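(* Let $0<b<B<1$, let $\beta\in[b,B]$ and $\sigma>0$ be fixed numbers, and let $d=d_\varepsilon\to\infty$ and $s=s_\varepsilon\to\infty$ be such that $s=o(d)$, $s=o(\log\varepsilon^{-1})$, $\log\log d=o(s)$ and $\varepsilon^2(\log d)^{1+2\sigma}=o(1)$ as $\varepsilon\to0$. Assume that the family of collections $r_\varepsilon=\{r_{\varepsilon,k},\,1\le k\le s\}$, $r_{\varepsilon,k}>0$, is such that (for arbitrary $u_k\in\mathcal U_{k,d}$, $1\le k\le s$) $$\liminf_{\varepsilon\to0}\min_{1\le k\le s}\frac{a_{\varepsilon,u_k}(r_{\varepsilon,k})}{\sqrt{2\log\binom{d}{k}}}>\sqrt\beta.$$ Then, for the aggregate adaptive selector $\hat{\boldsymbol\eta}=(\hat{\boldsymbol\eta}_1,\ldots,\hat{\boldsymbol\eta}_s)$ defined in the context (whose construction depends on $b,B,\sigma$ but not on $\beta$), $$\limsup_{\varepsilon\to0}\ \sup_{\boldsymbol\eta\in\mathcal H^s_{\beta,d}}\ \sup_{\boldsymbol\theta\in\Theta^\sigma_{s,d}(r_\varepsilon)}\mathrm E_{\boldsymbol\theta,\boldsymbol\eta}\left\{\sum_{k=1}^s\binom dk^{\beta-1}|\hat{\boldsymbol\eta}_k-\boldsymbol\eta_k|\right\}=0.$$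
   Context: Index sets. For $1\le k\le d$, $\mathcal U_{k,d}$ is the set of all subsets $u_k\subseteq\{1,\ldots,d\}$ with $k$ elements. For $u_k\in\mathcal U_{k,d}$, $\mathring{\mathbb Z}_{u_k}=\{\boldsymbol\ell=(l_1,\ldots,l_d)\in\mathbb Z^d:\ l_j=0 \text{ for } j\notin u_k,\ l_j\ne0\text{ for }j\in u_k\}$. Sparsity classes. $H^k_{\beta,d}=H^k_{\beta,d}(\varepsilon)$ is the set of $\boldsymbol\eta_k=(\eta_{u_k})_{u_k\in\mathcal U_{k,d}}$ with $\eta_{u_k}\in\{0,1\}$ and $\sum_{u_k\in\mathcal U_{k,d}}\eta_{u_k}=\binom dk^{1-\beta}(1+o(1))$ as $\varepsilon\to0$. The $o(1)$ is uniform (also in $1\le k\le s$): membership means $|\binom dk^{\beta-1}\sum\eta_{u_k}-1|\le\delta_\varepsilon$ for a fixed family $\delta_\varepsilon\to0$, large enough that all vectors with exactly $[\binom dk^{1-\beta}]$ ones (integer part) are included; one may think of the number of ones as being this integer part. $\mathcal H^s_{\beta,d}=\{\boldsymbol\eta=(\boldsymbol\eta_1,\ldots,\boldsymbol\eta_s):\boldsymbol\eta_k\in H^k_{\beta,d},\,1\le k\le s\}$. Ellipsoids. $c_{\boldsymbol\ell}^2=\big(\sum_{j=1}^d(2\pi l_j)^2\big)^\sigma$. For $r>0$, $\mathring\Theta_{\mathbf c_{u_k}}(r)$ is the set of real families $\boldsymbol\theta_{u_k}=(\theta_{\boldsymbol\ell}(u_k))_{\boldsymbol\ell\in\mathring{\mathbb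 Z}_{u_k}}$ with $\sum_{\boldsymbol\ell}\theta_{\boldsymbol\ell}^2(u_k)c_{\boldsymbol\ell}^2\le1$ and $\sum_{\boldsymbol\ell}\theta_{\boldsymbol\ell}^2(u_k)\ge r^2$. $\mathring\Theta^\sigma_{k,d}(r)$ is the set of $\boldsymbol\theta_k=(\boldsymbol\theta_{u_k})_{u_k\in\mathcal U_{k,d}}$ with $\boldsymbol\theta_{u_k}\in\mathring\Theta_{\mathbf c_{u_k}}(r)$ for every $u_k$. $\Theta^\sigma_{s,d}(r_\varepsilon)=\{\boldsymbol\theta=(\boldsymbol\theta_1,\ldots,\boldsymbol\theta_s):\boldsymbol\theta_k\in\mathring\Theta^\sigma_{k,d}(r_{\varepsilon,k}),\,1\le k\le s\}$. Standing convention: $r_{\varepsilon,k}\in(0,(2\pi)^{-\sigma}k^{-\sigma/2})$ (for larger radii the set is empty). Model. For noise level $\varepsilon>0$ one observes $X_{\boldsymbol\ell}=\eta_{u_k}\theta_{\boldsymbol\ell}(u_k)+\varepsilon\xi_{\boldsymbol\ell}$, $\boldsymbol\ell\in\mathring{\mathbb Z}_{u_k}$, $u_k\in\mathcal U_{k,d}$, $1\le k\le s$, where all $\xi_{\boldsymbol\ell}$ are i.i.d. $N(0,1)$. $\mathrm E_{\boldsymbol\theta,\boldsymbol\eta}$ is the expectation under this model. For $\{0,1\}$-valued vectors indexed by $\mathcal U_{k,d}$, $|\boldsymbol\eta_k-\boldsymbol\eta_k'|=\sum_{u_k\in\mathcal U_{k,d}}|\eta_{u_k}-\eta'_{u_k}|$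 (Hamming distance). Detection function. $a_{\varepsilon,u_k}(r)\ge0$ is given by $$a^2_{\varepsilon,u_k}(r)=\frac1{2\varepsilon^4}\inf_{\boldsymbol\theta_{u_k}\in\mathring\Theta_{\mathbf c_{u_k}}(r)}\sum_{\boldsymbol\ell\in\mathring{\mathbb Z}_{u_k}}\theta_{\boldsymbol\ell}(u_k)^4;$$ it depends on $u_k$ only through $k$. Let $(\theta^*_{\boldsymbol\ell}(r))_{\boldsymbol\ell\in\mathring{\mathbb Z}_{u_k}}$ be the minimizing sequence and $\omega_{\boldsymbol\ell}(r)=\dfrac{(\theta^*_{\boldsymbol\ell}(r))^2}{2\varepsilon^2a_{\varepsilon,u_k}(r)}$. Adaptive selector. Let $\epsilon=\epsilon_{\varepsilon}>0$ (not depending on $k$) be such that $\epsilon\to0$ and $\epsilon\log(d/s)\to\infty$ as $\varepsilon\to0$. For each $1\le k\le s$ (all limits below being as $\varepsilon\to0$, uniformly in $1\le k\le s$): let $\rho_k=\rho_{k,\varepsilon}>0$ be such that $\rho_k\to0$, $\rho_k\log\binom dk\to0$, $\rho_k\binom dk\to\infty$; put $M_k=\lceil(B-b)/\rho_k\rceil+1$ (here $\lceil x\rceil$ is the smallest integer strictly larger than $x$) and $\beta_{k,m}=b+(m-1)\rho_k$, $m=1,\ldots,M_k$. Let $r^*_{\varepsilon,k,m}>0$ be determined by $a_{\varepsilon,u_k}(r^*_{\varepsilon,k,m})=\sqrt{2\beta_{k,m}\log\binom dk}$, and $$S_{u_k}(\beta_{k,m})=\sum_{\boldsymbol\ell\in\mathring{\mathbb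 Z}_{u_k}}\omega_{\boldsymbol\ell}(r^*_{\varepsilon,k,m})\big[(X_{\boldsymbol\ell}/\varepsilon)^2-1\big],\qquad \hat\eta_{u_k}(\beta_{k,m})=\mathbf1\Big(S_{u_k}(\beta_{k,m})>\sqrt{(2\beta_{k,m}+\epsilon)\log\tbinom dk}\Big),$$ $\hat{\boldsymbol\eta}_k(\beta_{k,m})=(\hat\eta_{u_k}(\beta_{k,m}))_{u_k\in\mathcal U_{k,d}}$. Let $v_{j}=v_{j,k,d}=\binom dk^{1-\beta_{k,j}}/\tau_{k,d}$, where $\tau_{k,d}>0$ satisfies $\tau_{k,d}\to\infty$, $\binom dk^{\epsilon/8}/\tau_{k,d}\to0$ and $\tau_{k,d}/\binom dk^{\epsilon/2}\to0$. Define $$\hat m_k=\max\{1\le m\le M_k:\ |\hat{\boldsymbol\eta}_k(\beta_{k,m})-\hat{\boldsymbol\eta}_k(\beta_{k,j})|\le v_{j}\ \text{for all } j<m\}$$ and $\hat{\boldsymbol\eta}_k=\hat{\boldsymbol\eta}_k(\beta_{k,\hat m_k})$. The aggregate selector is $\hat{\boldsymbol\eta}=(\hat{\boldsymbol\eta}_1,\ldots,\hat{\boldsymbol\eta}_s)$. *)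

(* Defs.v *)
From HB Require Import structures.
From mathcomp Require Export all_boot all_order all_algebra.
From mathcomp Require Export finmap.
From mathcomp Require Export all_classical all_reals all_analysis.

Set Implicit Arguments.
Unset Strict Implicit.
Unset Printing Implicit Defensive.

Import Order.TTheory GRing.Theory Num.Theory.
Import numFieldNormedType.Exports.

Local Open Scope classical_set_scope.
Local Open Scope ring_scope.

(* The coordinates {1,...,d} are 'I_d, a frequency l in Z^d is a row
   vector, and the sets [freq_on u] are pairwise disjoint: l belongs to
   [freq_on u] only for u = [fsupp l]. Hence a family
   (theta_l(u)), l in [freq_on u], u in U_{k,d}, 1 <= k <= s, is one function
   of l, and a tuple (eta_1,...,eta_s) is one boolean function on subsets, of
   which eta_k is the part on [subsets d k]; values at subsets of size outside
   1..s (and at their frequencies) are never used. *)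

Section Indices.
Variable d : nat.

Definition subsets (k : nat) : {set {set 'I_d}} :=
  finset (fun u : {set 'I_d} => #|u| == k).

Definition freq_on (u : {set 'I_d}) : set 'rV[int]_d :=
  [set l | forall j, (l 0 j != 0) = (j \in u)].

Definition fsupp (l : 'rV[int]_d) : {set 'I_d} := finset (fun j => l 0 j != 0).

Definition subsets_upto (s : nat) : set {set 'I_d} :=
  [set u | (1 <= #|u| <= s)%N].

Definition hamming (k : nat) (eta eta' : {set 'I_d} -> bool) : nat :=
  \sum_(u in subsets k) (eta u != eta' u).

End Indices.

(* Sum of an absolutely summable family of reals over an index set that may be
   infinite. ([esum] alone is only meaningful for nonnegative families.) *)
Definition rsum (R : realType) (I : choiceType) (D : set I) (f : I -> R) : R :=
  fine (\esum_(i in D) (Num.max (f i) 0)%:E)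
  - fine (\esum_(i in D) (Num.max (- f i) 0)%:E).

Definition binr (R : realType) (d k : nat) : R := ('C(d, k))%:R.

Section Ellipsoids.
Variables (R : realType) (d : nat) (sigma : R).

Definition csq (l : 'rV[int]_d) : R :=
  (\sum_j (2 * pi * (l 0 j)%:~R) ^+ 2) `^ sigma.

Definition ellipsoid (u : {set 'I_d}) (r : R) : set ('rV[int]_d -> R) :=
  [set theta |
     (\esum_(l in freq_on u) (theta l ^+ 2 * csq l)%:E <= 1)%E /\
     ((r ^+ 2)%:E <= \esum_(l in freq_on u) (theta l ^+ 2)%:E)%E].

(* Theta^sigma_{s,d}(r) for a collection of radii r_1,...,r_s *)
Definition signals (s : nat) (r : nat -> R) : set ('rV[int]_d -> R) :=
  [set theta | forall u, subsets_upto s u -> ellipsoid u (r #|u|) theta].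

Definition quartic (u : {set 'I_d}) (theta : 'rV[int]_d -> R) : \bar R :=
  \esum_(l in freq_on u) (theta l ^+ 4)%:E.

Definition is_minimizer (u : {set 'I_d}) (r : R) (theta : 'rV[int]_d -> R) :=
  ellipsoid u r theta /\
  forall theta', ellipsoid u r theta' -> (quartic u theta <= quartic u theta')%E.

(* The infimum over an empty ellipsoid is +oo, which [fine] sends to 0; when
   the ellipsoid is nonempty the infimum is finite. *)
Definition detection (eps : R) (u : {set 'I_d}) (r : R) : R :=
  Num.sqrt (fine ((2 * eps ^+ 4)^-1%:E *
                  ereal_inf [set quartic u theta | theta in ellipsoid u r])%E).

End Ellipsoids.

Section SparsityClasses.
Variables (R : realType) (d : nat) (beta delta : R).

Definition sparse_class (k : nat) : set ({set 'I_d} -> bool) :=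
  [set eta | `| binr R d k `^ (beta - 1) *
                (\sum_(u in subsets d k) (eta u : nat))%N%:R - 1 | <= delta].

Definition sparse_classes (s : nat) : set ({set 'I_d} -> bool) :=
  [set eta | forall k, (1 <= k <= s)%N -> sparse_class k eta].

End SparsityClasses.

(* [thetastar m] is meant to be, on each [freq_on u], the minimizing sequence
   of radius [rstar #|u| m]; [kappa] is the slack epsilon in the threshold of
   the selector. *)
Section Selector.
Variables (R : realType) (d : nat) (sigma eps b B kappa : R).
Variables (rho tau : nat -> R) (rstar : nat -> nat -> R).
Variable thetastar : nat -> 'rV[int]_d -> R.

Definition grid (k m : nat) : R := b + m.-1%:R * rho k.

(* For x >= 0 the smallest integer strictly larger than x is (truncn x).+1. *)
Definition grid_size (k : nat) : nat := (Num.truncn ((B - b) / rho k)).+2.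

Definition weight (u : {set 'I_d}) (m : nat) (l : 'rV[int]_d) : R :=
  thetastar m l ^+ 2 / (2 * eps ^+ 2 * detection sigma eps u (rstar #|u| m)).

Definition Sstat (x : 'rV[int]_d -> R) (m : nat) (u : {set 'I_d}) : R :=
  rsum (freq_on u) (fun l => weight u m l * ((x l / eps) ^+ 2 - 1)).

Definition selector_at (x : 'rV[int]_d -> R) (m : nat) (u : {set 'I_d}) : bool :=
  Num.sqrt ((2 * grid #|u| m + kappa) * ln (binr R d #|u|)) < Sstat x m u.

Definition vthr (k j : nat) : R := binr R d k `^ (1 - grid k j) / tau k.

Definition mhat (x : 'rV[int]_d -> R) (k : nat) : nat :=
  \max_(1 <= m < (grid_size k).+1 |
        all (fun j => (hamming k (selector_at x m) (selector_at x j))%:R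
                      <= vthr k j) (index_iota 1 m)) m.

Definition selector (x : 'rV[int]_d -> R) (u : {set 'I_d}) : bool :=
  selector_at x (mhat x #|u|) u.

End Selector.

Definition observation (R : realType) (d : nat) (eps : R)
    (eta : {set 'I_d} -> bool) (theta xi : 'rV[int]_d -> R)
    (l : 'rV[int]_d) : R :=
  (eta (fsupp l))%:R * theta l + eps * xi l.

Definition iid_std_normal (R : realType) (disp : measure_display)
    (T : measurableType disp) (P : probability T R) (I : choiceType)
    (D : set I) (xi : I -> {RV P >-> R}) : Prop :=
  (forall i, D i -> forall A : set R, measurable A ->
     distribution P (xi i) A = normal_prob 0 1 A) /\
  (forall (J : {fset I}) (A : I -> set R),
     [set` J] `<=` D -> (forall i, measurable (A i)) ->
     P (\bigcap_(i in [set` J]) (xi i @^-1` A i)) =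
     (\prod_(i <- J) P (xi i @^-1` A i))%E).

(* Limits as eps -> 0+ that are uniform in 1 <= k <= s(eps). *)
Definition unif_cvg0 (R : realType) (s : R -> nat) (f : R -> nat -> R) : Prop :=
  forall e : R, 0 < e ->
    \forall eps \near 0^'+, forall k, (1 <= k <= s eps)%N -> `| f eps k | < e.

Definition unif_cvgy (R : realType) (s : R -> nat) (f : R -> nat -> R) : Prop :=
  forall A : R,
    \forall eps \near 0^'+, forall k, (1 <= k <= s eps)%N -> A < f eps k.

(* Main.v *)
Require Import Defs.
From mathcomp Require Import all_boot all_order all_algebra.
From mathcomp Require Import all_classical all_reals all_analysis.
From mathcomp Require Import measurable_realfun lra zify.

Set Implicit Arguments.
Unset Strict Implicit.
Unset Printing Implicit Defensive.

Import Order.TTheory GRing.Theory Num.Theory.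
Import numFieldNormedType.Exports.

Local Open Scope classical_set_scope.
Local Open Scope ring_scope.

(* On the lattice points with support [u], the minimizer of the quartic sum has the
   form theta^2 = max(A - B csq, 0). Summation by parts on the lattice shows that
   such a profile is not concentrated around its mean; as a consequence a signal
   whose detection function exceeds the critical one by a factor 1 + nu moves the
   mean of the statistic by a factor 1 + gap, with gap > 0 independent of k. As
   s = o(log(1/eps)) and log log d = o(s), the minimizer spreads over so many
   frequencies that all weights are at most a power of eps, whereas log C(d,k) is a
   smaller power of 1/eps, so that the chi-square statistics have Gaussian-type
   exponential moments: a false positive at level beta_m has probability at most
   of order n^(-beta_m - kappa/2), with n = C(d,k), and a miss at most n^(-c).

   Let m0 be the largest grid index with beta_m0 <= beta. For m <= m0 the mean
   number of errors at level m is at most v_m / 12, and the number of errors has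
   exponential moments, so that Lepski's comparisons reject m0 with probability
   exp(- v_m0 / 4) up to polynomial factors in n, while acceptance of m0 keeps the
   selector within v_m0 of the one at level m0. Hence the normalized risk at size k
   is O(n^(-kappa/8)). Finally C(d,k) >= (d/s)^k turns the sum over k into a
   geometric series with ratio exp(- kappa log(d/s) / 8), which tends to 0. *)

(** * Exponential moments of independent Gaussian variables *)

(** The separation hypothesis compares the detection function at two radii, but the weights of the
    statistic come from the minimizer at the critical radius. Convexity of the quartic sum in the
    squares only gives a mean at least equal to the critical level, with no room for the slack in
    the threshold. The room comes from a test signal: at constant energy, the squares of the
    minimizer are raised where they exceed their size-biased mean and lowered elsewhere. Its quartic
    sum stays below that of every signal of the separated radius, so its mass cannot reach that
    radius; through the Lagrange multipliers this gain in mass becomes a gain in the mean. The gain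
    is a one-sided deviation of [C - csq] from its size-biased mean. The delicate point is to bound
    it below uniformly in k while k may tend to infinity: one summation by parts gains a factor k
    for the second moment, another loses a factor k for the first moment, and the two cancel. All
    bounds are explicit at fixed noise; limits are taken only in the last proof. *)

Section Transfer.
Import HBSimple HBNNSimple.
Context (d1 d2 : measure_display) (X : measurableType d1) (Y : measurableType d2)
  (R : realType).
Variables (mu : {measure set X -> \bar R}) (nu : {measure set Y -> \bar R}).
Variables (phi : X -> Y) (h : X -> R) (K : R).
Hypotheses (mphi : measurable_fun setT phi) (mh : measurable_fun setT h).
Hypothesis h_ge0 : forall x, 0 <= h x.
Hypothesis nuE : forall A, measurable A ->
  (\int[mu]_x (\1_A (phi x) * h x)%:E = K%:E * nu A)%E.

(** Extension from indicators to simple functions, then monotone convergence. It serves twice: with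
    [phi] the identity and [h] the normal density it turns normal expectations into Lebesgue
    integrals; with [phi] one noise coordinate and [h] a product over the others it integrates that
    coordinate out. *)
Lemma ge0_integral_transfer (f : Y -> R) : measurable_fun setT f ->
  (forall y, 0 <= f y) ->
  (\int[mu]_x (f (phi x) * h x)%:E = K%:E * \int[nu]_y (f y)%:E)%E.
Proof.
move=> mf f_ge0.
have mEf : measurable_fun [set: Y] (fun y => (f y)%:E) by exact/measurable_EFinP.
pose g := nnsfun_approx measurableT mEf.
have Ef_ge0 y : setT y -> (0 <= (f y)%:E)%E by rewrite lee_fin.
have mgphi n : measurable_fun setT (fun x => (g n (phi x) * h x)%:E).
  apply/measurable_EFinP; apply: measurable_funM => //.
  exact: measurableT_comp.
have g_nd y : {homo (fun n => g n y) : n m / (n <= m)%N >-> n <= m}.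
  by move=> n m nm; have /lefP := nd_nnsfun_approx measurableT mEf nm; exact.
have step n : (\int[mu]_x (g n (phi x) * h x)%:E = K%:E * \int[nu]_y (g n y)%:E)%E.
  rewrite integral_nnsfun// patch_setT sintegralE.
  under eq_integral => x _.
    rewrite fimfunE fsbig_finite//= mulr_suml -sumEFin; over.
  rewrite /= ge0_integral_sum//; first last.
  - move=> y x _; rewrite lee_fin mulr_ge0// indicE.
    have [|_] := boolP (phi x \in g n @^-1` [set y]); last by rewrite mulr0.
    by rewrite inE /= => <-; rewrite mulr1.
  - move=> y; apply/measurable_EFinP; apply: measurable_funM => //.
    apply: measurable_funM => //; apply: (measurableT_comp _ mphi).
    by apply: measurable_indic; exact: measurable_sfunP.
  rewrite fsbig_finite//= ge0_sume_distrr; last first.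
    move=> y _; have [y0|y0] := leP 0 y; first by rewrite mule_ge0 ?lee_fin.
    rewrite preimage_nnfun0// measure0 mule0//.
  apply: eq_bigr => y _; rewrite muleCA -nuE; last exact: measurable_sfunP.
  have [y0|y0] := leP 0 y.
    rewrite -ge0_integralZl//=.
    + by apply: eq_integral => x _; rewrite -EFinM mulrA.
    + apply/measurable_EFinP; apply: measurable_funM => //.
      apply: (measurableT_comp _ mphi).
      by apply: measurable_indic; exact: measurable_sfunP.
    + by move=> x _; rewrite lee_fin mulr_ge0.
  rewrite preimage_nnfun0//.
  under eq_integral do rewrite indic0 mulr0 mul0r.
  under [in RHS]eq_integral do rewrite indic0 mul0r.
  by rewrite !integral0 mule0.
have L1 : (\int[mu]_x (g n (phi x) * h x)%:E @[n --> \oo] -->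
   \int[mu]_x (f (phi x) * h x)%:E)%E.
  have -> : (\int[mu]_x (f (phi x) * h x)%:E =
     \int[mu]_x limn (fun n => (g n (phi x) * h x)%:E))%E.
    apply: eq_integral => x _; apply/esym/cvg_lim => //.
    under eq_fun do rewrite EFinM.
    rewrite EFinM; apply: cvgeMr => //.
    exact: (cvg_nnsfun_approx measurableT mEf Ef_ge0 (x := phi x) I).
  apply: cvg_monotone_convergence => //.
    by move=> n x _; rewrite lee_fin mulr_ge0.
  by move=> x _ n m nm; rewrite lee_fin ler_wpM2r// g_nd.
have L2 : (K%:E * \int[nu]_y (g n y)%:E @[n --> \oo] --> K%:E * \int[nu]_y (f y)%:E)%E.
  apply: cvgeMl => //.
  have -> : (\int[nu]_y (f y)%:E = \int[nu]_y limn (fun n => (g n y)%:E))%E.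
    apply: eq_integral => y _; apply/esym/cvg_lim => //.
    exact: (cvg_nnsfun_approx measurableT mEf Ef_ge0 (x := y) I).
  apply: cvg_monotone_convergence => //.
  - by move=> n; exact/measurable_EFinP.
  - by move=> n x _; rewrite lee_fin.
  - by move=> x _ n m nm; rewrite lee_fin g_nd.
rewrite (funext step) in L1.
exact: (cvg_unique _ L1 L2).
Qed.
End Transfer.

Section Gaussian.
Variable R : realType.
Implicit Types a b c x : R.

(** Completing the square: with [v = 1 - 2 * a], the integrand times the standard density is a
    constant times the normal density of mean [b / v] and variance [v^-1]. *)
Lemma normal_expR_quadratic a b c : a < 2^-1 ->
  (\int[normal_prob 0 1]_x (expR (a * x ^+ 2 + b * x + c))%:E =
   ((Num.sqrt (1 - 2 * a))^-1 * expR (b ^+ 2 / (2 * (1 - 2 * a)) + c))%:E)%E.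
Proof.
move=> a_lt; set v := 1 - 2 * a; have v_gt0 : 0 < v by rewrite /v; lra.
have sv_gt0 : 0 < Num.sqrt v by rewrite sqrtr_gt0.
pose s := (Num.sqrt v)^-1; have s_gt0 : 0 < s by rewrite invr_gt0.
have s2 : s ^+ 2 = v^-1 by rewrite /s exprVn sqr_sqrtr// ltW.
pose f x := expR (a * x ^+ 2 + b * x + c).
have mf : measurable_fun [set: R] f.
  apply: measurableT_comp => //; apply: measurable_funD => //.
  apply: measurable_funD; apply: measurable_funM => //.
pose p := @normal_pdf R 0 1.
have mp : measurable_fun [set: R] p by exact: measurable_normal_pdf.
have := @ge0_integral_transfer _ _ _ _ R lebesgue_measure (normal_prob 0 1) id p 1
  (@measurable_id _ _ setT) mp (normal_pdf_ge0 0 1).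
move=> /(_ _ f mf (fun x => expR_ge0 _)); rewrite mul1e => <-; last first.
  move=> A mA; rewrite mul1e.
  transitivity (\int[lebesgue_measure]_(x in A) (p x)%:E)%E; last by [].
  rewrite [RHS]integral_mkcond.
  apply: eq_integral => x _; rewrite patchE indicE.
  by case: ifPn; rewrite ?mul1r ?mul0r.
have E x : f x * p x =
    s * expR (b ^+ 2 / (2 * v) + c) * normal_pdf (b / v) s x.
  rewrite /p !normal_pdfE ?oner_eq0 ?(gt_eqF s_gt0)//.
  rewrite /normal_peak /normal_fun s2 expr1n mul1r subr0.
  have -> : Num.sqrt (v^-1 * pi *+ 2) = s * Num.sqrt (pi *+ 2).
    rewrite -mulrnAr sqrtrM ?invr_ge0 ?ltW//; congr (_ * _).
    by rewrite /s sqrtrV// ltW.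
  have regroup (y i q e1 e2 : R) : y * e1 * ((i * q) * e2) = (y * i) * (q * (e1 * e2)).
    lra.
  rewrite (invfM s).
  rewrite regroup divff ?(gt_eqF s_gt0)// mul1r mulrCA /f -!expRD; congr (_ * expR _).
  have v0 : v != 0 by rewrite gt_eqF.
  have -> : b ^+ 2 / (2 * v) = b * (b / v) / 2 by rewrite invfM; lra.
  have -> : (v^-1 *+ 2)^-1 = v / 2 by rewrite -[v^-1 *+ 2]mulr_natr invfM invrK.
  set q := b / v; have -> : b = q * v by rewrite /q mulfVK.
  rewrite /v; lra.
under eq_integral do rewrite /= E EFinM.
rewrite ge0_integralZl//=.
- by rewrite integral_normal_pdf mule1.
- by apply/measurable_EFinP; exact: measurable_normal_pdf.
- by move=> x _; rewrite lee_fin normal_pdf_ge0.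
- by rewrite lee_fin mulr_ge0 ?expR_ge0 ?ltW.
Qed.
End Gaussian.

Lemma prod_indic (R : pzRingType) (I : Type) (X : Type) (A : I -> set X) (x : I -> X)
    (K : seq I) :
  \prod_(l <- K) \1_(A l) (x l) = (all (fun l => x l \in A l) K)%:R :> R.
Proof.
elim: K => [|l K IH]; first by rewrite big_nil.
by rewrite big_cons IH indicE -natrM mulnb.
Qed.

Section IndependentProducts.
Context (R : realType) (disp : measure_display) (T : measurableType disp)
  (P : probability T R) (I : choiceType) (D : set I) (xi : I -> {RV P >-> R}).
Hypothesis xi_iid : iid_std_normal D xi.
Variables (e : I -> R -> R) (phi : I -> R).
Hypotheses (me : forall l, measurable_fun setT (e l))
  (e_ge0 : forall l x, 0 <= e l x).
Hypothesis phiE : forall l, (\int[normal_prob 0 1]_x (e l x)%:E = (phi l)%:E)%E.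

Lemma measurable_prod_comp (J : seq I) (f : I -> R -> R) :
  (forall l, measurable_fun setT (f l)) ->
  measurable_fun setT (fun w : T => \prod_(l <- J) f l (xi l w)).
Proof.
move=> mf; apply: measurable_prod => l _.
exact: measurableT_comp (mf l) (measurable_funPT (xi l)).
Qed.

(** Independence is given for events only. The indicators over [K] make the induction on [J]
    possible: to treat the head [j], the transfer needs the formula with [e j] replaced by an
    arbitrary indicator, and this is the induction hypothesis with [j] moved to [K]. *)
Lemma integral_prod_mixed (J K : seq I) (A : I -> set R) :
  uniq (J ++ K) -> (forall l, l \in J ++ K -> D l) ->
  (forall l, measurable (A l)) ->
  (\int[P]_w ((\prod_(l <- J) e l (xi l w)) *
              \prod_(l <- K) \1_(A l) (xi l w))%:E =
   ((\prod_(l <- J) phi l) * \prod_(l <- K) fine (normal_prob 0 1 (A l)))%:E)%E.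
Proof.
elim: J K A => [|j J IH] K A.
  rewrite cat0s => uK KD mA.
  have inD : [set` [fset x in K]%fset] `<=` D.
    by move=> l /=; rewrite inE => /KD.
  have [distE indep] := xi_iid.
  have := indep [fset x in K]%fset A inD mA.
  have perm : perm_eq [fset x in K]%fset K.
    by apply: uniq_perm => // x; rewrite inE.
  rewrite (perm_big _ perm) => PE.
  rewrite big_nil mul1r.
  have -> : (\prod_(l <- K) fine (normal_prob 0 1 (A l)))%:E =
      (\prod_(i <- K) P (xi i @^-1` A i))%E.
    rewrite big_seq [RHS]big_seq -prodEFin; apply: eq_bigr => l /KD Dl.
    transitivity (normal_prob 0 1 (A l)); last exact/esym/distE.
    by apply: fineK; exact: (fin_num_measure (normal_prob 0 1) (A l) (mA l)).
  rewrite -PE -(setIT (\bigcap_(i in _) _)) -integral_indic//; last first.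
    apply: fin_bigcap_measurable; first exact: finite_fset.
    by move=> l _; rewrite -[_ @^-1` _]setTI; exact: measurable_funPT.
  apply: eq_integral => w _; rewrite big_nil mul1r prod_indic indicE.
  suff -> : all (fun l => xi l w \in A l) K =
    (w \in \bigcap_(i in [set` [fset x in K]%fset]) (xi i @^-1` A i)) by [].
  apply/allP/idP => /=; rewrite inE /=.
    by move=> AK l /=; rewrite inE => /AK; rewrite inE.
  by move=> AK l lK; rewrite inE; apply: (AK l); rewrite /= inE.
rewrite cat_cons /= => /andP[jJK uJK] JKD mA.
pose h w := (\prod_(l <- J) e l (xi l w)) * \prod_(l <- K) \1_(A l) (xi l w).
pose c := (\prod_(l <- J) phi l) * \prod_(l <- K) fine (normal_prob 0 1 (A l)).
have mh : measurable_fun setT h.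
  apply: measurable_funM; first exact: (measurable_prod_comp J me).
  apply: (@measurable_prod_comp K (fun l => \1_(A l))) => l.
  by apply: measurable_indic; exact: mA.
have h_ge0 w : 0 <= h w.
  by apply: mulr_ge0; apply: prodr_ge0.
under eq_integral do rewrite big_cons -mulrA.
rewrite big_cons -mulrA mulrC EFinM -phiE.
suff nuE (B : set R) (mB : measurable B) :
    (\int[P]_w (\1_B (xi j w) * h w)%:E = c%:E * normal_prob 0 1 B)%E.
  have mxi : measurable_fun setT (xi j) by [].
  exact: (@ge0_integral_transfer _ _ _ _ _ P (normal_prob 0 1) _ _ c mxi mh h_ge0
    nuE (e j) (me j) (e_ge0 j)).
pose A' l := if l == j then B else A l.
have perm : perm_eq (J ++ j :: K) (j :: J ++ K) by rewrite -cat1s perm_catCA.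
have jK : j \notin K by move: jJK; rewrite mem_cat negb_or => /andP[].
have A'E l : l \in K -> A' l = A l.
  by rewrite /A'; case: eqP => // -> /(negP jK).
have -> : (c%:E * normal_prob 0 1 B = (\prod_(l <- J) phi l *
    \prod_(l <- j :: K) fine (normal_prob 0 1 (A' l)))%:E)%E.
  rewrite big_cons {1}/A' eqxx -(@fineK _ (normal_prob 0 1 B)); last first.
    exact: (fin_num_measure (normal_prob 0 1) B mB).
  rewrite -EFinM mulrCA mulrC; congr (_ * (_ * _))%:E.
  by rewrite big_seq [RHS]big_seq; apply: eq_bigr => l /A'E ->.
rewrite -IH.
- apply: eq_integral => w _; rewrite big_cons {1}/A' eqxx mulrCA.
  congr (_ * (_ * _))%:E.
  by rewrite big_seq [RHS]big_seq; apply: eq_bigr => l /A'E ->.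
- by rewrite (perm_uniq perm) /= jJK.
- by move=> l; rewrite (perm_mem perm); exact: JKD.
- by move=> l; rewrite /A'; case: eqP.
Qed.

Lemma integral_prod (J : seq I) : uniq J -> (forall l, l \in J -> D l) ->
  (\int[P]_w (\prod_(l <- J) e l (xi l w))%:E = (\prod_(l <- J) phi l)%:E)%E.
Proof.
move=> uJ JD; have := @integral_prod_mixed J [::] (fun=> setT).
rewrite cats0 big_nil mulr1 => <- //.
by apply: eq_integral => w _; rewrite big_nil mulr1.
Qed.

Let phi_ge0 l : 0 <= phi l.
Proof. by rewrite -lee_fin -phiE integral_ge0// => x _; rewrite lee_fin. Qed.

(** Expanding the factor of one block gives two terms of the same form, one where the block
    disappears and one where it joins [J]; hence the free list [J] in the statement. *)
Lemma integral_prod_blocks (U : eqType) (us : seq U) (blk : U -> seq I)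
    (J : seq I) (c : U -> R) : (forall u, 0 <= c u) ->
  uniq (J ++ flatten [seq blk u | u <- us]) ->
  (forall l, l \in J ++ flatten [seq blk u | u <- us] -> D l) ->
  (\int[P]_w (\prod_(l <- J) e l (xi l w) *
     \prod_(u <- us) (1 + c u * \prod_(l <- blk u) e l (xi l w)))%:E =
   (\prod_(l <- J) phi l * \prod_(u <- us) (1 + c u * \prod_(l <- blk u) phi l))%:E)%E.
Proof.
move=> c_ge0; elim: us J => [|u us IH] J /=.
  rewrite cats0 big_nil mulr1 => uJ JD; rewrite -integral_prod//.
  by apply: eq_integral => w _; rewrite big_nil mulr1.
rewrite catA => uJ JD.
pose rest (w : T) := \prod_(u <- us) (1 + c u * \prod_(l <- blk u) e l (xi l w)).
have uJ' : uniq (J ++ flatten [seq blk u | u <- us]).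
  by apply: subseq_uniq uJ; apply: cat_subseq => //; exact: prefix_subseq.
have JD' l : l \in J ++ flatten [seq blk u | u <- us] -> D l.
  move=> lJ; apply: JD; move: lJ; rewrite !mem_cat.
  by case/orP => ->; rewrite ?orbT.
have mrest : measurable_fun setT rest.
  apply: measurable_prod => v _; apply: measurable_funD => //.
  by apply: measurable_funM => //; exact: measurable_prod_comp.
have rest_ge0 w : 0 <= rest w.
  apply: prodr_ge0 => v _; apply: addr_ge0 => //; apply: mulr_ge0 => //.
  exact: prodr_ge0.
have mJ K : measurable_fun setT (fun w => (\prod_(l <- K) e l (xi l w) * rest w)).
  by apply: measurable_funM => //; exact: measurable_prod_comp.
have J_ge0 K w : 0 <= \prod_(l <- K) e l (xi l w) * rest w.
  by apply: mulr_ge0 => //; exact: prodr_ge0.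
have E w : \prod_(l <- J) e l (xi l w) *
   \prod_(u <- u :: us) (1 + c u * \prod_(l <- blk u) e l (xi l w)) =
   \prod_(l <- J) e l (xi l w) * rest w +
   c u * (\prod_(l <- J ++ blk u) e l (xi l w) * rest w).
  rewrite big_cons big_cat /= -/(rest w); lra.
under eq_integral do rewrite E EFinD.
rewrite ge0_integralD//; first last.
- by apply/measurable_EFinP; apply: measurable_funM.
- by move=> w _; rewrite lee_fin mulr_ge0.
- exact/measurable_EFinP.
- by move=> w _; rewrite lee_fin.
under [X in (_ + X)%E]eq_integral do rewrite EFinM.
rewrite ge0_integralZl_EFin//; first last.
- exact/measurable_EFinP.
- by move=> w _; rewrite lee_fin.
rewrite IH// IH// -EFinM -EFinD big_cons big_cat /=; congr (_%:E); lra.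
Qed.

End IndependentProducts.

(** * Laplace transforms of central and shifted chi-square variables *)

Section ExponentialBounds.
Variable R : realType.
Implicit Types x y z : R.

Lemma expR_ge_taylor3 y : 0 <= y -> 1 + y + y ^+ 2 / 2 + y ^+ 3 / 6 <= expR y.
Proof.
move=> y_ge0; have -> : 1 + y + y ^+ 2 / 2 + y ^+ 3 / 6 = series (exp_coeff y) 4.
  rewrite /series /= /exp_coeff /= !big_nat_recr//= big_nil add0r.
  by rewrite expr0 expr1 !divr1.
apply: nondecreasing_cvgn_le (is_cvg_series_exp_coeff y) 4%N => //.
apply: nondecreasing_series => n _ _; exact: exp_coeff_ge0.
Qed.

(** The left side is the mean of [expR (z * (x ^+ 2 - 1))] for a standard normal [x]. In the proof,
    [y] majorizes [- ln (1 - 2 * z)], whose expansion is 2z + 2z^2 + 8z^3/3 + ...; for z at most 1/8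
    the coefficient 8 of the cube absorbs the tail. *)
Lemma chi2_mgf_le z zeta : 0 <= z <= zeta -> zeta <= 8^-1 ->
  (Num.sqrt (1 - 2 * z))^-1 * expR (- z) <= expR (z ^+ 2 * (1 + 4 * zeta)).
Proof.
move=> /andP[z_ge0 z_le] zeta_le; have v_gt0 : 0 < 1 - 2 * z by lra.
pose y := 2 * z + 2 * z ^+ 2 + 8 * z ^+ 3.
have z2 : 0 <= z ^+ 2 by exact: sqr_ge0.
have z3 : 0 <= z ^+ 3 by exact: exprn_ge0.
have ybig : 1 <= (1 - 2 * z) * expR y.
  apply: (@le_trans _ _ ((1 - 2 * z) * (1 + y + y ^+ 2 / 2 + y ^+ 3 / 6))).
    pose y0 := 2 * z + 2 * z ^+ 2.
    have y0_ge0 : 0 <= y0 by rewrite /y0; lra.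
    have yy0 : y0 <= y by rewrite /y /y0; lra.
    have z4 : z ^+ 4 <= z ^+ 3 / 8.
      by rewrite (exprS z 3) mulrC ler_wpM2l//; lra.
    apply: (@le_trans _ _ ((1 - 2 * z) * (1 + y + y0 ^+ 2 / 2 + (2 * z) ^+ 3 / 6))).
      rewrite /y /y0.
      have z5 : z ^+ 5 <= z ^+ 4 / 8.
        by rewrite (exprS z 4) mulrC ler_wpM2l ?exprn_ge0//; lra.
      lra.
    rewrite ler_wpM2l//; first exact: ltW.
    have s2 : y0 ^+ 2 <= y ^+ 2 by rewrite lerXn2r ?nnegrE//; lra.
    have : (2 * z) ^+ 3 <= y ^+ 3 by rewrite lerXn2r ?nnegrE// /y; lra.
    lra.
  apply: ler_wpM2l; first exact: ltW.
  by apply: expR_ge_taylor3; rewrite /y; lra.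
rewrite ler_pdivrMl ?sqrtr_gt0//.
rewrite -(@ler_pXn2r _ 2) ?nnegrE ?mulr_ge0 ?expR_ge0 ?sqrtr_ge0//.
rewrite exprMn sqr_sqrtr ?(ltW v_gt0)// -!expRM_natl.
apply: (@le_trans _ _ (expR (2 * - z) * ((1 - 2 * z) * expR y))).
  by rewrite ler_peMr// expR_ge0.
rewrite mulrCA -expRD ler_wpM2l ?(ltW v_gt0)// ler_expR /y.
have : z ^+ 3 <= z ^+ 2 * zeta by rewrite exprSr ler_wpM2l.
lra.
Qed.

(** The left side is the mean of [expR (- z * ((mu + x) ^+ 2 - 1))] for a standard normal [x]. The
    square root is handled by the identity (1 - 2z + 4z^2)(1 + 2z) = 1 + 8z^3, which is at least
    1. *)
Lemma chi2_shift_mgf_le z mu zeta : 0 <= z <= zeta ->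
  (Num.sqrt (1 + 2 * z))^-1 * expR (- z * (mu ^+ 2 - 1) + 2 * z ^+ 2 * mu ^+ 2 / (1 + 2 * z))
   <= expR (- z * mu ^+ 2 * (1 - 2 * zeta) + 2 * z ^+ 2).
Proof.
move=> /andP[z_ge0 z_le]; have v_gt0 : 0 < 1 + 2 * z by lra.
have mu2 : 0 <= mu ^+ 2 by exact: sqr_ge0.
have z2 : 0 <= z ^+ 2 by exact: sqr_ge0.
have sq : 1 <= expR (2 * z ^+ 2 - z) * Num.sqrt (1 + 2 * z).
  rewrite -(@ler_pXn2r _ 2) ?nnegrE ?mulr_ge0 ?expR_ge0 ?sqrtr_ge0//.
  rewrite exprMn sqr_sqrtr ?(ltW v_gt0)// -!expRM_natl expr1n.
  have := expR_ge1Dx (2%:R * (2 * z ^+ 2 - z)).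
  have [e2 _|e2 h] := lerP (1 + 2%:R * (2 * z ^+ 2 - z)) 0; last first.
    nra.
  exfalso; nra.
rewrite ler_pdivrMl ?sqrtr_gt0//.
apply: (@le_trans _ _ (expR (- z * (mu ^+ 2 - 1) + 2 * z ^+ 2 * mu ^+ 2 / (1 + 2 * z)) *
   (expR (2 * z ^+ 2 - z) * Num.sqrt (1 + 2 * z)))).
  by rewrite ler_peMr// expR_ge0.
rewrite mulrA -expRD mulrC ler_wpM2l ?sqrtr_ge0// ler_expR.
have : 2 * z ^+ 2 * mu ^+ 2 / (1 + 2 * z) <= 2 * z * mu ^+ 2 * zeta.
  rewrite ler_pdivrMr//.
  have := mulr_ge0 z_ge0 mu2; move=> zm.
  have : z * (z * mu ^+ 2) <= zeta * (z * mu ^+ 2) by rewrite ler_wpM2r.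
  have : 0 <= zeta * (z * mu ^+ 2) by rewrite mulr_ge0//; lra.
  nra.
lra.
Qed.
End ExponentialBounds.

(** * Sums over lattice points with given support *)

Lemma powR_homo (R : realType) (a x y : R) : 0 <= a -> 0 <= x -> x <= y ->
  x `^ a <= y `^ a.
Proof.
by move=> a0 x0 xy; apply: ge0_ler_powR => //; rewrite nnegrE//; exact: le_trans xy.
Qed.

Section Lattice.
Variables (R : realType) (d : nat) (sigma : R).
Hypothesis sigma_gt0 : 0 < sigma.
Implicit Types (l : 'rV[int]_d) (u : {set 'I_d}) (j : 'I_d) (C : R).

Local Notation c := (@csq R d sigma).

Definition coord l j : R := `|(l 0 j)%:~R|.
Definition normsq l : R := \sum_j coord l j ^+ 2.

Lemma freq_onE u l : freq_on u l <-> fsupp l = u.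
Proof.
split=> [lu|<- j]; last by rewrite inE.
by apply/setP => j; rewrite inE lu.
Qed.

Lemma coord_ge0 l j : 0 <= coord l j.
Proof. exact: normr_ge0. Qed.

Lemma coord_ge1 l j : j \in fsupp l -> 1 <= coord l j.
Proof.
rewrite inE /coord -intr_norm -[1]/(1%:~R) ler_int.
by rewrite -gtz0_ge1 normr_gt0.
Qed.

Lemma coord_eq0 l j : j \notin fsupp l -> coord l j = 0.
Proof. by rewrite inE negbK /coord => /eqP ->; rewrite normr0. Qed.

Lemma normsqE l : normsq l = \sum_(j in fsupp l) coord l j ^+ 2.
Proof.
rewrite /normsq (bigID (mem (fsupp l))) /= [X in _ + X]big1 ?addr0// => j.
by move=> /coord_eq0 ->; rewrite expr0n.
Qed.

Lemma coord_le_normsq l j : coord l j ^+ 2 <= normsq l.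
Proof.
by rewrite /normsq (bigD1 j)//= lerDl sumr_ge0// => i _; exact: sqr_ge0.
Qed.

Lemma normsq_ge0 l : 0 <= normsq l.
Proof. by apply: sumr_ge0 => j _; exact: sqr_ge0. Qed.

Lemma card_le_normsq l : #|fsupp l|%:R <= normsq l.
Proof.
rewrite normsqE -sumr_const; apply: ler_sum => j /coord_ge1 h.
by rewrite -[1](expr1n _ 2) lerXn2r// nnegrE ?ler01//; exact: le_trans h.
Qed.

Let four_pi2_gt0 : 0 < 4 * pi ^+ 2 :> R.
Proof. by rewrite mulr_gt0// exprn_gt0// pi_gt0. Qed.

Lemma csqE l : c l = (4 * pi ^+ 2 * normsq l) `^ sigma.
Proof.
rewrite /csq /normsq mulr_sumr; congr (_ `^ _); apply: eq_bigr => j _.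
rewrite /coord; move: (_%:~R : R) => z; rewrite real_normK ?num_real//.
move: (pi : R) => p; lra.
Qed.

Lemma csq_ge0 l : 0 <= c l. Proof. by rewrite csqE powR_ge0. Qed.

Lemma csq_lt l (t : R) : 0 <= t ->
  (c l < (4 * pi ^+ 2 * t) `^ sigma) = (normsq l < t).
Proof.
move=> t0; have n0 := normsq_ge0 l; have p0 := ltW four_pi2_gt0.
rewrite csqE; apply/idP/idP; last first.
  by move=> lt; apply: gt0_ltr_powR; rewrite ?nnegrE ?(mulr_ge0 p0)// ltr_pM2l.
apply: contraTT; rewrite -!leNgt => tl; apply: powR_homo; first exact: ltW.
  exact: (mulr_ge0 p0).
by rewrite ler_pM2l.
Qed.

Lemma csq_le l (t : R) : normsq l <= t -> c l <= (4 * pi ^+ 2 * t) `^ sigma.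
Proof.
move=> lt; rewrite csqE; apply: powR_homo; first exact: ltW.
  exact: mulr_ge0 (ltW four_pi2_gt0) (normsq_ge0 l).
by rewrite ler_pM2l.
Qed.

(** Encodes the points of a box as finite functions, the value [B] standing for coordinate 0, so
    that sublevel sets of [csq] become finite sets that can be enumerated. *)
Definition row_of B (f : {ffun 'I_d -> 'I_(2 * B).+1}) : 'rV[int]_d :=
  \row_j ((f j)%:Z - B%:Z).

Lemma row_of_inj B : injective (@row_of B).
Proof.
move=> f g /rowP fg; apply/ffunP => j; apply/val_inj.
by have := fg j; rewrite !mxE => /addIr [].
Qed.

Lemma row_ofP B l : (forall j, `|l 0 j| <= B%:Z) -> exists f, l = @row_of B f.
Proof.
move=> lB; exists [ffun j : 'I_d => inord (absz (l 0 j + B%:Z))].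
apply/rowP => j; rewrite mxE ffunE.
have := lB j; rewrite ler_norml => /andP[h1 h2].
have h0 : 0 <= l 0 j + B%:Z by rewrite -lerBlDr sub0r.
rewrite inordK; first by rewrite gez0_abs// addrK.
by rewrite ltnS -lez_nat gez0_abs// mul2n -addnn PoszD lerD2r.
Qed.

(** A box of this half-width contains the sublevel set: a nonzero coordinate a satisfies a <= a^2 <=
    normsq <= csq^(1/sigma). *)
Definition radius C : nat := (Num.truncn (C `^ sigma^-1)).+1.

Definition suppset u C : {set {ffun 'I_d -> 'I_(2 * radius C).+1}} :=
  finset (fun f => (fsupp (row_of f) == u) && (c (row_of f) < C)).

Definition freqs u C : seq 'rV[int]_d := [seq row_of f | f <- enum (suppset u C)].

Lemma freqs_uniq u C : uniq (freqs u C).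
Proof. by rewrite map_inj_uniq ?enum_uniq//; exact: row_of_inj. Qed.

Lemma mem_freqs u C l : (l \in freqs u C) = (fsupp l == u) && (c l < C).
Proof.
apply/mapP/idP => [[f]|/andP[lu lC]].
  by rewrite mem_enum inE => lC ->.
suff [f lf] : exists f, l = @row_of (radius C) f.
  by exists f => //; rewrite mem_enum inE -lf lu.
apply: row_ofP => j; rewrite -(ler_int R) intr_norm -/(coord l j).
have [h|h] := lerP (coord l j) 1.
  by apply: (le_trans h); rewrite -[1]/(1%:~R) ler_int lez_nat.
have : coord l j <= C `^ sigma^-1; last first.
  move=> h2; apply: (le_trans h2); rewrite /radius ltW//.
  exact: truncnS_gt.
have sV0 : 0 <= sigma^-1 by rewrite invr_ge0 ltW.
apply: (@le_trans _ _ ((c l) `^ sigma^-1)); last first.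
  exact: (powR_homo sV0 (csq_ge0 l) (ltW lC)).
rewrite csqE -powRrM divff ?gt_eqF// powRr1; last first.
  exact: mulr_ge0 (ltW four_pi2_gt0) (normsq_ge0 l).
apply: (@le_trans _ _ (coord l j ^+ 2)).
  by rewrite expr2 ler_peMl ?ltW// (lt_trans ltr01 h).
apply: (le_trans (coord_le_normsq l j)); rewrite ler_peMl ?normsq_ge0//.
have := @pi_ge2 R; move=> p2; have : 2 * 2 <= pi * pi :> R by rewrite ler_pM.
rewrite expr2; lra.
Qed.
End Lattice.

(** * Counting lattice points in sublevel sets of [csq] *)

Section Counting.
Variables (R : realType) (d : nat).
Implicit Types (l : 'rV[int]_d) (u : {set 'I_d}) (j : 'I_d) (C : R).

Lemma coord_absz l j : coord R l j = (absz (l 0 j))%:R.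
Proof. by rewrite /coord -intr_norm -abszE. Qed.

(** These are the points whose coordinates on [u] lie in 1..M. They later show how many frequencies
    carry a large square of the minimizer. *)
Lemma positive_box u (M : nat) : (0 < M)%N -> exists F : seq 'rV[int]_d,
  [/\ uniq F, size F = (M ^ #|u|)%N &
    forall l, l \in F -> fsupp l = u /\ normsq R l <= #|u|%:R * M%:R ^+ 2].
Proof.
move=> M0.
pose j0 : 'I_(2 * M).+1 := inord M.
have j0E : j0 = M :> nat by rewrite inordK// ltnS mul2n -addnn leq_addr.
pose rg : pred 'I_(2 * M).+1 := fun i => (M < i)%N.
exists [seq row_of f | f <- enum (pffun_on j0 (mem u) rg)]; split.
- by rewrite map_inj_uniq ?enum_uniq//; exact: row_of_inj.
- rewrite size_map -cardE card_pffun_on; congr (_ ^ _)%N.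
  rewrite -sum1_card -(big_mkord (fun i => (M < i)%N) (fun=> 1%N)).
  rewrite (@big_cat_nat _ _ _ M.+1)//=; last by rewrite ltnS mul2n -addnn leq_addr.
  rewrite big_nat_cond big_pred0 => [|i]; last first.
    by rewrite /= ltnS; case: leqP => //=; rewrite andbF.
  rewrite add0n big_nat_cond (eq_bigl (fun i => (M.+1 <= i < (2 * M).+1)%N && true)).
    rewrite -big_nat_cond sum_nat_const_nat; lia.
  by move=> i; rewrite andbT andbAC andbb.
move=> l /mapP[f]; rewrite mem_enum => /pffun_onP[/fintype.subsetP fu frg] ->.
have su : fsupp (row_of f) = u.
  apply/setP => j; rewrite inE mxE.
  have [ju|ju] := boolP (j \in u).
    have : f j \in rg by apply: frg; apply: (map_f f); rewrite mem_enum.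
    by rewrite /in_mem /= /rg subr_eq0 eqz_nat => /gtn_eqF ->.
  have := contra (fu j) ju; rewrite inE negbK => /eqP ->.
  by rewrite j0E subrr eqxx.
split=> //; rewrite normsqE su mulr_natl -sumr_const.
apply: ler_sum => j _; rewrite lerXn2r ?nnegrE ?coord_ge0//.
rewrite coord_absz mxE ler_nat.
by move: (ltn_ord (f j)); move: (nat_of_ord (f j)) => n; lia.
Qed.
Variable sigma : R.
Hypothesis sigma_gt0 : 0 < sigma.

(** Ratio of a geometric weight that dominates exp(-1/N) and whose powers of exponent at least 1 sum
    to exactly N. *)
Let q (N : nat) : R := N%:R / N.+1%:R.

Let q_ge0 N : 0 <= q N. Proof. by rewrite divr_ge0. Qed.

Let geometric_sum N n : \sum_(a < n) q N ^+ a.+1 <= N%:R.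
Proof.
have E : \sum_(a < n) q N ^+ a.+1 + N%:R * q N ^+ n = N%:R.
  elim: n => [|n IH]; first by rewrite big_ord0 expr0 mulr1 add0r.
  rewrite big_ord_recr/= -[RHS]IH -addrA; congr (_ + _).
  rewrite exprSr -{1}[q N ^+ n * q N]mul1r -mulrDl nat1r mulrCA.
  have -> : N.+1%:R * q N = N%:R by rewrite /q mulrC divfK// pnatr_eq0.
  exact: mulrC.
by rewrite -[leRHS]E lerDl mulr_ge0// exprn_ge0.
Qed.

Let two_sided_sum (N B : nat) :
  \sum_(i < (2 * B).+1 | (i%:Z - B%:Z != 0)%R) q N ^+ absz (i%:Z - B%:Z) <= 2 * N%:R.
Proof.
rewrite -(big_mkord (fun i => (i%:Z - B%:Z != 0)%R) (fun i => q N ^+ absz (i%:Z - B%:Z))).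
rewrite (@big_cat_nat _ _ _ B)//=; last by rewrite mul2n -addnn ltnW// ltnS leq_addr.
rewrite mulr_natl mulr2n; apply: lerD.
  rewrite big_nat_rev/= big_mkcond big_nat; apply: le_trans (geometric_sum N B).
  rewrite -(big_mkord xpredT (fun a => q N ^+ a.+1)) [leRHS]big_nat.
  apply: ler_sum => i /andP[_ iB]; rewrite add0n.
  case: ifP => _; last by rewrite exprn_ge0.
  suff -> : absz ((B - i.+1)%N%:Z - B%:Z) = i.+1 by [].
  rewrite -abszN opprB subzn ?leq_subr// /=; by rewrite subKn.
rewrite big_ltn_cond; last by rewrite ltnS mul2n -addnn leq_addr.
rewrite subrr eqxx /= -{1}[B.+1]add0n big_addn.
have -> : ((2 * B).+1 - B.+1 = B)%N by rewrite subSS mul2n -addnn addnK.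
rewrite big_mkcond; apply: le_trans (geometric_sum N B).
rewrite -(big_mkord xpredT (fun a => q N ^+ a.+1)).
apply: ler_sum => i _.
case: ifP => _; last by rewrite exprn_ge0.
suff -> : absz ((i + B.+1)%N%:Z - B%:Z) = i.+1 by [].
by rewrite -addSnnS PoszD addrK.
Qed.

(** Exponential weighting: if the squared norm is below k N^2, then |l_j|/N <= ((l_j/N)^2 + 1)/2
    shows that the product of exp(-|l_j|/N) over [u] is at least exp(-k). The count is therefore at
    most exp(k) times the k-th power of a two-sided geometric sum, itself at most 2N. *)
Lemma size_freqs_le u (N : nat) : (0 < N)%N ->
  (size (freqs sigma u ((4 * pi ^+ 2 * (#|u|%:R * N%:R ^+ 2)) `^ sigma)))%:R <=
  (expR 1 * (2 * N%:R)) ^+ #|u| :> R.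
Proof.
move=> N0; set C := _ `^ sigma; rewrite size_map -cardE.
set B := radius sigma C.
pose v (i : 'I_(2 * B).+1) : int := i%:Z - B%:Z.
pose j0 : 'I_(2 * B).+1 := inord B.
have vj0 : v j0 = 0 by rewrite /v inordK ?subrr// ltnS mul2n -addnn leq_addr.
have v_eq0 i : v i = 0 -> i = j0.
  by rewrite -vj0 => /addIr [] /val_inj.
have N0' : 0 < N%:R :> R by rewrite ltr0n.
have qexp a : expR (- (a%:R / N%:R)) <= q N ^+ a :> R.
  rewrite -mulrN expRM_natl lerXn2r ?nnegrE ?expR_ge0//.
  rewrite expRN -[q N]invrK lef_pV2 ?posrE ?expR_gt0 ?invr_gt0 ?divr_gt0//.
  rewrite /q invf_div -natr1 mulrDl divff ?gt_eqF// mul1r.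
  exact: expR_ge1Dx.
have wt (f : {ffun 'I_d -> 'I_(2 * B).+1}) : f \in suppset sigma u C ->
    1 <= expR 1 ^+ #|u| * \prod_(j in u) q N ^+ absz (v (f j)).
  rewrite inE => /andP[/eqP fu].
  rewrite /C csq_lt//.
  rewrite normsqE fu => flt.
  apply: (@le_trans _ _ (expR 1 ^+ #|u| *
     \prod_(j in u) expR (- (coord R (row_of f) j / N%:R)))).
    rewrite -expR_sum -expRM_natl -expRD mulr1.
    rewrite -[X in X <= _]expR0 ler_expR sumrN subr_ge0.
    have h j : j \in u -> coord R (row_of f) j / N%:R <=
        (coord R (row_of f) j ^+ 2 / N%:R ^+ 2 + 1) / 2.
      move=> _; rewrite -expr_div_n; move: (_ / N%:R) => t.
      have := sqr_ge0 (t - 1); lra.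
    apply: le_trans (ler_sum _ h) _; rewrite -mulr_suml big_split/= sumr_const.
    rewrite -mulr_suml; move: flt; rewrite -ltr_pdivrMr ?exprn_gt0//; lra.
  rewrite ler_wpM2l ?exprn_ge0 ?expR_ge0//.
  apply: ler_prod => j _; rewrite expR_ge0/=.
  by rewrite coord_absz mxE qexp.
rewrite -sumr_const; apply: le_trans (ler_sum _ wt) _.
rewrite -mulr_sumr exprMn ler_wpM2l ?exprn_ge0 ?expR_ge0//.
apply: (@le_trans _ _ (\prod_(j in u)
    \sum_(i < (2 * B).+1 | (v i != 0)%R) q N ^+ absz (v i))); last first.
  rewrite -prodr_const; apply: ler_prod => j _.
  by rewrite two_sided_sum sumr_ge0// => i _; rewrite exprn_ge0.
(* The product of sums expands into a sum over functions equal to [j0], the code of coordinate 0,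
   outside [u]; every counted frequency is one of them. *)
rewrite (big_distr_big_dep j0) /=.
rewrite [leLHS]big_mkcond [leRHS]big_mkcond /=; apply: ler_sum => f _.
case: ifPn => [fu|_]; last by case: ifP => // _; rewrite prodr_ge0// => i _; rewrite exprn_ge0.
suff -> : f \in pfamily j0 (mem u) (fun _ => [pred i | v i != 0]) by [].
move: fu; rewrite inE => /andP[/eqP fu _]; apply/pfamilyP; split.
  apply/fintype.subsetP => j; rewrite inE -fu inE mxE -/(v _); apply: contra => /eqP v0.
  by apply/eqP; apply: v_eq0.
by move=> j /=; rewrite -fu inE mxE.
Qed.

End Counting.

(** * Summation by parts on the lattice *)

Section SummationByParts.
Variables (R : realType) (d : nat).
Implicit Types (l : 'rV[int]_d) (u : {set 'I_d}) (j : 'I_d) (C : R).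

(** Moves coordinate [j] away from 0 for [e = 1] and towards 0 for [e = -1]. The factor [sgz] treats
    both signs alike and keeps zero coordinates at zero. *)
Definition shift (e : int) j l : 'rV[int]_d :=
  \row_i (if i == j then l 0 i + e * sgz (l 0 i) else l 0 i).

Local Notation up := (shift 1).
Local Notation down := (shift (-1)).

Let ltz_sgz l j : [\/ l 0 j = 0 /\ sgz (l 0 j) = 0,
  (0 < l 0 j)%R /\ sgz (l 0 j) = 1 | (l 0 j < 0)%R /\ sgz (l 0 j) = -1].
Proof. by case: sgzP => h; [apply: Or31|apply: Or32|apply: Or33]. Qed.

Lemma fsupp_up j l : fsupp (up j l) = fsupp l.
Proof.
apply/setP => i; rewrite !inE mxE; case: (i =P j) => // _.
by case: (ltz_sgz l i) => -[h1 h2]; lia.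
Qed.

Lemma fsupp_down j l : 2 <= coord R l j -> fsupp (down j l) = fsupp l.
Proof.
rewrite coord_absz -[2]/(2%:R) ler_nat => h.
apply/setP => i; rewrite !inE mxE; case: (i =P j) => // ->.
by case: (ltz_sgz l j) => -[h1 h2]; lia.
Qed.

Lemma upK j l : down j (up j l) = l.
Proof.
apply/rowP => i; rewrite !mxE; case: (i =P j) => // ->; rewrite ?eqxx.
case: (ltz_sgz l j) => -[h1 h2]; case: (ltz_sgz (up j l) j) => -[];
  rewrite mxE eqxx h2; lia.
Qed.

Lemma downK j l : 2 <= coord R l j -> up j (down j l) = l.
Proof.
rewrite coord_absz -[2]/(2%:R) ler_nat => h.
apply/rowP => i; rewrite !mxE; case: (i =P j) => // ->; rewrite ?eqxx.
case: (ltz_sgz l j) => -[h1 h2]; case: (ltz_sgz (down j l) j) => -[];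
  rewrite mxE eqxx h2; lia.
Qed.

Lemma coord_up j l : j \in fsupp l -> coord R (up j l) j = coord R l j + 1.
Proof.
rewrite inE => h; rewrite !coord_absz natr1 mxE eqxx; congr _%:R.
by case: (ltz_sgz l j) => -[h1 h2]; lia.
Qed.

Lemma coord_down j l : j \in fsupp l -> coord R (down j l) j = coord R l j - 1.
Proof.
rewrite inE => h; apply/eqP; rewrite eq_sym subr_eq !coord_absz natr1 mxE eqxx eqr_nat.
by apply/eqP; case: (ltz_sgz l j) => -[h1 h2]; lia.
Qed.

Lemma normsq_shift e j l : normsq R (shift e j l) =
  normsq R l + (coord R (shift e j l) j ^+ 2 - coord R l j ^+ 2).
Proof.
rewrite /normsq (bigD1 j)//= [in RHS](bigD1 j)//=.
rewrite (eq_bigr (fun i => coord R l i ^+ 2)); first lra.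
by move=> i ij; rewrite /coord mxE (negbTE ij).
Qed.

Lemma coord_ge2 j l : j \in fsupp l -> coord R l j != 1 -> 2 <= coord R l j.
Proof.
rewrite inE coord_absz -[2]/(2%:R) -[1]/(1%:R) eqr_nat ler_nat; lia.
Qed.

Variable sigma : R.
Hypothesis sigma_gt0 : 0 < sigma.
Local Notation c := (@csq R d sigma).

(* Summation by parts in coordinate [j]. *)
Lemma abel_sum u C j (phi : 'rV[int]_d -> R) : j \in u ->
  (forall l, C <= c l -> phi l = 0) -> (forall l, c l <= c (up j l)) ->
  \sum_(l <- freqs sigma u C) coord R l j * phi (up j l) =
  \sum_(l <- freqs sigma u C) (coord R l j - 1) * phi l.
Proof.
move=> ju phi0 c_up; set s := freqs sigma u C.
have sE l : l \in s = (fsupp l == u) && (c l < C) by exact: mem_freqs.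
(* The sum is reindexed by [up j]. No boundary term survives: points pushed out of the sublevel set
   have [phi = 0] at their image, and points with coordinate of modulus 1, which are not images,
   have weight 0 on the right. *)
rewrite (bigID (fun l => c (up j l) < C)) /= [X in _ + X]big1 ?addr0; last first.
  by move=> l; rewrite -leNgt => /phi0 ->; rewrite mulr0.
rewrite [RHS](bigID (fun l => coord R l j == 1)) /= [X in _ = X + _]big1 ?add0r; last first.
  by move=> l /eqP ->; rewrite subrr mul0r.
rewrite -big_filter -[RHS]big_filter.
set A := [seq l <- s | c (up j l) < C]; set B := [seq l <- s | _].
have perm : perm_eq [seq up j l | l <- A] B.
  have uA : uniq A by rewrite filter_uniq// freqs_uniq.
  apply: uniq_perm; first by rewrite map_inj_uniq//; exact: can_inj (@upK j).
    by rewrite filter_uniq// freqs_uniq.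
  move=> l; rewrite mem_filter sE; apply/mapP/idP => [[l']|].
    rewrite mem_filter sE => /and3P[h /eqP hu hc] ->; rewrite fsupp_up hu eqxx h.
    have ju' : j \in fsupp l' by rewrite hu.
    by rewrite coord_up// gt_eqF// ltrDr (lt_le_trans ltr01)// coord_ge1.
  move=> /and3P[h1 /eqP hu hc].
  have h2 : 2 <= coord R l j by apply: coord_ge2 => //; rewrite hu.
  exists (down j l); last by rewrite downK.
  rewrite mem_filter sE downK// fsupp_down// hu hc eqxx /=.
  by apply: le_lt_trans hc; rewrite -{2}(downK h2).
rewrite -(perm_big _ perm) big_map /= big_seq [RHS]big_seq.
apply: eq_bigr => l; rewrite mem_filter sE => /and3P[_ /eqP hu _].
by rewrite coord_up ?hu// addrK.
Qed.

(** Reindexing by [down j] gives only an inequality: the image misses the points of the sublevel set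
    whose outward shift leaves it, and their nonnegative terms are dropped. *)
Lemma abel_down_le u C j (phi : 'rV[int]_d -> R) : j \in u ->
  (forall l, 0 <= phi l) -> (forall l, c (down j l) <= c l) ->
  \sum_(l <- freqs sigma u C | coord R l j != 1) (coord R l j - 1) * phi (down j l) <=
  \sum_(l <- freqs sigma u C) coord R l j * phi l.
Proof.
move=> ju phi0 c_down; set s := freqs sigma u C.
have sE l : l \in s = (fsupp l == u) && (c l < C) by exact: mem_freqs.
rewrite -big_filter; set A := [seq l <- s | _].
have Ah l : l \in A -> [/\ l \in s, fsupp l = u & 2 <= coord R l j].
  rewrite mem_filter => /andP[h1 ls]; split => //.
    by move: ls; rewrite sE => /andP[/eqP].
  by apply: coord_ge2 => //; move: ls; rewrite sE => /andP[/eqP ->].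
have uB : uniq [seq down j l | l <- A].
  rewrite map_inj_in_uniq ?filter_uniq ?freqs_uniq//.
  by move=> l l' /Ah[_ _ h] /Ah[_ _ h'] /(congr1 (up j)); rewrite !downK.
have Bs : {subset [seq down j l | l <- A] <= s}.
  move=> l /mapP[l' /Ah[ls lu h] ->]; rewrite sE fsupp_down// lu eqxx /=.
  by move: ls; rewrite sE => /andP[_]; exact: le_lt_trans.
have -> : \sum_(l <- A) (coord R l j - 1) * phi (down j l) =
    \sum_(l <- [seq down j l | l <- A]) coord R l j * phi l.
  rewrite big_map big_seq [RHS]big_seq; apply: eq_bigr => l /Ah[_ hu _].
  by rewrite coord_down// hu.
move: {Ah} [seq down j l | l <- A] uB Bs => B uB Bs.
have perm : perm_eq [seq l <- s | l \in B] B.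
  apply: uniq_perm => //; first by rewrite filter_uniq// freqs_uniq.
  by move=> l; rewrite mem_filter; case: (boolP (l \in B)) => //= /Bs.
rewrite -(perm_big _ perm) big_filter [leRHS](bigID (mem B)) /= lerDl.
by apply: sumr_ge0 => l _; rewrite mulr_ge0 ?coord_ge0.
Qed.
End SummationByParts.

(** * Isoperimetric-type inequalities for the sublevel sets of [csq] *)

Section Isoperimetry.
Variables (R : realType) (d : nat) (sigma : R).
Hypothesis sigma_gt0 : 0 < sigma.
Implicit Types (l : 'rV[int]_d) (u : {set 'I_d}) (j : 'I_d) (C : R).

Local Notation c := (@csq R d sigma).
Local Notation up := (shift 1).
Local Notation down := (shift (-1)).
Local Notation a l j := (coord R l j).
Local Notation rho := (@normsq R d).

(** [K1] is twice the constant of [csq_up_le], the 2 coming from a difference of squares; [K2] is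
    what the proof of [sum_csq_le] leaves after division by [sigma]. Neither depends on the size of
    the support. *)
Definition K1 : R := 6 * sigma * expR (3 * sigma).
Definition K2 : R := 2 + 4 * (1 + sigma) / sigma.

Lemma K1_gt0 : 0 < K1.
Proof. by rewrite /K1 !mulr_gt0// expR_gt0. Qed.

Lemma K2_ge2 : 2 <= K2.
Proof.
by rewrite /K2 lerDl divr_ge0 ?(ltW sigma_gt0)// mulr_ge0// addr_ge0// ltW.
Qed.

Let pi2_ge0 : 0 <= 4 * pi ^+ 2 :> R. Proof. by rewrite mulr_ge0// sqr_ge0. Qed.

Lemma csq_homo l l' : rho l <= rho l' -> c l <= c l'.
Proof. by move=> h; rewrite (csqE sigma l'); exact: csq_le. Qed.

Lemma csq_le_up l j : c l <= c (up j l).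
Proof.
apply: csq_homo; rewrite normsq_shift lerDl subr_ge0.
rewrite lerXn2r ?nnegrE ?coord_ge0//.
have [h|h] := boolP (j \in fsupp l); first by rewrite coord_up// lerDl.
by rewrite (coord_eq0 R h) coord_ge0.
Qed.

Lemma csq_down_le l j : c (down j l) <= c l.
Proof.
apply: csq_homo; rewrite normsq_shift gerDl subr_le0.
rewrite lerXn2r ?nnegrE ?coord_ge0//.
have [h|h] := boolP (j \in fsupp l); first by rewrite coord_down// gerBl.
rewrite [leLHS](_ : _ = 0) ?coord_ge0//; apply: coord_eq0.
move: h; rewrite !inE !negbK mxE eqxx => /eqP ->.
by rewrite sgz0 mulr0.
Qed.

Lemma csq_ratio l l' (t : R) : 0 <= 1 + t -> rho l' = rho l * (1 + t) ->
  c l' = c l * (1 + t) `^ sigma.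
Proof.
move=> t0 h; rewrite !csqE h mulrA powRM//.
by rewrite mulr_ge0// normsq_ge0.
Qed.

Lemma powR_expR_le (t : R) : 0 <= 1 + t -> (1 + t) `^ sigma <= expR (sigma * t).
Proof.
move=> t0; rewrite mulrC expRM; apply: powR_homo => //; first exact: ltW.
exact: expR_ge1Dx.
Qed.

(** The squared norm grows by a factor 1 + t with t = (2a + 1)/normsq <= 3, so that expR x - 1 <= x
    expR x, at x = sigma t, loses only a factor expR (3 sigma). *)
Lemma csq_up_le l j : j \in fsupp l ->
  (c (up j l) - c l) * rho l <= 3 * sigma * expR (3 * sigma) * c l * a l j.
Proof.
move=> jl; have a1 : 1 <= a l j by exact: coord_ge1.
have rho_ge : a l j ^+ 2 <= rho l by exact: coord_le_normsq.
have a2 : a l j <= a l j ^+ 2 by rewrite expr2 ler_peMl// (le_trans ler01 a1).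
have rho_gt0 : 0 < rho l by lra.
pose t := (2 * a l j + 1) / rho l.
have t0 : 0 <= t by rewrite divr_ge0 ?(ltW rho_gt0)//; lra.
have t3 : t <= 3 by rewrite ler_pdivrMr//; lra.
have trho : t * rho l = 2 * a l j + 1 by rewrite divfK// gt_eqF.
rewrite (@csq_ratio l (up j l) t); first last.
- by rewrite normsq_shift coord_up// mulrDr mulr1 (mulrC (rho l)) trho; lra.
- lra.
have e3 : expR (sigma * t) - 1 <= sigma * t * expR (3 * sigma).
  have w0 : 0 <= sigma * t by rewrite mulr_ge0// ltW.
  have := expR_ge1Dx (- (sigma * t)); rewrite expRN => h.
  have : expR (sigma * t) - 1 <= sigma * t * expR (sigma * t).
    have e0 := expR_gt0 (sigma * t).
    have := ler_wpM2l (ltW e0) h; rewrite divff ?gt_eqF//; lra.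
  move=> h2; apply: (le_trans h2); rewrite ler_wpM2l// ler_expR mulrC.
  by rewrite ler_wpM2r// ltW.
have p := powR_expR_le (_ : 0 <= 1 + t); have {p} := p ltac:(lra) => p.
have c0 := csq_ge0 sigma l.
have Pw : (1 + t) `^ sigma - 1 <= sigma * t * expR (3 * sigma) by lra.
have h1 := ler_wpM2l (mulr_ge0 c0 (ltW rho_gt0)) Pw.
have h2 := congr1 (fun x => c l * sigma * expR (3 * sigma) * x) trho.
have h0 : 0 <= c l * sigma * expR (3 * sigma) * (a l j - 1).
  by rewrite !mulr_ge0 ?expR_ge0 ?(ltW sigma_gt0)//; lra.
move: h1 h2 h0 => /=; move: (expR _) (powR _ _) => E P; lra.
Qed.

(** The chain is 1 - (1 - t)^sigma >= 1 - exp(-sigma t) >= sigma t/(1 + sigma t), where t <= 1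
    bounds the denominator by 1 + sigma. *)
Lemma csq_down_ge l j : j \in fsupp l -> a l j != 1 ->
  c l * sigma * (2 * a l j - 1) <= (c l - c (down j l)) * rho l * (1 + sigma).
Proof.
move=> jl jl1; have a2 : 2 <= a l j by exact: coord_ge2.
have rho_ge : a l j ^+ 2 <= rho l by exact: coord_le_normsq.
have a2' : 2 * a l j <= a l j ^+ 2 by rewrite expr2 ler_wpM2r// (le_trans _ a2).
have rho_gt0 : 0 < rho l by lra.
pose t := (2 * a l j - 1) / rho l.
have t0 : 0 <= t by rewrite divr_ge0 ?(ltW rho_gt0)//; lra.
have t1 : t <= 1 by rewrite ler_pdivrMr//; lra.
have trho : t * rho l = 2 * a l j - 1 by rewrite divfK// gt_eqF.
rewrite (@csq_ratio l (down j l) (- t)); first last.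
- by rewrite normsq_shift coord_down// mulrDr mulr1 mulrN (mulrC (rho l)) trho; lra.
- lra.
have c0 := csq_ge0 sigma l.
have p : (1 + - t) `^ sigma <= expR (sigma * - t) by apply: powR_expR_le; lra.
rewrite -trho.
have w0 : 0 <= sigma * t by rewrite mulr_ge0// ltW.
have st : sigma * t <= sigma by rewrite ler_piMr// ltW.
have e1 : sigma * t <= (1 - expR (sigma * - t)) * (1 + sigma).
  rewrite mulrN expRN; have e := expR_ge1Dx (sigma * t).
  have e' : (expR (sigma * t))^-1 <= (1 + sigma * t)^-1.
    by rewrite lef_pV2 ?posrE ?expR_gt0//; lra.
  apply: (@le_trans _ _ ((1 - (1 + sigma * t)^-1) * (1 + sigma))); last first.
    by rewrite ler_wpM2r//; lra.
  have -> : 1 - (1 + sigma * t)^-1 = sigma * t / (1 + sigma * t).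
    apply/(mulIf (_ : 1 + sigma * t != 0)); first by rewrite gt_eqF//; lra.
    by rewrite divfK ?mulrBl ?mulVf ?gt_eqF//; lra.
  by rewrite mulrAC ler_pdivlMr ?ler_wpM2l//; lra.
have h : sigma * t <= (1 - (1 + - t) `^ sigma) * (1 + sigma).
  by apply: (le_trans e1); rewrite ler_wpM2r//; lra.
have := ler_wpM2l (mulr_ge0 c0 (ltW rho_gt0)) h; lra.
Qed.

Let sumr_coord l u : fsupp l = u -> \sum_(j in u) a l j ^+ 2 = rho l.
Proof. by move=> <-; rewrite normsqE. Qed.

(** A discrete divergence identity: for each j in [u], summation by parts turns the sum of y^2, y =
    max(C - csq, 0), into the sum of a_j times the decrement of y^2 under an outward shift. This
    decrement is at most 2y times the increment of [csq], of order y csq a_j / normsq, and summing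
    a_j^2 over j cancels normsq. The factor [#|u|] counts the coordinates; it forces the size-biased
    mean of C - csq down to order C / [#|u|]. *)
Lemma sum_sqr_le u C :
  #|u|%:R * (\sum_(l <- freqs sigma u C) (C - c l) ^+ 2) <=
  K1 * \sum_(l <- freqs sigma u C) c l * (C - c l).
Proof.
set s := freqs sigma u C.
have sE l : l \in s = (fsupp l == u) && (c l < C) by exact: mem_freqs.
pose y l := Num.max (C - c l) 0.
have y0 l : C <= c l -> y l ^+ 2 = 0.
  by move=> h; rewrite /y max_r ?subr_le0// expr0n.
have E : \sum_(l <- s) (C - c l) ^+ 2 = \sum_(l <- s) y l ^+ 2.
  rewrite big_seq [RHS]big_seq; apply: eq_bigr => l; rewrite sE => /andP[_ h].
  by rewrite /y max_l// subr_ge0 ltW.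
have step j : j \in u -> \sum_(l <- s) y l ^+ 2 =
    \sum_(l <- s) a l j * (y l ^+ 2 - y (up j l) ^+ 2).
  move=> ju; have := abel_sum sigma_gt0 ju y0 (csq_le_up ^~ j).
  under [X in _ = X -> _]eq_bigr do rewrite mulrBl mul1r.
  rewrite sumrB => h.
  under [RHS]eq_bigr do rewrite mulrBr.
  rewrite sumrB h; lra.
rewrite E mulr_natl -sumr_const (eq_bigr _ step) exchange_big /=.
rewrite mulr_sumr big_seq [leRHS]big_seq; apply: ler_sum => l; rewrite sE.
move=> /andP[/eqP lu lC].
have yl : y l = C - c l by rewrite /y max_l// subr_ge0 ltW.
have u_le j : j \in u -> a l j * (y l ^+ 2 - y (up j l) ^+ 2) * rho l <=
    K1 * (c l * (C - c l)) * a l j ^+ 2.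
  move=> ju; have jl : j \in fsupp l by rewrite lu.
  have h1 := csq_up_le jl; have a0 := coord_ge0 R l j.
  have y_ge : y l - (c (up j l) - c l) <= y (up j l).
    by rewrite yl /y le_max; apply/orP; left; lra.
  have y_gt0 : 0 < y l by rewrite yl subr_gt0.
  have sq : y l ^+ 2 - y (up j l) ^+ 2 <= 2 * y l * (c (up j l) - c l).
    have := sqr_ge0 (y l - y (up j l)).
    have := ler_wpM2l (ltW y_gt0) y_ge; lra.
  have rho0 := normsq_ge0 R l.
  have := ler_wpM2l (mulr_ge0 a0 rho0) sq.
  have := ler_wpM2l (mulr_ge0 a0 (ltW y_gt0)) h1.
  rewrite -yl /K1; lra.
have rho_gt0 : 0 < rho l \/ u = finset.set0.
  have [->|[j ju]] := set_0Vmem u; first by right.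
  left; apply: lt_le_trans (coord_le_normsq R l j).
  by rewrite exprn_gt0// (lt_le_trans ltr01)// coord_ge1// lu.
case: rho_gt0 => [rho_gt0|u0]; last first.
  rewrite u0 big_set0; apply: mulr_ge0 (ltW K1_gt0) _.
  by apply: mulr_ge0 (csq_ge0 _ _) _; rewrite subr_ge0 ltW.
rewrite -(ler_pM2r rho_gt0) mulr_suml; apply: le_trans (ler_sum _ u_le) _.
by rewrite -mulr_sumr sumr_coord.
Qed.

(** Inward shifts lower [csq] except along coordinates of modulus 1, which contribute at most [#|u|]
    to the squared norm. Beyond twice this value the other coordinates keep half of the norm; below
    it [csq] is at most C / 2 by the assumption on [C]. This is the companion of [sum_sqr_le]: it
    bounds the plain mean of C - csq from below, with a loss of [#|u|]. *)
Lemma sum_csq_le u C : (0 < #|u|)%N ->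
  2 * (4 * pi ^+ 2 * (2 * #|u|%:R)) `^ sigma <= C ->
  \sum_(l <- freqs sigma u C) C <= K2 * #|u|%:R * \sum_(l <- freqs sigma u C) (C - c l).
Proof.
have sigma_pos := sigma_gt0.
move=> u0 Cbig; set s := freqs sigma u C; set k : R := #|u|%:R.
have k1 : 1 <= k by rewrite /k ler1n.
have sE l : l \in s = (fsupp l == u) && (c l < C) by exact: mem_freqs.
pose y l := Num.max (C - c l) 0.
have yE l : l \in s -> y l = C - c l.
  by rewrite sE => /andP[_ h]; rewrite /y max_l// subr_ge0 ltW.
have y0 l : 0 <= y l by rewrite /y le_max lexx orbT.
pose W l j := if a l j != 1 then (a l j - 1) * (c l - c (down j l)) else 0.
have W0 l j : l \in s -> j \in u -> 0 <= W l j.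
  rewrite sE => /andP[/eqP lu _] ju; rewrite /W; case: ifP => // _.
  by apply: mulr_ge0; rewrite subr_ge0 ?csq_down_le// coord_ge1// lu.
have step j : j \in u -> \sum_(l <- s) W l j <= \sum_(l <- s) y l.
  move=> ju; have := abel_down_le sigma_gt0 C ju y0 (csq_down_le ^~ j).
  rewrite -/s big_mkcond /= => h.
  have -> : \sum_(l <- s) y l = \sum_(l <- s) a l j * y l - \sum_(l <- s) (a l j - 1) * y l.
    by rewrite -sumrB; apply: eq_bigr => l _; lra.
  rewrite lerBrDr; apply: le_trans h; rewrite -big_split/= big_seq [leRHS]big_seq.
  apply: ler_sum => l ls; rewrite /W; have := yE _ ls.
  have yd : C - c (down j l) <= y (down j l) by rewrite /y le_max lexx.
  have [a1 _|a1 ->] /= := eqVneq (a l j) 1; first by rewrite a1 subrr mul0r addr0.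
  have : 1 <= a l j.
    by apply: coord_ge1; move: ls; rewrite sE => /andP[/eqP ->].
  by rewrite -subr_ge0 => h0; have := ler_wpM2l h0 yd; lra.
have sumW : \sum_(l <- s) \sum_(j in u) W l j <= k * \sum_(l <- s) y l.
  by rewrite exchange_big /= mulr_natl -sumr_const; apply: ler_sum.
have pt l : l \in s -> sigma * C <= 4 * (1 + sigma) * (\sum_(j in u) W l j) + 2 * sigma * y l.
  move=> ls; have W0l : 0 <= \sum_(j in u) W l j by apply: sumr_ge0 => j; exact: W0.
  have W0' : 0 <= (1 + sigma) * \sum_(j in u) W l j.
    by apply: mulr_ge0 => //; apply: addr_ge0 => //; exact: ltW.
  rewrite (yE _ ls); move: (ls); rewrite sE => /andP[/eqP lu lC].
  have [small|big] := ltP (rho l) (2 * k).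
    have : c l < (4 * pi ^+ 2 * (2 * k)) `^ sigma.
      by rewrite csq_lt//; lra.
    move=> h; have : c l <= C - c l by lra.
    by move/(ler_wpM2l (ltW sigma_gt0)); lra.
  have rho_gt0 : 0 < rho l by lra.
  suff h : sigma * c l <= 4 * (1 + sigma) * \sum_(j in u) W l j.
    have : 0 <= sigma * (C - c l) by rewrite mulr_ge0 ?(ltW sigma_gt0)// subr_ge0 ltW.
    lra.
  rewrite -(ler_pM2r rho_gt0).
  have Wge j : j \in u -> c l * sigma / 2 * (a l j ^+ 2 - 1) <= (1 + sigma) * rho l * W l j.
    move=> ju; have jl : j \in fsupp l by rewrite lu.
    rewrite /W; have [-> |a1] /= := eqVneq (a l j) 1; first by rewrite expr1n subrr !mulr0.
    have a2 := coord_ge2 jl a1; have := csq_down_ge jl a1.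
    have a10 : 0 <= a l j - 1 by lra.
    move/(ler_wpM2l a10).
    have : 0 <= (c l * sigma) * ((a l j - 1) * (a l j - 2)).
      by rewrite mulr_ge0 ?mulr_ge0 ?csq_ge0 ?(ltW sigma_gt0)//; lra.
    have : 0 <= (c l * sigma) * (a l j - 2).
      by rewrite mulr_ge0 ?mulr_ge0 ?csq_ge0 ?(ltW sigma_gt0)//; lra.
    have : 0 <= c l * sigma by rewrite mulr_ge0 ?csq_ge0 ?(ltW sigma_gt0).
    lra.
  have : \sum_(j in u) c l * sigma / 2 * (a l j ^+ 2 - 1) <=
      \sum_(j in u) (1 + sigma) * rho l * W l j by exact: ler_sum.
  rewrite -!mulr_sumr sumrB sumr_coord// sumr_const -/k.
  have : 0 <= c l * sigma * (rho l - 2 * k).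
    by rewrite mulr_ge0 ?mulr_ge0 ?csq_ge0 ?(ltW sigma_gt0)//; lra.
  lra.
have : sigma * (\sum_(l <- s) C) <= 4 * (1 + sigma) * (\sum_(l <- s) \sum_(j in u) W l j)
    + 2 * sigma * \sum_(l <- s) y l.
  rewrite !mulr_sumr -big_split/= big_seq [leRHS]big_seq.
  by apply: ler_sum => l /pt.
have <- : \sum_(l <- s) y l = \sum_(l <- s) (C - c l).
  by rewrite big_seq [RHS]big_seq; apply: eq_bigr => l /yE.
have Y0 : 0 <= \sum_(l <- s) y l by apply: sumr_ge0.
move: (\sum_(l <- s) y l) sumW Y0 (\sum_(l <- s) C) => Y sumW Y0 S h.
have sK : sigma * K2 = 2 * sigma + 4 * (1 + sigma).
  by rewrite /K2 mulrDr mulrCA divff ?gt_eqF// mulr1 mulrC.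
rewrite -(ler_pM2l sigma_gt0) !mulrA sK.
have kY : Y <= k * Y by rewrite ler_peMl.
have := ler_wpM2l (_ : 0 <= 4 * (1 + sigma)) sumW; have := ler_wpM2l (ltW sigma_gt0) kY.
by move=> h1 /(_ ltac:(lra)); lra.
Qed.

Lemma perm_freqs u C C' : C' <= C ->
  perm_eq (freqs sigma u C') [seq l <- freqs sigma u C | c l < C'].
Proof.
move=> CC; apply: uniq_perm; rewrite ?filter_uniq ?freqs_uniq// => l.
rewrite mem_filter !mem_freqs// andbCA; have [h|] := boolP (c l < C'); last by rewrite andbF.
by rewrite (lt_le_trans h CC) !andbT.
Qed.

(** Chosen so that [2 * K3 * K1 * K2] is at most 1/2: in [sum_deviation_ge] the points between the
    levels [t] and [z] then account for at most half of the excess over [t]. *)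
Definition K3 : R := (4 * (1 + K1) * K2)^-1.

Lemma K3_gt0 : 0 < K3.
Proof.
have := K1_gt0; have := K2_ge2; rewrite invr_gt0 => h1 h2.
by rewrite !mulr_gt0//; lra.
Qed.

Let deviation_pointwise (z y K M N : R) : 0 <= z -> 0 < y -> 0 <= K -> 8 * K <= 1 ->
  z * (y - (1 - 2 * K) * z) <= z * M -> 0 <= z * M ->
  y * (z - y) <= y * N -> 0 <= y * N -> K * (z * y) <= z * M + y * N.
Proof.
move=> z0 y0 K0 K8 h5 h6 h7 h8.
have [h|h] := lerP ((1 - K) * z) y.
  have h1 : 0 <= z * ((1 - K) * (y - (1 - K) * z)).
    by apply: mulr_ge0 => //; apply: mulr_ge0; lra.
  have h2 : 0 <= K ^+ 2 * z ^+ 2 by rewrite mulr_ge0// sqr_ge0.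
  lra.
have : 0 <= y * ((1 - K) * z - y) by apply: mulr_ge0; lra.
lra.
Qed.

(* The values [C - csq l] are not concentrated around their size-biased mean. *)
Lemma sum_deviation_ge u C (m1 m2 : R) : (0 < #|u|)%N ->
  2 * (1 + K1) * (4 * pi ^+ 2 * (2 * #|u|%:R)) `^ sigma <= C ->
  m1 = \sum_(l <- freqs sigma u C) (C - c l) ->
  m2 = \sum_(l <- freqs sigma u C) (C - c l) ^+ 2 -> 0 < m1 ->
  K3 / 3 * m2 <=
  \sum_(l <- freqs sigma u C) (C - c l) * Num.max (m2 / m1 - (C - c l)) 0.
Proof.
move=> u0 Cbig m1E m2E m1_gt0; set s := freqs sigma u C; set k : R := #|u|%:R.
have k1 : 1 <= k by rewrite /k ler1n.
have sE l : l \in s = (fsupp l == u) && (c l < C) by exact: mem_freqs.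
pose y l := C - c l; have K1p := K1_gt0; have K2p := K2_ge2.
pose z : R := m2 / m1; have zm1 : z * m1 = m2 by rewrite divfK// gt_eqF.
have y_gt0 l : l \in s -> 0 < y l by rewrite sE /y subr_gt0 => /andP[].
have z0 : 0 <= z.
  rewrite /z divr_ge0 ?(ltW m1_gt0)// m2E; apply: sumr_ge0 => l _; exact: sqr_ge0.
have I : (k + K1) * z <= K1 * C.
  rewrite -(ler_pM2r m1_gt0) -mulrA zm1; have := sum_sqr_le u C.
  rewrite -/s -/k -m2E (eq_bigr (fun l => C * (C - c l) - (C - c l) ^+ 2)); last first.
    by move=> l _; lra.
  by rewrite sumrB -mulr_sumr -m1E -m2E; lra.
have C0 : 0 <= C.
  apply: le_trans Cbig; rewrite mulr_ge0 ?powR_ge0//; lra.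
have zk : z <= k * z by rewrite ler_peMl.
have Cz : C <= (1 + K1) * (C - z) by lra.
(* A level slightly below the size-biased mean [z]. The number of points above it is controlled by
   [sum_csq_le] at the smaller level [C - t], whose factor [#|u|] is compensated by
   [k * z <= K1 * (C - t)]. *)
pose t := (1 - 2 * K3) * z.
have K3z : 0 <= K3 * z by rewrite mulr_ge0// ltW// K3_gt0.
have tz : t <= z by rewrite /t; lra.
have K3p := K3_gt0.
have K3E : K3 * ((1 + K1) * K2) = 4^-1.
  have h : (1 + K1) * K2 != 0 by rewrite gt_eqF// mulr_gt0//; lra.
  by rewrite /K3 -mulrA invfM mulfVK.
have K3_le : 8 * K3 <= 1.
  have : K3 * 2 <= K3 * ((1 + K1) * K2).
    rewrite ler_wpM2l ?(ltW K3p)//; have := ler_wpM2l (ltW K1p) K2p; lra.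
  lra.
have t0 : 0 <= t by rewrite /t mulr_ge0//; lra.
have CC : C - t <= C by lra.
have Czp : 0 <= C - z.
  by rewrite -(pmulr_rge0 _ (_ : 0 < 1 + K1)) ?(le_trans C0 Cz)//; lra.
have big' : 2 * (4 * pi ^+ 2 * (2 * #|u|%:R)) `^ sigma <= C - t.
  have h : 2 * (4 * pi ^+ 2 * (2 * #|u|%:R)) `^ sigma <= C - z.
    rewrite -(ler_pM2l (_ : 0 < 1 + K1)); last lra.
    by apply: le_trans Cz; move: Cbig; move: (powR _ _) => p; lra.
  lra.
have := sum_csq_le u0 big'; rewrite -/k.
rewrite !(perm_big _ (perm_freqs u CC)) /= !big_filter -/s.
set n : R := \sum_(l <- s | _) _; set Psi : R := \sum_(l <- s | _) _ => II.
pose n' : R := \sum_(l <- s | c l < C - t) 1.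
have nE : n = (C - t) * n' by rewrite mulr_sumr; apply: eq_bigr => l _; rewrite mulr1.
have n'0 : 0 <= n' by apply: sumr_ge0.
have Psi0 : 0 <= Psi by apply: sumr_ge0 => l h; rewrite subr_ge0 ltW.
pose Psiz : R := \sum_(l <- s) Num.max (y l - z) 0.
have PsiPsi : Psi <= Psiz + (z - t) * n'.
  rewrite /Psi /n' big_mkcond [X in _ * X]big_mkcond mulr_sumr -big_split/=.
  apply: ler_sum => l _.
  have h1 : y l - z <= Num.max (y l - z) 0 by rewrite le_max lexx.
  have h2 : 0 <= Num.max (y l - z) 0 by rewrite le_max lexx orbT.
  by move: h1 h2; rewrite /y; case: ifP => _; lra.
have zn : k * (z * n') <= K1 * (K2 * k * Psi).
  have h : k * z <= K1 * (C - t).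
    have := ler_wpM2l (ltW K1p) tz; lra.
  apply: (@le_trans _ _ (K1 * n)); last by rewrite ler_wpM2l// ltW.
  by rewrite nE; have := ler_wpM2r n'0 h; lra.
have zn' : z * n' <= K1 * K2 * Psi.
  by rewrite -(ler_pM2l (_ : 0 < k)); lra.
have halfPsi : Psi <= 2 * Psiz.
  have h : (z - t) * n' = 2 * K3 * (z * n') by rewrite /t; lra.
  have h2 : K3 * (z * n') <= K3 * (K1 * K2 * Psi) by rewrite ler_wpM2l ?(ltW K3p).
  have h3 : 0 <= K3 * K2 * Psi by rewrite !mulr_ge0 ?(ltW K3p)//; lra.
  have h4 : K3 * ((1 + K1) * K2) * Psi = 4^-1 * Psi by rewrite K3E.
  move: PsiPsi; rewrite h; lra.
set P := \sum_(l <- s) _.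
(* Weighted by y, the deviations below and above [z] balance, because [z] is the size-biased
   mean. *)
have P_alt : P = \sum_(l <- s) y l * Num.max (y l - z) 0.
  apply/eqP; rewrite -subr_eq0 -sumrB; apply/eqP.
  transitivity (\sum_(l <- s) (z * y l - y l ^+ 2)); last first.
    by rewrite sumrB -mulr_sumr /y -m1E -m2E zm1 subrr.
  apply: eq_bigr => l _; rewrite -/(y l) -/z.
  have [h|h] := lerP (y l) z.
    by rewrite max_l ?subr_ge0// max_r ?subr_le0//; lra.
  by rewrite max_r ?subr_le0 ?max_l ?subr_ge0 ?(ltW h)//; lra.
have P_ge : z * Psiz <= P.
  rewrite P_alt mulr_sumr big_seq [leRHS]big_seq; apply: ler_sum => l ls.
  have [h|h] := lerP (y l) z; first by rewrite max_r ?subr_le0// !mulr0.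
  by rewrite ler_wpM2r ?ltW// lt_max subr_gt0 h.
(* Where y is close to [z] or larger, its excess over [t] pays for the left side; where it is
   smaller, its distance to [z] does. *)
have Psi_ge : K3 * m2 <= z * Psi + P.
  have -> : Psi = \sum_(l <- s) Num.max (y l - t) 0.
    rewrite /Psi big_mkcond; apply: eq_bigr => l _; rewrite /y.
    by case: ifPn => h; [rewrite max_l|rewrite max_r]; lra.
  rewrite -zm1 m1E !mulr_sumr -big_split/= big_seq [leRHS]big_seq.
  apply: ler_sum => l ls; rewrite -/(y l) -/z.
  have yl := y_gt0 l ls.
  have h1 : y l - t <= Num.max (y l - t) 0 by rewrite le_max lexx.
  have h2 : 0 <= Num.max (y l - t) 0 by rewrite le_max lexx orbT.
  have h3 : z - y l <= Num.max (z - y l) 0 by rewrite le_max lexx.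
  have h4 : 0 <= Num.max (z - y l) 0 by rewrite le_max lexx orbT.
  have h5 := ler_wpM2l z0 h1; have h6 := mulr_ge0 z0 h2.
  have h7 := ler_wpM2l (ltW yl) h3; have h8 := mulr_ge0 (ltW yl) h4.
  exact: (deviation_pointwise z0 yl (ltW K3p) K3_le h5 h6 h7 h8).
have := ler_wpM2l z0 halfPsi; lra.
Qed.
End Isoperimetry.

(** * The extremal problem *)

Section FiniteSums.
Context (R : realType) (I : choiceType) (D : set I).
Implicit Types (J : seq I) (f : I -> \bar R).

Lemma esum_split_seq J f : uniq J -> (forall l, l \in J -> D l) ->
  (forall l, D l -> (0 <= f l)%E) ->
  (\esum_(l in D) f l = \sum_(l <- J) f l + \esum_(l in D `&` ~` [set` J]) f l)%E.
Proof.
move=> uJ JD f0; rewrite (esumID [set` J])//; congr (_ + _)%E.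
have -> : D `&` [set` J] = [set` J].
  by apply/seteqP; split=> l /= => [[]//|lJ]; split=> //; exact: JD.
rewrite esum_fset//; last by move=> l; rewrite inE /= => /JD/f0.
exact: (esym (fsbig_seq _ _ uJ)).
Qed.

Lemma sum_le_esum J f : uniq J -> (forall l, l \in J -> D l) ->
  (forall l, D l -> (0 <= f l)%E) -> (\sum_(l <- J) f l <= \esum_(l in D) f l)%E.
Proof.
move=> uJ JD f0; rewrite (esum_split_seq uJ JD f0) leeDl// esum_ge0// => l [Dl _].
exact: f0.
Qed.

Lemma esum_supported J f : uniq J -> (forall l, l \in J -> D l) ->
  (forall l, D l -> (0 <= f l)%E) -> (forall l, D l -> l \notin J -> f l = 0%E) ->
  (\esum_(l in D) f l = \sum_(l <- J) f l)%E.
Proof.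
move=> uJ JD f0 f00; rewrite (esum_split_seq uJ JD f0) [X in (_ + X)%E]esum1 ?adde0//.
by move=> l [Dl /= /negP lJ]; exact: f00.
Qed.
End FiniteSums.

Section Minimizer.
Variables (R : realType) (d : nat) (sigma : R) (u : {set 'I_d}) (r V : R).
Variable theta : 'rV[int]_d -> R.
Hypotheses (sigma_gt0 : 0 < sigma) (u_gt0 : (0 < #|u|)%N).
Hypotheses (theta_min : is_minimizer sigma u r theta)
  (V_gt0 : 0 < V) (quarticE : quartic u theta = V%:E).
Implicit Types (l : 'rV[int]_d).
Local Notation c := (@csq R d sigma).

Let x l := theta l ^+ 2.
Let x_ge0 l : 0 <= x l. Proof. exact: sqr_ge0. Qed.
Let c_ge0 l : 0 <= c l. Proof. exact: csq_ge0. Qed.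

Lemma csq_ge1 l : freq_on u l -> 1 <= c l.
Proof.
move/freq_onE => lu; rewrite (csqE sigma); 
suff : 1 `^ sigma <= (4 * pi ^+ 2 * normsq R l) `^ sigma by rewrite powR1.
apply: powR_homo => //.
  exact: ltW sigma_gt0.
have h := card_le_normsq R l; rewrite lu in h.
have : 1 <= #|u|%:R :> R by rewrite ler1n.
have := @pi_ge2 R => p2; have : 2 * 2 <= pi * pi :> R by rewrite ler_pM.
move=> p4 k1; have : 1 <= normsq R l by exact: le_trans h.
have pp : 1 <= 4 * pi ^+ 2 :> R by rewrite expr2; lra.
by move=> n1; have := ler_pM ler01 ler01 pp n1; rewrite mulr1.
Qed.

Let energy := fine (\esum_(l in freq_on u) (x l * c l)%:E).
Let mass := fine (\esum_(l in freq_on u) (x l)%:E).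

Let energyE : (\esum_(l in freq_on u) (x l * c l)%:E = energy%:E)%E.
Proof.
rewrite fineK// ge0_fin_numE ?esum_ge0// => [|l _]; last by rewrite lee_fin mulr_ge0.
by apply: (@le_lt_trans _ _ 1%E); [exact: theta_min.1.1|rewrite ltry].
Qed.

Let energy_le1 : energy <= 1.
Proof. by rewrite -lee_fin -energyE; exact: theta_min.1.1. Qed.

Let massE : (\esum_(l in freq_on u) (x l)%:E = mass%:E)%E.
Proof.
rewrite fineK// ge0_fin_numE ?esum_ge0// => [|l _]; last by rewrite lee_fin.
apply: (@le_lt_trans _ _ energy%:E); last by rewrite ltry.
rewrite -energyE; apply: le_esum => l /csq_ge1 c1; rewrite lee_fin.
by rewrite ler_peMr.
Qed.

Let mass_ge : r ^+ 2 <= mass.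
Proof. by rewrite -lee_fin -massE; exact: theta_min.1.2. Qed.

Let quartE : (\esum_(l in freq_on u) (x l ^+ 2)%:E = V%:E)%E.
Proof. by rewrite -quarticE; apply: eq_esum => l _; rewrite -exprM. Qed.

Let rest_fin (J : seq 'rV[int]_d) (f : 'rV[int]_d -> R) (s : R) :
  uniq J -> (forall l, l \in J -> freq_on u l) -> (forall l, 0 <= f l) ->
  (\esum_(l in freq_on u) (f l)%:E = s%:E)%E ->
  (\esum_(l in freq_on u `&` ~` [set` J]) (f l)%:E = (s - \sum_(l <- J) f l)%:E)%E.
Proof.
move=> uJ JD f0; rewrite (esum_split_seq uJ JD); last by move=> l _; rewrite lee_fin.
rewrite sumEFin; case: (esum _ _) => [t|//|//]; rewrite -EFinD => -[<-].
by congr (_%:E); lra.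
Qed.

(** Changing finitely many squares changes the infinite sums by finite ones. The slack of both
    constraints enters explicitly, so that the same comparison later shows the constraints to be
    active. *)
Lemma minimizer_perturb (J : seq 'rV[int]_d) (g : 'rV[int]_d -> R) :
  uniq J -> (forall l, l \in J -> freq_on u l) -> (forall l, l \in J -> 0 <= g l) ->
  \sum_(l <- J) g l * c l <= \sum_(l <- J) x l * c l + (1 - energy) ->
  \sum_(l <- J) x l + (r ^+ 2 - mass) <= \sum_(l <- J) g l ->
  \sum_(l <- J) x l ^+ 2 <= \sum_(l <- J) g l ^+ 2.
Proof.
move=> uJ JD g0 gc gm.
pose theta' l := if l \in J then Num.sqrt (g l) else theta l.
have th2 l : l \in J -> theta' l ^+ 2 = g l.
  by move=> lJ; rewrite /theta' lJ sqr_sqrtr// g0.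
have th2' l : l \notin J -> theta' l ^+ 2 = x l.
  by move=> lJ; rewrite /theta' (negbTE lJ).
have splitE (f : 'rV[int]_d -> R -> R) s : (forall l t, 0 <= t -> 0 <= f l t) ->
    (\esum_(l in freq_on u) (f l (x l))%:E = s%:E)%E ->
    (\esum_(l in freq_on u) (f l (theta' l ^+ 2))%:E =
     (\sum_(l <- J) f l (g l) + (s - \sum_(l <- J) f l (x l)))%:E)%E.
  move=> f0 fE; have fx0 l : 0 <= f l (x l) by exact: f0.
  rewrite (esum_split_seq uJ JD); last by move=> l _; rewrite lee_fin f0// sqr_ge0.
  rewrite EFinD; congr (_ + _)%E.
    by rewrite sumEFin big_seq [in RHS]big_seq; congr (_%:E); apply: eq_bigr => l /th2 ->.
  rewrite -(rest_fin uJ JD fx0 fE); apply: eq_esum => l [_ /= /negP lJ].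
  by rewrite th2'.
have th'_in : ellipsoid sigma u r theta'.
  split.
    rewrite (splitE (fun l t => t * c l) energy)//; last by move=> *; rewrite mulr_ge0.
    by rewrite lee_fin; lra.
  rewrite (splitE (fun l t => t) mass)//; rewrite lee_fin; lra.
have := theta_min.2 _ th'_in; rewrite quarticE /quartic.
rewrite (eq_esum (b := fun l => ((theta' l ^+ 2) ^+ 2)%:E)); last first.
  by move=> l _; rewrite -exprM.
rewrite (splitE (fun l t => t ^+ 2) V)//; last by move=> *; rewrite sqr_ge0.
rewrite lee_fin; lra.
Qed.

(** First-order condition. Steps below [t0] remain admissible because the constraints are linear in
    the squares and hold at step 0; the objective is quadratic in the step, so a negative slope
    would beat the minimum. *)
Lemma minimizer_direction (J : seq 'rV[int]_d) (h : 'rV[int]_d -> R) (t0 : R) :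
  uniq J -> (forall l, l \in J -> freq_on u l) -> 0 < t0 ->
  (forall l, l \in J -> 0 <= x l + t0 * h l) ->
  t0 * \sum_(l <- J) h l * c l <= 1 - energy ->
  r ^+ 2 - mass <= t0 * \sum_(l <- J) h l ->
  0 <= \sum_(l <- J) x l * h l.
Proof.
move=> uJ JD t0_gt0 xh hc hm.
have quad t : 0 < t -> t <= t0 ->
    0 <= 2 * t * (\sum_(l <- J) x l * h l) + t ^+ 2 * \sum_(l <- J) h l ^+ 2.
  move=> t_gt0 t_le; have e1 := energy_le1; have m1 := mass_ge.
  have lin (s b : R) : 0 <= b -> t0 * s <= b -> t * s <= b.
    move=> b0 sb; have [s0|s0] := lerP 0 s.
      by apply: le_trans sb; rewrite ler_wpM2r.
    by apply: le_trans b0; rewrite pmulr_rle0// ltW.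
  have := @minimizer_perturb J (fun l => x l + t * h l) uJ JD.
  have -> : \sum_(l <- J) (x l + t * h l) * c l =
      \sum_(l <- J) x l * c l + t * \sum_(l <- J) h l * c l.
    by rewrite mulr_sumr -big_split; apply: eq_bigr => l _ /=; lra.
  have -> : \sum_(l <- J) (x l + t * h l) = \sum_(l <- J) x l + t * \sum_(l <- J) h l.
    by rewrite mulr_sumr -big_split.
  have -> : \sum_(l <- J) (x l + t * h l) ^+ 2 =
      \sum_(l <- J) x l ^+ 2 + (2 * t * (\sum_(l <- J) x l * h l) +
      t ^+ 2 * \sum_(l <- J) h l ^+ 2).
    by rewrite !mulr_sumr -!big_split; apply: eq_bigr => l _ /=; lra.
  rewrite lerDl; apply.
  - move=> l /xh h1; have [h0|h0] := lerP 0 (h l).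
      by rewrite addr_ge0// mulr_ge0// ltW.
    apply: le_trans h1 _; rewrite lerD2l; rewrite ler_wnM2r//; exact: ltW.
  - by rewrite lerD2l; apply: lin => //; lra.
  - rewrite lerD2l; have := lin (- \sum_(l <- J) h l) (mass - r ^+ 2); lra.
rewrite leNgt; apply/negP; set a := (X in X < 0) => a_lt0.
set H := \sum_(l <- J) h l ^+ 2 in quad.
have H0 : 0 <= H by apply: sumr_ge0 => l _; exact: sqr_ge0.
pose t := Num.min t0 (- a / (H + 1)).
have H1 : 0 < H + 1 by lra.
have t_gt0 : 0 < t by rewrite lt_min t0_gt0 divr_gt0//; lra.
have := quad t t_gt0; rewrite ge_min lexx -/a => /(_ isT).
have tH : t * (H + 1) <= - a by rewrite -ler_pdivlMr// /t ge_min lexx orbT.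
have := ler_wpM2l (ltW t_gt0) tH.
have : t * a < 0 by rewrite pmulr_rlt0.
have := sqr_ge0 t; lra.
Qed.

(** Diagonal points: the first has the least [csq] among frequencies with support [u], and the
    others reach arbitrarily large values of [csq]. *)
Definition ray (n : nat) : 'rV[int]_d := \row_j (if j \in u then n%:Z else 0).

Lemma fsupp_ray n : (0 < n)%N -> fsupp (ray n) = u.
Proof.
by case: n => // n _; apply/setP => j; rewrite inE mxE; case: (j \in u).
Qed.

Lemma csq_ray n : c (ray n) = (4 * pi ^+ 2 * (#|u|%:R * n%:R ^+ 2)) `^ sigma.
Proof.
rewrite csqE; congr ((_ * _) `^ _).
rewrite /normsq (bigID (mem u)) /= [X in _ + X]big1 ?addr0; last first.
  by move=> j ju; rewrite /coord mxE (negbTE ju) normr0 expr0n.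
rewrite (eq_bigr (fun=> n%:R ^+ 2)) ?sumr_const ?mulr_natl// => j ju.
by rewrite /coord mxE ju normr_nat.
Qed.

Let freq_ray n : (0 < n)%N -> freq_on u (ray n).
Proof. by move=> n0; apply/freq_onE; exact: fsupp_ray. Qed.

Lemma csq_ray1_le l : freq_on u l -> c (ray 1) <= c l.
Proof.
move/freq_onE => lu; rewrite csq_ray (csqE sigma l) expr1n mulr1.
have p0 : 0 <= 4 * pi ^+ 2 :> R by rewrite mulr_ge0// sqr_ge0.
apply: (powR_homo (ltW sigma_gt0)); first exact: (mulr_ge0 p0).
by rewrite ler_wpM2l// -{1}lu card_le_normsq.
Qed.

Lemma csq_ray_unbounded (C : R) : exists2 n, (0 < n)%N & C <= c (ray n).
Proof.
exists (radius sigma C) => //; rewrite csq_ray.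
have [C0|C0] := lerP C 0; first by rewrite (le_trans C0)// powR_ge0.
set n := radius sigma C.
have n1 : 1 <= n%:R :> R by rewrite ler1n.
have Cn : C `^ sigma^-1 <= n%:R by rewrite ltW// truncnS_gt.
apply: (@le_trans _ _ (n%:R `^ sigma)).
  apply: (@le_trans _ _ ((C `^ sigma^-1) `^ sigma)).
    by rewrite -powRrM mulVf ?gt_eqF// powRr1// ltW.
  exact: powR_homo (ltW sigma_gt0) (powR_ge0 _ _) Cn.
apply: (powR_homo (ltW sigma_gt0) (ler0n _ _)).
have k1 : 1 <= #|u|%:R :> R by rewrite ler1n.
have p1 : 1 <= 4 * pi ^+ 2 :> R.
  have p2 := @pi_ge2 R; have : 2 * 2 <= pi * pi :> R by rewrite ler_pM.
  rewrite expr2; lra.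
have n2 : n%:R <= n%:R ^+ 2 :> R by rewrite expr2 ler_peMl.
have h : n%:R <= #|u|%:R * n%:R ^+ 2 :> R by apply: (le_trans n2); rewrite ler_peMl// sqr_ge0.
apply: (le_trans h); rewrite ler_peMl//.
Qed.

Let exists_pos : exists2 l, freq_on u l & 0 < x l.
Proof.
apply: contrapT => h; have : (0 < \esum_(l in freq_on u) (x l ^+ 2)%:E)%E.
  by rewrite quartE lte_fin.
rewrite esum1 ?ltxx// => l lu; suff -> : x l = 0 by rewrite expr0n.
by apply/eqP; rewrite eq_le x_ge0 andbT leNgt; apply/negP => xl; apply: h; exists l.
Qed.

Let direction1 l (a t0 : R) : freq_on u l -> 0 < t0 ->
  0 <= x l + t0 * a -> t0 * (a * c l) <= 1 - energy -> r ^+ 2 - mass <= t0 * a ->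
  0 <= x l * a.
Proof.
move=> lu t0_gt0 h1 hc hm.
have := @minimizer_direction [:: l] (fun=> a) t0.
rewrite !big_seq1; apply => //; by move=> l'; rewrite inE => /eqP ->.
Qed.

Let direction2 l1 l2 (a1 a2 t0 : R) : freq_on u l1 -> freq_on u l2 -> l1 != l2 ->
  0 < t0 -> 0 <= x l1 + t0 * a1 -> 0 <= x l2 + t0 * a2 ->
  t0 * (a1 * c l1 + a2 * c l2) <= 1 - energy -> r ^+ 2 - mass <= t0 * (a1 + a2) ->
  0 <= x l1 * a1 + x l2 * a2.
Proof.
move=> lu1 lu2 l12 t0_gt0 h1 h2 hc hm.
have := @minimizer_direction [:: l1; l2] (fun l => if l == l1 then a1 else a2) t0.
rewrite !big_cons !big_nil eqxx eq_sym (negbTE l12) !addr0; apply => //.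
- by rewrite /= inE l12.
- by move=> l; rewrite !inE => /orP[] /eqP ->.
- move=> l; rewrite !inE => /orP[] /eqP ->; first by rewrite eqxx.
  by rewrite eq_sym (negbTE l12).
Qed.

Let direction3 l1 l2 l3 (a1 a2 a3 t0 : R) :
  freq_on u l1 -> freq_on u l2 -> freq_on u l3 ->
  l1 != l2 -> l1 != l3 -> l2 != l3 -> 0 < t0 ->
  0 <= x l1 + t0 * a1 -> 0 <= x l2 + t0 * a2 -> 0 <= x l3 + t0 * a3 ->
  t0 * (a1 * c l1 + a2 * c l2 + a3 * c l3) <= 1 - energy ->
  r ^+ 2 - mass <= t0 * (a1 + a2 + a3) ->
  0 <= x l1 * a1 + x l2 * a2 + x l3 * a3.
Proof.
move=> lu1 lu2 lu3 l12 l13 l23 t0_gt0 h1 h2 h3 hc hm.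
pose h l := if l == l1 then a1 else if l == l2 then a2 else a3.
have e1 : h l1 = a1 by rewrite /h eqxx.
have e2 : h l2 = a2 by rewrite /h eqxx eq_sym (negbTE l12).
have e3 : h l3 = a3 by rewrite /h ![l3 == _]eq_sym (negbTE l13) (negbTE l23).
have := @minimizer_direction [:: l1; l2; l3] h t0.
rewrite !big_cons !big_nil e1 e2 e3 !addr0 !addrA; apply => //.
- by rewrite /= !inE negb_or l12 l13 l23.
- by move=> l; rewrite !inE => /or3P[] /eqP ->.
- by move=> l; rewrite !inE => /or3P[] /eqP ->; rewrite ?e1 ?e2 ?e3.
Qed.

(** Unspent energy would allow moving mass from a charged frequency to a remote uncharged one, which
    decreases the objective. *)
Let energy1 (C : R) : (forall l, freq_on u l -> C <= c l -> x l = 0) -> energy = 1.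
Proof.
move=> xC; apply: contrapT => /eqP e1.
have {e1} e_lt1 : energy < 1 by rewrite lt_neqAle e1 energy_le1.
have [l' lu' xl'] := exists_pos; have [n n0 Cn] := csq_ray_unbounded C.
have x3 : x (ray n) = 0 by apply: xC => //; exact: freq_ray.
have l3 : l' != ray n by apply: contraTneq xl' => ->; rewrite x3 ltxx.
have c3 := csq_ge1 (freq_ray n0).
pose t0 := Num.min (x l') ((1 - energy) / c (ray n)).
have t0_gt0 : 0 < t0 by rewrite lt_min xl' divr_gt0//; lra.
have t0x : t0 <= x l' by rewrite ge_min lexx.
have t0c : t0 * c (ray n) <= 1 - energy.
  by rewrite -ler_pdivlMr; [rewrite ge_min lexx orbT|lra].
have mm := mass_ge; have c' := c_ge0 l'.
have tc : 0 <= t0 * c l' by rewrite mulr_ge0// ltW.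
have := direction2 (a1 := -1) (a2 := 1) lu' (freq_ray n0) l3 t0_gt0.
rewrite x3; lra.
Qed.

Variable N : nat.
Let D0 := (4 * pi ^+ 2 * (#|u|%:R * N%:R ^+ 2)) `^ sigma.
Hypotheses (N_gt1 : (1 < N)%N)
  (few : D0 ^+ 2 * (size (freqs sigma u D0))%:R * V < 1).

Let in_freqs C l : l \in freqs sigma u C -> freq_on u l /\ c l < C.
Proof. by rewrite mem_freqs// => /andP[/eqP/freq_onE]. Qed.

(** Otherwise the energy, equal to 1, is carried by the frequencies with csq < D0, and
    Cauchy-Schwarz, used in its pointwise form, gives 1 <= V D0^2 times their number, contrary to
    [few]. *)
Let exists_far : exists2 l, freq_on u l /\ 0 < x l & D0 <= c l.
Proof.
apply: contrapT => far.
have x0 l : freq_on u l -> D0 <= c l -> x l = 0.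
  move=> lu cl; apply/eqP; rewrite eq_le x_ge0 andbT leNgt; apply/negP => xl.
  by apply: far; exists l.
have e1 := energy1 x0; have := few; set s := freqs sigma u D0 => few_s.
have sD l : l \in s -> freq_on u l by case/in_freqs.
have us : uniq s by exact: freqs_uniq.
have e1' : \sum_(l <- s) x l * c l = 1.
  rewrite -e1; apply/EFin_inj; rewrite -energyE -sumEFin; apply/esym/esum_supported => //.
    by move=> l _; rewrite lee_fin mulr_ge0.
  move=> l lu; rewrite mem_freqs//; move/freq_onE : (lu) => -> /=.
  by rewrite eqxx /= -leNgt => h; rewrite x0// mul0r.
have V_ge : \sum_(l <- s) x l ^+ 2 <= V.
  rewrite -lee_fin -quartE -sumEFin; apply: sum_le_esum => // l _.
  by rewrite lee_fin sqr_ge0.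
have pt l : l \in s -> x l * c l <= x l ^+ 2 * V^-1 / 2 + V * D0 ^+ 2 / 2.
  move=> ls; have cD : c l ^+ 2 <= D0 ^+ 2.
    by rewrite lerXn2r ?nnegrE// ?powR_ge0//; case/in_freqs : ls => _ /ltW.
  have iV : 0 < V^-1 by rewrite invr_gt0.
  have h : 0 <= V^-1 * (x l - V * c l) ^+ 2 by rewrite mulr_ge0 ?sqr_ge0// ltW.
  have e : V^-1 * (x l - V * c l) ^+ 2 =
     x l ^+ 2 * V^-1 - 2 * (V^-1 * V) * x l * c l + (V^-1 * V) * V * c l ^+ 2 by lra.
  have v1 : V^-1 * V = 1 by rewrite mulVf// gt_eqF.
  rewrite e v1 in h; have := ler_wpM2l (ltW V_gt0) cD; lra.
have : \sum_(l <- s) x l * c l <= \sum_(l <- s) (x l ^+ 2 * V^-1 / 2 + V * D0 ^+ 2 / 2).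
  by rewrite big_seq [leRHS]big_seq; exact: ler_sum.
rewrite e1' big_split/= -!mulr_suml big_const_seq count_predT iter_addr addr0.
rewrite -mulr_natl => h.
have : (\sum_(l <- s) x l ^+ 2) * V^-1 <= 1 by rewrite ler_pdivrMr// mul1r.
lra.
Qed.

(* The Lagrange form of the minimizer, obtained by moving mass between at most
   three frequencies. *)
Lemma minimizer_shape : exists A B : R, [/\ 0 < A, 0 < B, D0 <= A / B &
  [/\ forall l, freq_on u l -> theta l ^+ 2 = Num.max (A - B * c l) 0,
      \sum_(l <- freqs sigma u (A / B)) theta l ^+ 2 = r ^+ 2,
      \sum_(l <- freqs sigma u (A / B)) theta l ^+ 2 * c l = 1 &
      \sum_(l <- freqs sigma u (A / B)) (theta l ^+ 2) ^+ 2 = V]].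
Proof.
pose l1 := ray 1; have lu1 : freq_on u l1 by exact: freq_ray.
have [l2 [lu2 x2] c2] := exists_far.
have mm := mass_ge; have ee := energy_le1.
have c12 : c l1 < c l2.
  apply: lt_le_trans c2; rewrite /l1 csq_ray expr1n mulr1 /D0.
  have k0 : 0 < #|u|%:R :> R by rewrite ltr0n.
  have p0 : 0 < 4 * pi ^+ 2 :> R by rewrite mulr_gt0// exprn_gt0// pi_gt0.
  apply: (gt0_ltr_powR sigma_gt0); rewrite ?nnegrE.
  - exact: mulr_ge0 (ltW p0) (ltW k0).
  - by apply: mulr_ge0 (ltW p0) _; rewrite mulr_ge0// sqr_ge0.
  - by rewrite ltr_pM2l// ltr_pMr// exprn_egt1// ltr1n.
have l12 : l1 != l2 by apply: contraTneq c12 => ->; rewrite ltxx.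
(* Moving mass from [l2] to the cheaper [l1] saves energy and would lower the objective if [l1] were
   uncharged. *)
have x1 : 0 < x l1.
  rewrite lt_neqAle x_ge0 andbT; apply: contraT; rewrite negbK => /eqP x10.
  have := direction2 (a1 := 1) (a2 := -1) (t0 := x l2) lu1 lu2 l12 x2.
  rewrite -x10; have : 0 <= x l2 * (c l2 - c l1) by apply: mulr_ge0; lra.
  lra.
have c21 : 0 < c l2 - c l1 by lra.
(* [A - B * c] is the affine function of [csq] that interpolates the squares at [l1] and [l2]. *)
pose B := (x l1 - x l2) / (c l2 - c l1); pose A := x l1 + B * c l1.
have BE : B * (c l2 - c l1) = x l1 - x l2 by rewrite divfK// gt_eqF.
have affine e l : freq_on u l -> e = 1 \/ e = -1 /\ 0 < x l ->
    0 <= e * (x l - (A - B * c l)).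
  move=> lu he; have [->|n1] := eqVneq l l1; first by rewrite /A; lra.
  have [->|n2] := eqVneq l l2.
    by have : e * (B * (c l2 - c l1)) = e * (x l1 - x l2); [rewrite BE|rewrite /A; lra].
  (* The direction with entries e at [l], -e al at [l1] and -e (1 - al) at [l2] changes neither mass
     nor energy, so the first-order condition compares the square at [l] with its interpolated
     value. The sign e = -1 needs [l] to be charged. *)
  pose al := (c l2 - c l) / (c l2 - c l1).
  have alE : al * (c l2 - c l1) = c l2 - c l by rewrite divfK// gt_eqF.
  pose m := Num.min (x l1) (if 0 < x l then Num.min (x l2) (x l) else x l2).
  have m0 : 0 < m by rewrite /m; case: ifP => h; rewrite !lt_min ?x1 ?x2 ?h.
  have m1 : m <= x l1 by rewrite /m ge_min lexx.
  have m2 : m <= x l2 by rewrite /m; case: ifP => h; rewrite !ge_min lexx ?orbT.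
  have m3 : e = 1 \/ e = -1 /\ m <= x l.
    case: he => [->|[-> xl]]; [by left|right; split=> //].
    by rewrite /m xl !ge_min lexx !orbT.
  pose M := 1 + `|al| + `|1 - al|.
  have na := normr_ge0 al; have nb := normr_ge0 (1 - al).
  have M0 : 0 < M by rewrite /M; lra.
  pose t0 := m / M; have t0_gt0 : 0 < t0 by rewrite divr_gt0.
  have tM : t0 * M = m by rewrite divfK// gt_eqF.
  have ta : t0 * `|al| <= m by have := mulr_ge0 (ltW t0_gt0) nb; rewrite /M in tM; lra.
  have tb : t0 * `|1 - al| <= m by have := mulr_ge0 (ltW t0_gt0) na; rewrite /M in tM; lra.
  have t1 : t0 <= m.
    by have := mulr_ge0 (ltW t0_gt0) na; have := mulr_ge0 (ltW t0_gt0) nb; rewrite /M in tM; lra.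
  have /andP[a1 a2] : - `|al| <= al <= `|al| by rewrite -ler_norml.
  have /andP[b1 b2] : - `|1 - al| <= 1 - al <= `|1 - al| by rewrite -ler_norml.
  have := ler_wpM2l (ltW t0_gt0) a1; have := ler_wpM2l (ltW t0_gt0) a2.
  have := ler_wpM2l (ltW t0_gt0) b1; have := ler_wpM2l (ltW t0_gt0) b2.
  move=> h1 h2 h3 h4; have xl0 := x_ge0 l.
  have := direction3 (a1 := e) (a2 := - e * al) (a3 := - e * (1 - al)) (t0 := t0)
    lu lu1 lu2 n1 n2 l12 t0_gt0.
  have hal : B * (al * (c l2 - c l1)) = B * (c l2 - c l) by rewrite alE.
  have hbl : al * (B * (c l2 - c l1)) = al * (x l1 - x l2) by rewrite BE.
  have hcl : e * (al * (c l2 - c l1)) = e * (c l2 - c l) by rewrite alE.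
  have hcl' : t0 * (e * c l + - e * al * c l1 + - e * (1 - al) * c l2) = 0.
    have -> : e * c l + - e * al * c l1 + - e * (1 - al) * c l2 = 0 by lra.
    by rewrite mulr0.
  rewrite hcl'; rewrite /A; case: m3 => [e1|[e1 mx]]; rewrite e1; lra.
have xE0 l : freq_on u l -> A - B * c l <= x l.
  by move=> lu; have := affine 1 l lu (or_introl erefl); lra.
have xE1 l : freq_on u l -> 0 < x l -> x l = A - B * c l.
  move=> lu xl; have := xE0 l lu; have := affine (-1) l lu (or_intror (conj erefl xl)); lra.
(* Otherwise every square is at least the one at [l1], and finitely many diagonal points already
   push the quartic sum above [V]. *)
have B0 : 0 < B.
  rewrite ltNge; apply/negP => Bneg.
  have xge l : freq_on u l -> x l1 <= x l.
    move=> lu; apply: le_trans (xE0 l lu); rewrite /A.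
    have : 0 <= B * (c l1 - c l) by rewrite mulr_le0// subr_le0 csq_ray1_le.
    lra.
  pose m := (Num.truncn (V / x l1 ^+ 2)).+1.
  pose J := [seq ray n.+1 | n <- iota 0 m].
  have uJ : uniq J.
    rewrite map_inj_uniq ?iota_uniq// => n n' /rowP E.
    have [j ju] := card_gt0P u_gt0.
    by have := E j; rewrite !mxE ju => -[].
  have JD l : l \in J -> freq_on u l by case/mapP => n _ ->; exact: freq_ray.
  have : \sum_(l <- J) x l ^+ 2 <= V.
    rewrite -lee_fin -quartE -sumEFin; apply: sum_le_esum => // l _.
    by rewrite lee_fin sqr_ge0.
  have : \sum_(l <- J) x l1 ^+ 2 <= \sum_(l <- J) x l ^+ 2.
    rewrite big_seq [leRHS]big_seq; apply: ler_sum => l /JD/xge h.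
    by rewrite lerXn2r// nnegrE.
  rewrite big_const_seq count_predT iter_addr addr0 size_map size_iota.
  have x10 : 0 < x l1 ^+ 2 by rewrite exprn_gt0.
  have : V / x l1 ^+ 2 < m%:R by exact: truncnS_gt.
  rewrite ltr_pdivrMr// mulr_natl; lra.
have A0 : 0 < A by rewrite /A ltr_wpDr// mulr_ge0// ltW.
have AB : c l2 < A / B.
  rewrite ltr_pdivlMr// mulrC -subr_gt0 -xE1//.
have shape l : freq_on u l -> x l = Num.max (A - B * c l) 0.
  move=> lu; have := xE0 l lu; have [h|h] := lerP (A - B * c l) 0.
    move=> _; apply/eqP; rewrite eq_le x_ge0 andbT leNgt; apply/negP => xl.
    by move: (xl); rewrite (xE1 l lu xl) ltNge h.
  by move=> h2; apply: xE1 => //; exact: lt_le_trans h2.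
have x0 l : freq_on u l -> A / B <= c l -> x l = 0.
  move=> lu; rewrite ler_pdivrMr// mulrC => h; rewrite shape// max_r//; lra.
have e1 := energy1 x0.
(* Excess mass could be removed at [l1], which lowers the objective. *)
have mass_r : mass = r ^+ 2.
  apply/eqP; rewrite eq_le mm andbT leNgt; apply/negP => m_lt.
  pose t0 := Num.min (x l1) (mass - r ^+ 2).
  have t0_gt0 : 0 < t0 by rewrite lt_min x1 subr_gt0.
  have t1 : t0 <= x l1 by rewrite ge_min lexx.
  have t2 : t0 <= mass - r ^+ 2 by rewrite ge_min lexx orbT.
  have := mulr_ge0 (ltW t0_gt0) (c_ge0 l1).
  have := direction1 (a := -1) lu1 t0_gt0; rewrite e1; lra.
exists A, B; split => //; first by apply: ltW; exact: le_lt_trans AB.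
have us : uniq (freqs sigma u (A / B)) by exact: freqs_uniq.
have sD l : l \in freqs sigma u (A / B) -> freq_on u l by case/in_freqs.
have out l : freq_on u l -> l \notin freqs sigma u (A / B) -> x l = 0.
  move=> lu; rewrite mem_freqs//; move/freq_onE : (lu) => ->.
  by rewrite eqxx /= -leNgt; exact: x0.
split => //.
- rewrite -mass_r; apply/EFin_inj; rewrite -massE -sumEFin; apply/esym/esum_supported => //.
    by move=> l _; rewrite lee_fin.
  by move=> l lu lo; rewrite out.
- rewrite -e1; apply/EFin_inj; rewrite -energyE -sumEFin; apply/esym/esum_supported => //.
    by move=> l _; rewrite lee_fin mulr_ge0.
  by move=> l lu lo; rewrite out// mul0r.
- apply/EFin_inj; rewrite -quartE -sumEFin; apply/esym/esum_supported => //.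
    by move=> l _; rewrite lee_fin sqr_ge0.
  by move=> l lu lo; rewrite out// expr0n.
Qed.
End Minimizer.

Lemma esum_scale_le (R : realType) (I : choiceType) (D : set I) (a : R) (f : I -> R) :
  0 <= a -> (forall l, 0 <= f l) ->
  (\esum_(l in D) (a * f l)%:E <= a%:E * \esum_(l in D) (f l)%:E)%E.
Proof.
move=> a0 f0; rewrite {1}/esum; apply: ge_ereal_sup => _ [X /= XD <-].
have [fX XsD] := XD.
under eq_fsbigr do rewrite EFinM.
rewrite -ge0_mule_fsumr; last by move=> l; rewrite lee_fin.
apply: lee_wpmul2l; first by rewrite lee_fin.
by apply: ereal_sup_ubound; exists X.
Qed.

(** [A] and [B] stand for the Lagrange multipliers, [B ^+ 2 * m1 * P] for the gain in mass of the
    test signal per unit of [nu], and [S] for the correlation between the squares of the minimizer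
    and those of a separated signal. *)
Lemma mean_gap_arith (R : realType) (A B P V m1 r2 r2' S kk nu : R) :
  0 <= A -> 0 <= B -> 0 <= P -> 0 <= V -> 0 <= nu -> r2 = B * m1 -> V = A * r2 - B ->
  kk * V <= B ^+ 2 * P -> r2 + nu * (B ^+ 2 * m1 * P) <= r2' -> A * r2' <= S + B ->
  (1 + nu * kk) * V <= S.
Proof.
move=> A0 B0 P0 V0 nu0 r2E VE kP rr AS; have h1 := ler_wpM2l A0 rr.
have h2 : A * (nu * (B ^+ 2 * m1 * P)) = nu * (B * P * (V + B)).
  by rewrite VE r2E; lra.
have h3 : 0 <= nu * (B * P * V) by rewrite !mulr_ge0.
have h4 := ler_wpM2l nu0 kP.
have h5 : A * r2 = V + B by lra.
by rewrite mulrDr h5 h2 in h1; lra.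
Qed.

(** * Spread of the minimizer and gain in the mean of the statistic *)

Section MinimizerConsequences.
Variables (R : realType) (d : nat) (sigma : R) (u : {set 'I_d}) (r V : R).
Variable theta : 'rV[int]_d -> R.
Hypotheses (sigma_gt0 : 0 < sigma) (u_gt0 : (0 < #|u|)%N) (r_gt0 : 0 < r).
Hypotheses (theta_min : is_minimizer sigma u r theta)
  (V_gt0 : 0 < V) (quarticE : quartic u theta = V%:E).
Variables (q M : nat).
Hypotheses (M_gt0 : (0 < M)%N)
  (q_big : 2 * (1 + K1 sigma) <= (q%:R ^+ 2 / 2) `^ sigma)
  (few : ((4 * pi ^+ 2 * (#|u|%:R * (q * M)%N%:R ^+ 2)) `^ sigma) ^+ 2 *
    (size (freqs sigma u ((4 * pi ^+ 2 * (#|u|%:R * (q * M)%N%:R ^+ 2)) `^ sigma)))%:R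
    * V < 1).
Implicit Types (l : 'rV[int]_d).
Local Notation c := (@csq R d sigma).
Local Notation x l := (theta l ^+ 2).

(** Spread: the squares are at most A everywhere and at least A / 2 on the M^k points of the
    positive box, where [csq] is at most half of A / B; hence A^2 M^k / 4 <= V. Gap: A - B csq <= x
    gives A r'^2 <= S + B, where S is the sum to be bounded below, while V = A r^2 - B, so a gain of
    r'^2 over r^2 becomes a gain of S over V. The factor [q] lifts the cutoff above what both the
    box and [sum_deviation_ge] require. *)
Lemma minimizer_consequences : exists s : seq 'rV[int]_d,
  [/\ uniq s /\ forall l, l \in s -> freq_on u l,
      forall l, freq_on u l -> l \notin s -> theta l = 0,
      \sum_(l <- s) x l ^+ 2 = V,
      forall l, freq_on u l -> x l ^+ 2 * M%:R ^+ #|u| <= 4 * V &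
      forall r' nu : R, 0 < nu <= 1 ->
        (forall z, ellipsoid sigma u r' z -> (((1 + nu) ^+ 2 * V)%:E < quartic u z)%E) ->
        forall y, ellipsoid sigma u r' y ->
          (1 + nu * (K3 sigma / 3)) * V <= \sum_(l <- s) x l * y l ^+ 2].
Proof.
have sigma0 := sigma_gt0; have K1p := K1_gt0 sigma_gt0; have V0 := V_gt0.
have q_big' := q_big; have r0 := r_gt0.
have q_ge2 : (1 < q)%N.
  rewrite ltnNge; apply/negP => q1; have : (q%:R ^+ 2 / 2) `^ sigma <= 1 `^ sigma :> R.
    apply: powR_homo; rewrite ?(ltW sigma_gt0) ?divr_ge0 ?sqr_ge0//.
    rewrite ler_pdivrMr// mul1r -natrX.
    by rewrite ler_nat; case: (q) q1 => [|[|]].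
  rewrite powR1; lra.
have N_gt1 : (1 < q * M)%N by rewrite (leq_trans q_ge2)// leq_pmulr.
have [A [B [A0 B0 CD [shape massE energyE quartE]]]] :=
  minimizer_shape sigma_gt0 u_gt0 theta_min V_gt0 quarticE N_gt1 few.
set C := A / B in CD massE energyE quartE.
set D0 := _ `^ sigma in CD.
have BC : B * C = A by rewrite /C mulrC divfK// gt_eqF.
set s := freqs sigma u C in massE energyE quartE.
have us : uniq s by exact: freqs_uniq.
have sE l : l \in s = (fsupp l == u) && (c l < C) by exact: mem_freqs.
have sD l : l \in s -> freq_on u l by rewrite sE => /andP[/eqP/freq_onE].
have xs l : l \in s -> x l = B * (C - c l).
  move=> ls; have lC : c l < C by move: ls; rewrite sE => /andP[].
  rewrite (shape _ (sD _ ls)) -BC -mulrBr max_l// mulr_ge0 ?(ltW B0)// subr_ge0; exact: ltW.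
have x_out l : freq_on u l -> l \notin s -> theta l = 0.
  move=> lu; rewrite sE; move/freq_onE : (lu) => -> /=; rewrite eqxx /= -leNgt => lC.
  apply/eqP; rewrite -sqrf_eq0 (shape _ lu) -BC -mulrBr max_r//.
  by rewrite pmulr_rle0// subr_le0.
have k0 : 0 < #|u|%:R :> R by rewrite ltr0n.
have p0 : 0 < 4 * pi ^+ 2 :> R by rewrite mulr_gt0// exprn_gt0// pi_gt0.
have M1 : 1 <= M%:R :> R by rewrite ler1n.
have M2 : 1 <= M%:R ^+ 2 :> R by rewrite exprn_ege1.
have D0_big : 2 * (1 + K1 sigma) * (4 * pi ^+ 2 * (2 * #|u|%:R)) `^ sigma <= D0.
  have -> : D0 = (q%:R ^+ 2 / 2 * M%:R ^+ 2) `^ sigma * (4 * pi ^+ 2 * (2 * #|u|%:R)) `^ sigma.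
    rewrite -powRM; [|by rewrite !mulr_ge0 ?sqr_ge0|]; last first.
      by rewrite mulr_ge0 ?(ltW p0)// mulr_ge0 ?(ltW k0).
    rewrite /D0 natrM; congr (_ `^ _); lra.
  rewrite ler_wpM2r ?powR_ge0//; apply: (le_trans q_big).
  apply: powR_homo; [exact: ltW|by rewrite divr_ge0 ?sqr_ge0|].
  by rewrite ler_peMr// divr_ge0 ?sqr_ge0.
have cF_le : 2 * (4 * pi ^+ 2 * (#|u|%:R * M%:R ^+ 2)) `^ sigma <= D0.
  have -> : D0 = (q%:R ^+ 2) `^ sigma * (4 * pi ^+ 2 * (#|u|%:R * M%:R ^+ 2)) `^ sigma.
    rewrite -powRM ?sqr_ge0//; last first.
      by rewrite mulr_ge0 ?(ltW p0)// mulr_ge0 ?(ltW k0)// sqr_ge0.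
    rewrite /D0 natrM; congr (_ `^ _); lra.
  rewrite ler_wpM2r ?powR_ge0//.
  have : (q%:R ^+ 2 / 2) `^ sigma <= (q%:R ^+ 2) `^ sigma :> R.
    apply: powR_homo; [exact: ltW|by rewrite divr_ge0 ?sqr_ge0|].
    by have := sqr_ge0 (q%:R : R); lra.
  lra.
exists s; split => //.
- move=> l0 lu0; have [F [uF sF FE]] := positive_box R u M_gt0.
  have FD l : l \in F -> freq_on u l by move/FE => [/freq_onE].
  have x0A : x l0 <= A.
    rewrite (shape _ lu0) ge_max (ltW A0) andbT gerBl mulr_ge0 ?csq_ge0//; exact: ltW.
  have xF l : l \in F -> A / 2 <= x l.
    move=> lF; have [_ rl] := FE _ lF; rewrite (shape _ (FD _ lF)) le_max; apply/orP; left.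
    have h := csq_le sigma_gt0 rl; have : c l <= C / 2 by lra.
    by move/(ler_wpM2l (ltW B0)); lra.
  have : \sum_(l <- F) (x l) ^+ 2 <= V.
    rewrite -lee_fin -quarticE -sumEFin.
    rewrite /quartic (eq_esum (b := fun l => (x l ^+ 2)%:E)); last first.
      by move=> l _; rewrite -exprM.
    by apply: sum_le_esum => // l _; rewrite lee_fin sqr_ge0.
  have : \sum_(l <- F) (A / 2) ^+ 2 <= \sum_(l <- F) (x l) ^+ 2.
    rewrite big_seq [leRHS]big_seq; apply: ler_sum => l /xF h.
    by rewrite lerXn2r// nnegrE ?sqr_ge0// divr_ge0// ltW.
  have -> : \sum_(l <- F) (A / 2) ^+ 2 = (A / 2) ^+ 2 * M%:R ^+ #|u|.
    by rewrite big_const_seq count_predT iter_addr addr0 sF -[LHS]mulr_natr natrX.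
  move=> h1 h2.
  have x0A2 : x l0 ^+ 2 <= A ^+ 2 by rewrite lerXn2r ?nnegrE ?sqr_ge0// ltW.
  have Mk : 0 <= M%:R ^+ #|u| :> R by rewrite exprn_ge0.
  have := ler_wpM2r Mk x0A2; lra.
move=> r' nu /andP[nu0 nu1] far y y_in.
pose m1 : R := \sum_(l <- s) (C - c l); pose m2 : R := \sum_(l <- s) (C - c l) ^+ 2.
have sumx (f : 'rV[int]_d -> R) : \sum_(l <- s) x l * f l = B * \sum_(l <- s) (C - c l) * f l.
  by rewrite mulr_sumr big_seq [RHS]big_seq; apply: eq_bigr => l /xs ->; rewrite mulrA.
have r2E : r ^+ 2 = B * m1.
  by rewrite -massE mulr_sumr big_seq [RHS]big_seq; apply: eq_bigr => l /xs ->.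
have V2E : V = B ^+ 2 * m2.
  rewrite -quartE expr2 -mulrA; under eq_bigr do rewrite expr2.
  rewrite sumx; congr (_ * _); rewrite mulr_sumr big_seq [RHS]big_seq.
  by apply: eq_bigr => l /xs ->; lra.
have oneE : B * (C * m1 - m2) = 1.
  rewrite -energyE sumx; congr (_ * _); rewrite mulr_sumr -sumrB.
  by apply: eq_bigr => l _; lra.
have m1_gt0 : 0 < m1.
  by rewrite -(pmulr_rgt0 _ B0) -r2E exprn_gt0.
pose ybar := m2 / m1; have ybarE : ybar * m1 = m2 by rewrite divfK// gt_eqF.
pose P := \sum_(l <- s) (C - c l) * Num.max (ybar - (C - c l)) 0.
have P_ge : K3 sigma / 3 * m2 <= P.
  by apply: sum_deviation_ge => //; apply: le_trans CD.
have K3p := K3_gt0 sigma_gt0.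
(* [chi] marks the squares that do not exceed the size-biased mean. Their weight is lowered by [nu]
   relative to the others, and [nu'] restores the energy. *)
pose chi l : R := (C - c l <= ybar)%R%:R.
have chi01 l : 0 <= chi l <= 1 by rewrite /chi ler0n lern1 leq_b1.
pose S1 := \sum_(l <- s) x l * (chi l * c l).
pose S0 := \sum_(l <- s) x l * chi l.
pose nu' := nu * S1.
have S1_ge0 : 0 <= S1.
  apply: sumr_ge0 => l _; have /andP[h _] := chi01 l.
  by apply: mulr_ge0 (sqr_ge0 _) _; apply: mulr_ge0 h _; exact: csq_ge0.
have S1_le1 : S1 <= 1.
  rewrite -energyE; apply: ler_sum => l _; rewrite ler_wpM2l ?sqr_ge0//.
  by rewrite ler_piMl ?csq_ge0//; case/andP : (chi01 l).
have nu'0 : 0 <= nu' by rewrite mulr_ge0// ltW.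
have nu'le : nu' <= nu by rewrite ler_piMr// ltW.
(* [sqrt z] has energy 1 and quartic sum at most [(1 + nu) ^+ 2 * V], so the
   separation assumption forbids its mass to reach [r' ^+ 2]. *)
pose z l := x l * (1 + nu' - nu * chi l).
have z_ge0 l : 0 <= z l.
  rewrite mulr_ge0 ?sqr_ge0//; have /andP[h1 h2] := chi01 l.
  have := ler_wpM2l (ltW nu0) h2; lra.
have z_le l : z l <= (1 + nu) * x l.
  rewrite /z mulrC ler_wpM2r ?sqr_ge0//; have /andP[h1 h2] := chi01 l.
  have := mulr_ge0 (ltW nu0) h1; lra.
have z_out l : freq_on u l -> l \notin s -> z l = 0.
  by move=> lu ls; rewrite /z x_out// expr0n mul0r.
pose tz l := Num.sqrt (z l).
have tz2 l : tz l ^+ 2 = z l by rewrite sqr_sqrtr.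
have r'_big : r ^+ 2 + nu * (r ^+ 2 * S1 - S0) <= r' ^+ 2.
  rewrite leNgt; apply/negP => r'_lt.
  have : ellipsoid sigma u r' tz.
    split.
      rewrite (esum_supported us sD)/=.
      - rewrite sumEFin lee_fin; under eq_bigr do rewrite tz2.
        have -> : \sum_(l <- s) z l * c l = (1 + nu') * (\sum_(l <- s) x l * c l) - nu * S1.
          by rewrite !mulr_sumr -sumrB; apply: eq_bigr => l _; rewrite /z; lra.
        by rewrite energyE /nu'; lra.
      - by move=> l _; rewrite lee_fin mulr_ge0 ?sqr_ge0 ?csq_ge0.
      - by move=> l lu ls; rewrite tz2 z_out// mul0r.
    rewrite (esum_supported us sD)/=.
    - rewrite sumEFin lee_fin; under eq_bigr do rewrite tz2.
      have -> : \sum_(l <- s) z l = (1 + nu') * (\sum_(l <- s) x l) - nu * S0.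
        by rewrite !mulr_sumr -sumrB; apply: eq_bigr => l _; rewrite /z; lra.
      by rewrite massE /nu'; lra.
    - by move=> l _; rewrite lee_fin sqr_ge0.
    - by move=> l lu ls; rewrite tz2 z_out.
  move/far; rewrite ltNge => /negP; apply.
  have tz4 l : tz l ^+ 4 = z l ^+ 2 by rewrite -tz2 -exprM.
  rewrite /quartic (esum_supported us sD).
  - rewrite sumEFin lee_fin -quartE mulr_sumr; apply: ler_sum => l _.
    by rewrite tz4 -exprMn lerXn2r// nnegrE// mulr_ge0 ?sqr_ge0//; lra.
  - by move=> l _; rewrite lee_fin tz4 sqr_ge0.
  - by move=> l lu ls; rewrite tz4 z_out// expr0n.
(* Unit energy reads [B * m1 * (C - ybar) = 1]; inserting it identifies the gain in mass with the
   deviation [P] up to a factor. *)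
have gain : r ^+ 2 * S1 - S0 = B ^+ 2 * m1 * P.
  rewrite /S1 /S0 !sumx r2E /P.
  have -> : B ^+ 2 * m1 * (\sum_(l <- s) (C - c l) * Num.max (ybar - (C - c l)) 0) =
     B * \sum_(l <- s) B * m1 * ((C - c l) * Num.max (ybar - (C - c l)) 0).
    by rewrite -mulr_sumr; lra.
  rewrite mulrCA -mulrBr; congr (_ * _).
  rewrite mulr_sumr -sumrB; apply: eq_bigr => l _.
  have oneE' : B * m1 * (C - ybar) = 1 by rewrite -oneE -ybarE; lra.
  rewrite /chi; have [h|h] := lerP (C - c l) ybar.
    rewrite max_l ?subr_ge0// !mul1r mulr1.
    have -> : B * m1 * ((C - c l) * (ybar - (C - c l))) =
       (C - c l) * (B * m1 * c l - B * m1 * (C - ybar)) by lra.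
    rewrite oneE'; lra.
  by rewrite max_r ?subr_le0 ?(ltW h)// !(mul0r,mulr0) subr0.
have VE : V = A * r ^+ 2 - B.
  rewrite V2E r2E -BC; have := congr1 (fun t => B * t) oneE => /=; lra.
have yc_ge0 l : 0 <= y l ^+ 2 * c l by rewrite mulr_ge0 ?sqr_ge0 ?csq_ge0.
have xy_ge0 l : 0 <= x l * y l ^+ 2 by rewrite mulr_ge0 ?sqr_ge0.
have xy_ge : A * r' ^+ 2 <= \sum_(l <- s) x l * y l ^+ 2 + B.
  rewrite -lee_fin EFinM EFinD.
  have [y_en y_mass] := y_in.
  apply: (@le_trans _ _ (\esum_(l in freq_on u) (A * y l ^+ 2)%:E)%E).
    (* The scaling lemma is one-sided; applied with [A^-1] it yields the reverse bound for [A]. *)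
    have h := @esum_scale_le R _ (freq_on u) A^-1 (fun l => A * y l ^+ 2).
    have {h} := h (ltW (_ : 0 < A^-1)) _.
    rewrite invr_gt0 => /(_ A0) h; have {h} := h _.
    under eq_esum do rewrite mulrA mulVf ?gt_eqF// mul1r.
    move=> h; have {h} h := h (fun l => mulr_ge0 (ltW A0) (sqr_ge0 _)).
    have h2 := le_trans y_mass h.
    have := lee_wpmul2l (_ : (0 <= A%:E)%E) h2; rewrite lee_fin => /(_ (ltW A0)).
    have AA : (A%:E * (A^-1)%:E = 1)%E by rewrite -EFinM divff ?gt_eqF.
    by rewrite [X in (_ <= X)%E -> _]muleA AA mul1e.
  apply: (@le_trans _ _ (\esum_(l in freq_on u)
      ((x l * y l ^+ 2)%:E + (B * (y l ^+ 2 * c l))%:E))%E).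
    apply: le_esum => l lu; rewrite -EFinD lee_fin.
    have : A - B * c l <= x l by rewrite (shape _ lu) le_max lexx.
    by move/(ler_wpM2r (sqr_ge0 (y l))); lra.
  rewrite esumD; first last.
  - by move=> l _; rewrite lee_fin (mulr_ge0 (ltW B0)).
  - by move=> l _; rewrite lee_fin.
  rewrite (esum_supported us sD (f := fun l => (x l * y l ^+ 2)%:E)); first last.
  - by move=> l lu ls; rewrite x_out// expr0n mul0r.
  - by move=> l _; rewrite lee_fin.
  rewrite sumEFin leeD2l//.
  apply: (le_trans (esum_scale_le _ (ltW B0) yc_ge0)).
  have := lee_wpmul2l (_ : (0 <= B%:E)%E) y_en.
  by rewrite lee_fin mule1; apply; exact: ltW.
have P0 : 0 <= P.
  apply: le_trans P_ge; rewrite mulr_ge0 ?divr_ge0 ?(ltW K3p)//.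
  by apply: sumr_ge0 => l _; exact: sqr_ge0.
rewrite gain in r'_big.
apply: (mean_gap_arith (ltW A0) (ltW B0) P0 (ltW V_gt0) (ltW nu0) r2E VE _ r'_big xy_ge).
by rewrite V2E mulrCA ler_wpM2l ?sqr_ge0.
Qed.
End MinimizerConsequences.

(** * Errors at one grid level *)

(* Allows to bound the risk by measurable majorants without showing that the
   selector is measurable. *)
Lemma expectation_ge0_le (R : realType) (disp : measure_display)
    (T : measurableType disp) (P : probability T R) (f g : T -> R) :
  (forall w, 0 <= f w) -> (forall w, f w <= g w) ->
  ('E_P[f] <= \int[P]_w (g w)%:E)%E.
Proof.
move=> f0 fg; rewrite unlock ge0_integralTE; last by move=> w; rewrite lee_fin.
rewrite ge0_integralTE; last by move=> w; rewrite lee_fin (le_trans (f0 w)).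
apply: le_ereal_sup => _ [h /= hf <-]; exists h => // w.
by apply: (le_trans (hf w)); rewrite lee_fin.
Qed.

Section Chernoff.
Context (R : realType) (disp : measure_display) (T : measurableType disp)
  (P : probability T R) (d : nat) (D : set 'rV[int]_d).
Context (xi : 'rV[int]_d -> {RV P >-> R}).
Hypothesis xi_iid : iid_std_normal D xi.
Variables (eta : {set 'I_d} -> bool) (mu w : 'rV[int]_d -> R).
Variables (us : seq {set 'I_d}) (s : {set 'I_d} -> seq 'rV[int]_d).
Hypotheses (us_uniq : uniq us) (s_uniq : forall u, u \in us -> uniq (s u))
  (s_freq : forall u l, u \in us -> l \in s u -> freq_on u l /\ D l).
Variables (wmax lam0 lam1 t m1 : R).
Hypotheses (w_bd : forall l, 0 <= w l <= wmax)
  (w_sqr : forall u, u \in us -> \sum_(l <- s u) w l ^+ 2 = 2^-1)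
  (mean_ge : forall u, u \in us -> eta u -> m1 <= \sum_(l <- s u) w l * mu l ^+ 2)
  (lam0_ge0 : 0 <= lam0) (lam1_ge0 : 0 <= lam1)
  (lam0_small : lam0 * wmax <= 8^-1) (lam1_small : lam1 * wmax <= 8^-1).

Definition shifted_chi2 u (om : T) : R :=
  \sum_(l <- s u) w l * (((eta u)%:R * mu l + xi l om) ^+ 2 - 1).

(** Coefficients of the quadratic exponent attached to one coordinate: the tilt is +lam0 on inactive
    components, where an error is a large statistic, and -lam1 on active ones, where an error is a
    small one. *)
Let qa l : R := if eta (fsupp l) then - (lam1 * w l) else lam0 * w l.
Let qb l : R := if eta (fsupp l) then - (2 * (lam1 * w l) * mu l) else 0.
Let qc l : R := if eta (fsupp l) then - (lam1 * w l) * (mu l ^+ 2 - 1) else - (lam0 * w l).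
Let e l (x : R) : R := expR (qa l * x ^+ 2 + qb l * x + qc l).
Let phi l : R := (Num.sqrt (1 - 2 * qa l))^-1 *
  expR (qb l ^+ 2 / (2 * (1 - 2 * qa l)) + qc l).
Let cst u : R := if eta u then expR (lam1 * t) else expR (- (lam0 * t)).
Let g u (om : T) : R := cst u * \prod_(l <- s u) e l (xi l om).
Let p u : R := cst u * \prod_(l <- s u) phi l.

Let lamw lam l : 0 <= lam -> 0 <= lam * w l <= lam * wmax.
Proof. by move=> h; have /andP[h1 h2] := w_bd l; rewrite mulr_ge0//= ler_wpM2l. Qed.

Let me l : measurable_fun setT (e l).
Proof.
apply: measurableT_comp => //; apply: measurable_funD => //.
by apply: measurable_funD; apply: measurable_funM.
Qed.

Let e_ge0 l x : 0 <= e l x. Proof. exact: expR_ge0. Qed.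

Let phiE l : (\int[normal_prob 0 1]_x (e l x)%:E = (phi l)%:E)%E.
Proof.
apply: normal_expR_quadratic; rewrite /qa; have h0 := lam0_small.
have /andP[a1 a2] := lamw l lam0_ge0; have /andP[b1 b2] := lamw l lam1_ge0.
by case: ifP => _; lra.
Qed.

Let cst_ge0 u : 0 <= cst u. Proof. by rewrite /cst; case: ifP; rewrite expR_ge0. Qed.

Let fsupp_s u l : u \in us -> l \in s u -> fsupp l = u.
Proof. by move=> uu ls; apply/freq_onE; exact: (s_freq uu ls).1. Qed.

(** The squared weights sum to 1/2, so the statistic has unit variance on inactive components; hence
    the Gaussian term lam0^2 / 2, the remaining factor being the chi-square correction. *)
Definition chernoff_bound u : R :=
  if eta u then expR (lam1 * t - lam1 * m1 * (1 - 2 * (lam1 * wmax)) + lam1 ^+ 2)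
  else expR (- (lam0 * t) + lam0 ^+ 2 / 2 * (1 + 4 * (lam0 * wmax))).

Let p_le u : u \in us -> p u <= chernoff_bound u.
Proof.
move=> uu; rewrite /p /cst /chernoff_bound; have [eu|eu] := boolP (eta u).
  have phi_le l : l \in s u -> phi l <=
      expR (- lam1 * (1 - 2 * (lam1 * wmax)) * (w l * mu l ^+ 2) + 2 * lam1 ^+ 2 * w l ^+ 2).
    move=> ls; rewrite /phi /qa /qb /qc (fsupp_s uu ls) eu.
    have -> : 1 - 2 * - (lam1 * w l) = 1 + 2 * (lam1 * w l) by lra.
    have v0 : 0 < 1 + 2 * (lam1 * w l) by have /andP[b1 b2] := lamw l lam1_ge0; lra.
    have -> : (- (2 * (lam1 * w l) * mu l)) ^+ 2 / (2 * (1 + 2 * (lam1 * w l))) =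
        2 * (lam1 * w l) ^+ 2 * mu l ^+ 2 / (1 + 2 * (lam1 * w l)).
      by rewrite invfM; lra.
    rewrite [X in expR X]addrC.
    apply: (le_trans (chi2_shift_mgf_le (mu l) (lamw l lam1_ge0))).
    rewrite ler_expR; lra.
  apply: (@le_trans _ _ (expR (lam1 * t) * \prod_(l <- s u)
     expR (- lam1 * (1 - 2 * (lam1 * wmax)) * (w l * mu l ^+ 2) + 2 * lam1 ^+ 2 * w l ^+ 2))).
    rewrite ler_wpM2l ?expR_ge0// big_seq [leRHS]big_seq; apply: ler_prod => l ls.
    by rewrite phi_le// andbT mulr_ge0 ?invr_ge0 ?sqrtr_ge0 ?expR_ge0.
  rewrite -expR_sum -expRD ler_expR big_split/= -!mulr_sumr w_sqr//.
  have h := mean_ge uu eu.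
  have c0 : 0 <= lam1 * (1 - 2 * (lam1 * wmax)).
    by apply: mulr_ge0 => //; have := lam1_small; lra.
  have := ler_wpM2l c0 h; move: (\sum_(l <- s u) _) => S.
  rewrite -!mulrA; lra.
have phi_le l : l \in s u -> phi l <=
    expR (lam0 ^+ 2 * (1 + 4 * (lam0 * wmax)) * w l ^+ 2).
  move=> ls; rewrite /phi /qa /qb /qc (fsupp_s uu ls) (negbTE eu) expr0n mul0r add0r.
  apply: (le_trans (chi2_mgf_le (lamw l lam0_ge0) lam0_small)).
  rewrite ler_expR; lra.
apply: (@le_trans _ _ (expR (- (lam0 * t)) * \prod_(l <- s u)
   expR (lam0 ^+ 2 * (1 + 4 * (lam0 * wmax)) * w l ^+ 2))).
  rewrite ler_wpM2l ?expR_ge0// big_seq [leRHS]big_seq; apply: ler_prod => l ls.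
  by rewrite phi_le// andbT mulr_ge0 ?invr_ge0 ?sqrtr_ge0 ?expR_ge0.
by rewrite -expR_sum -expRD ler_expR -!mulr_sumr w_sqr//; lra.
Qed.

Let g_err u om : u \in us -> (t < shifted_chi2 u om) != eta u -> 1 <= g u om.
Proof.
move=> uu err; rewrite /g /cst.
have [eu|eu] := boolP (eta u).
  have {}err : shifted_chi2 u om <= t by move: err; rewrite eu eqb_id -leNgt.
  rewrite (eq_big_seq (fun l => expR (- lam1 *
     (w l * (((eta u)%:R * mu l + xi l om) ^+ 2 - 1))))); last first.
    move=> l ls; rewrite /e /qa /qb /qc (fsupp_s uu ls) eu; congr expR.
    by rewrite /=; lra.
  rewrite -expR_sum -expRD -mulr_sumr -/(shifted_chi2 u om) -[leLHS]expR0 ler_expR.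
  by have := ler_wpM2l lam1_ge0 err; lra.
have {}err : t <= shifted_chi2 u om.
  by move: err; rewrite (negbTE eu); case: ltP => // /ltW.
rewrite (eq_big_seq (fun l => expR (lam0 *
   (w l * (((eta u)%:R * mu l + xi l om) ^+ 2 - 1))))); last first.
  move=> l ls; rewrite /e /qa /qb /qc (fsupp_s uu ls) (negbTE eu); congr expR.
  by rewrite /=; lra.
rewrite -expR_sum -expRD -mulr_sumr -/(shifted_chi2 u om) -[leLHS]expR0 ler_expR.
by have := ler_wpM2l lam0_ge0 err; lra.
Qed.

Let blocks_uniq (vs : seq {set 'I_d}) : uniq vs -> {subset vs <= us} ->
  uniq (flatten [seq s u | u <- vs]).
Proof.
elim: vs => //= u vs IH /andP[uv uvs] sub.
have uu : u \in us by apply: sub; rewrite mem_head.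
have sub' : {subset vs <= us} by move=> v vv; apply: sub; rewrite inE vv orbT.
rewrite cat_uniq s_uniq//= IH// andbT; apply/hasPn => l /flattenP[_ /mapP[v vv ->] lv].
apply/negP => /= lu; move: uv; rewrite -(fsupp_s uu lu) (fsupp_s (sub' _ vv) lv).
by rewrite vv.
Qed.

Let blocks_D (vs : seq {set 'I_d}) : {subset vs <= us} ->
  forall l, l \in flatten [seq s u | u <- vs] -> D l.
Proof. by move=> sub l /flattenP[_ /mapP[v vv ->] lv]; exact: (s_freq (sub _ vv) lv).2. Qed.

Let phi_ge0 l : 0 <= phi l.
Proof. by rewrite mulr_ge0 ?invr_ge0 ?sqrtr_ge0 ?expR_ge0. Qed.

(* The majorants are products of functions of single coordinates, so their joint
   moments only need the product rule for coordinates, not independence of blocks. *)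
Lemma chernoff : exists g : {set 'I_d} -> T -> R,
  [/\ forall u, measurable_fun setT (g u), forall u om, 0 <= g u om,
      forall u om, u \in us -> (t < shifted_chi2 u om) != eta u -> 1 <= g u om,
      forall u, u \in us -> (\int[P]_om (g u om)%:E <= (chernoff_bound u)%:E)%E &
      (\int[P]_om (\prod_(u <- us) (1 + 3 * g u om))%:E <=
       (expR (3 * \sum_(u <- us) chernoff_bound u))%:E)%E].
Proof.
have mg u : measurable_fun setT (g u).
  by apply: measurable_funM => //; exact: measurable_prod_comp.
have g0 u om : 0 <= g u om by rewrite mulr_ge0//; exact: prodr_ge0.
exists g; split => //.
  move=> u uu; suff -> : (\int[P]_om (g u om)%:E = (p u)%:E)%E by rewrite lee_fin p_le.
  under eq_integral do rewrite /g EFinM.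
  rewrite ge0_integralZl_EFin//; first last.
  - by apply/measurable_EFinP; exact: measurable_prod_comp.
  - by move=> om _; rewrite lee_fin prodr_ge0.
  rewrite (integral_prod xi_iid me e_ge0 phiE (s_uniq uu))//.
  by move=> l /(s_freq uu)[].
have := integral_prod_blocks xi_iid me e_ge0 phiE (us := us) (blk := s) (J := [::])
  (c := fun u => 3 * cst u).
move=> /(_ (fun u => mulr_ge0 (ler0n _ 3) (cst_ge0 u))).
move=> /(_ (blocks_uniq us_uniq (fun _ => id)) (blocks_D (fun _ => id))).
rewrite big_nil mul1r => E.
have -> : (\int[P]_om (\prod_(u <- us) (1 + 3 * g u om))%:E =
    (\prod_(u <- us) (1 + 3 * p u))%:E)%E.
  transitivity ((\prod_(u <- us) (1 + 3 * cst u * \prod_(l <- s u) phi l))%:E)%E.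
    rewrite -E; apply: eq_integral => om _; rewrite big_nil mul1r; congr (_%:E).
    by apply: eq_bigr => u _; rewrite /g mulrA.
  by congr (_%:E); apply: eq_bigr => u _; rewrite /p mulrA.
rewrite lee_fin mulr_sumr expR_sum big_seq [leRHS]big_seq; apply: ler_prod => u uu.
have p0 : 0 <= p u by rewrite mulr_ge0//; exact: prodr_ge0.
apply/andP; split; first lra.
apply: le_trans (expR_ge1Dx _).
by rewrite lerD2l ler_wpM2l// p_le.
Qed.
End Chernoff.

Section MeanBounds.
Context (R : realType) (disp : measure_display) (T : measurableType disp)
  (P : probability T R).
Implicit Types (f g : T -> R) (a b c : R).

Definition mean_le f a := [/\ measurable_fun setT f, forall w, 0 <= f w &
  (\int[P]_w (f w)%:E <= a%:E)%E].

Lemma mean_le_cst c : 0 <= c -> mean_le (fun=> c) c.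
Proof.
move=> c0; split => //; rewrite integral_cst//= probability_setT mule1//.
Qed.

Lemma mean_leD f g a b : mean_le f a -> mean_le g b ->
  mean_le (fun w => f w + g w) (a + b).
Proof.
move=> [mf f0 fa] [mg g0 gb]; split.
- exact: measurable_funD.
- by move=> w; rewrite addr_ge0.
under eq_integral do rewrite EFinD.
rewrite ge0_integralD//; first by rewrite EFinD leeD.
- by move=> w _; rewrite lee_fin.
- exact/measurable_EFinP.
- by move=> w _; rewrite lee_fin.
- exact/measurable_EFinP.
Qed.

Lemma mean_leZ f a c : 0 <= c -> mean_le f a -> mean_le (fun w => c * f w) (c * a).
Proof.
move=> c0 [mf f0 fa]; split.
- exact: measurable_funM.
- by move=> w; rewrite mulr_ge0.
under eq_integral do rewrite EFinM.
rewrite ge0_integralZl_EFin//; first by rewrite EFinM lee_wpmul2l ?lee_fin.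
- by move=> w _; rewrite lee_fin.
- exact/measurable_EFinP.
Qed.

Lemma mean_le_sum (I : eqType) (r : seq I) (F : I -> T -> R) (a : I -> R) :
  (forall i, i \in r -> mean_le (F i) (a i)) ->
  mean_le (fun w => \sum_(i <- r) F i w) (\sum_(i <- r) a i).
Proof.
elim: r => [_|i r IH h].
  rewrite big_nil; under [X in mean_le X]eq_fun do rewrite big_nil.
  exact: mean_le_cst.
rewrite big_cons; under [X in mean_le X]eq_fun do rewrite big_cons.
apply: mean_leD; first by apply: h; rewrite mem_head.
by apply: IH => j jr; apply: h; rewrite inE jr orbT.
Qed.

Lemma mean_le_trans f a b : mean_le f a -> a <= b -> mean_le f b.
Proof. by move=> [mf f0 fa] ab; split=> //; apply: le_trans fa _; rewrite lee_fin. Qed.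
End MeanBounds.

(** * Adaptive selection *)

(** The weights vanish off a finite list of frequencies, so this makes the statistic a finite
    sum. *)
Lemma rsum_supported (R : realType) (I : choiceType) (D : set I) (J : seq I)
    (f : I -> R) : uniq J -> (forall l, l \in J -> D l) ->
  (forall l, D l -> l \notin J -> f l = 0) -> rsum D f = \sum_(l <- J) f l.
Proof.
move=> uJ JD f0; rewrite /rsum !(esum_supported uJ JD); first last.
- by move=> l Dl lJ; rewrite f0// maxxx.
- by move=> l _; rewrite lee_fin le_max lexx orbT.
- by move=> l Dl lJ; rewrite f0// oppr0 maxxx.
- by move=> l _; rewrite lee_fin le_max lexx orbT.
rewrite !sumEFin /= -sumrB; apply: eq_bigr => l _.
have [h|h] := lerP 0 (f l).
  by rewrite max_r ?oppr_le0// subr0.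
by rewrite max_l ?oppr_ge0 ?(ltW h)// sub0r opprK.
Qed.

Section Lepski.
Variables (R : realType) (d k M m0 : nat).
Variables (sel : nat -> {set 'I_d} -> bool) (eta : {set 'I_d} -> bool) (v : nat -> R).
Hypotheses (m0_gt0 : (0 < m0)%N) (m0_le : (m0 <= M)%N) (v0 : 0 <= v m0).

Let ok m := all (fun j => (hamming k (sel m) (sel j))%:R <= v j) (index_iota 1 m).
Let mh := \max_(1 <= m < M.+1 | ok m) m.

Lemma hammingC (a b : {set 'I_d} -> bool) : hamming k a b = hamming k b a.
Proof. by apply: eq_bigr => u _; rewrite eq_sym. Qed.

Lemma hamming_triangle (a b c : {set 'I_d} -> bool) :
  (hamming k a c <= hamming k a b + hamming k b c)%N.
Proof.
rewrite /hamming -big_split; apply: leq_sum => u _.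
by case: (a u) (b u) (c u) => [] [] [].
Qed.

Lemma hamming_le_bin (a b : {set 'I_d} -> bool) : (hamming k a b)%:R <= binr R d k.
Proof.
rewrite /binr ler_nat -[d in 'C(d, k)]card_ord -card_draws -sum1_card.
by apply: leq_sum => u _; exact: leq_b1.
Qed.

(** If [m0] is accepted, the selected index is at least [m0] and, when larger, was itself compared
    with [m0], so the two selectors are within [v m0]. If [m0] is rejected, some term of the sum
    equals 1 and the trivial bound on the distance suffices. *)
Lemma lepski_le : (hamming k (sel mh) eta)%:R <= v m0 + (hamming k (sel m0) eta)%:R +
  binr R d k * \sum_(1 <= j < m0) (v j < (hamming k (sel m0) (sel j))%:R)%R%:R.
Proof.
have v0' := v0; have bin0 : 0 <= binr R d k by rewrite ler0n.
have sum0 : 0 <= \sum_(1 <= j < m0) (v j < (hamming k (sel m0) (sel j))%:R)%R%:R :> R.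
  by apply: sumr_ge0.
have [okm0|] := boolP (ok m0); last first.
  move=> /allPn[j jm]; rewrite -ltNge => jv.
  have : 1 <= \sum_(1 <= j < m0) (v j < (hamming k (sel m0) (sel j))%:R)%R%:R :> R.
    rewrite (big_rem j)//= jv lerDl sumr_ge0//.
  move/(ler_wpM2l bin0); have := hamming_le_bin (sel mh) eta.
  have := ler0n R (hamming k (sel m0) eta); lra.
have mh_ge : (m0 <= mh)%N.
  rewrite /mh (big_rem m0)/= ?okm0 ?leq_maxl// mem_index_iota m0_gt0 ltnS//.
(* The maximum defaults to 0 when no index qualifies; [mh_ge] excludes this case. *)
have okmh : ok mh.
  have : mh = 0%N \/ ok mh.
    rewrite /mh; apply: (big_ind (fun x => x = 0%N \/ ok x)); first by left.
      by move=> a b ha hb; rewrite /maxn; case: ifP.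
    by move=> m okm; right.
  by case=> // mh0; move: mh_ge; rewrite mh0 leqNgt m0_gt0.
have P0 := mulr_ge0 bin0 sum0.
move: mh_ge; rewrite leq_eqVlt => /orP[/eqP <-|mlt].
  by lra.
have := allP okmh m0; rewrite mem_index_iota m0_gt0 mlt => /(_ isT) h.
have := hamming_triangle (sel mh) (sel m0) eta; rewrite -(ler_nat R) natrD; lra.
Qed.
End Lepski.

Lemma expR_half_le2 (R : realType) : expR 2^-1 <= 2 :> R.
Proof.
have h := expR_ge1Dx (- 2^-1 : R).
have hh : expR 2^-1 * expR (- 2^-1) = 1 :> R by rewrite -expRD subrr expR0.
have := ler_wpM2l (expR_ge0 (2^-1 : R)) h; rewrite hh; lra.
Qed.

Lemma expR1_le4 (R : realType) : expR 1 <= 4 :> R.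
Proof.
have e0 := expR_gt0 (2^-1 : R); have e2 := expR_half_le2 R.
have -> : 1 = 2^-1 + 2^-1 :> R by lra.
rewrite expRD; have := ler_pM (ltW e0) (ltW e0) e2 e2; lra.
Qed.

(* [m0] is meant to be the largest index of a grid point at most [beta]. *)
Section SelectorRisk.
Context (R : realType) (disp : measure_display) (T : measurableType disp)
  (P : probability T R) (d k M m0 : nat).
Variables (sel : T -> nat -> {set 'I_d} -> bool) (eta : {set 'I_d} -> bool) (v : nat -> R).
Variables (cb : nat -> {set 'I_d} -> R).
Hypotheses (m0_gt0 : (0 < m0)%N) (m0_le : (m0 <= M)%N) (v0 : 0 <= v m0)
  (v_ge : forall m, (1 <= m <= m0)%N -> v m0 <= v m).
Let us := enum (subsets d k).
Hypothesis cb_small : forall m, (1 <= m <= m0)%N -> \sum_(u <- us) cb m u <= v m / 12.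
Hypothesis majorants : forall m, (1 <= m <= m0)%N -> exists g : {set 'I_d} -> T -> R,
  [/\ forall u, measurable_fun setT (g u), forall u om, 0 <= g u om,
      forall u om, u \in us -> sel om m u != eta u -> 1 <= g u om,
      forall u, u \in us -> (\int[P]_om (g u om)%:E <= (cb m u)%:E)%E &
      (\int[P]_om (\prod_(u <- us) (1 + 3 * g u om))%:E <=
       (expR (3 * \sum_(u <- us) cb m u))%:E)%E].

Let mh om := \max_(1 <= m < M.+1 |
  all (fun j => (hamming k (sel om m) (sel om j))%:R <= v j) (index_iota 1 m)) m.

(** A comparison failing at [j] forces one of the two error counts above [v j / 2]. Since 3 (v / 12)
    = v / 4, an error count at level m has exponential moment at most [expR (v m / 4)], so Markov's
    inequality bounds each failure by [2 * expR (- (v m0 / 4))], multiplied by the trivial loss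
    [binr R d k]. Indicators of failure are replaced by exponential majorants, so these events need
    not be measurable. *)
Lemma selector_risk : exists G : T -> R,
  (forall om, (hamming k (sel om (mh om)) eta)%:R <= G om) /\
  mean_le P G (2 * v m0 + 2 * binr R d k * m0%:R * expR (- (v m0 / 4))).
Proof.
have [g gP] : exists g : nat -> {set 'I_d} -> T -> R, forall m, (1 <= m <= m0)%N ->
  [/\ forall u, measurable_fun setT (g m u), forall u om, 0 <= g m u om,
      forall u om, u \in us -> sel om m u != eta u -> 1 <= g m u om,
      forall u, u \in us -> (\int[P]_om (g m u om)%:E <= (cb m u)%:E)%E &
      (\int[P]_om (\prod_(u <- us) (1 + 3 * g m u om))%:E <=
       (expR (3 * \sum_(u <- us) cb m u))%:E)%E].
  suff /choice[g gP] : forall m, exists g : {set 'I_d} -> T -> R, (1 <= m <= m0)%N ->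
    [/\ forall u, measurable_fun setT (g u), forall u om, 0 <= g u om,
      forall u om, u \in us -> sel om m u != eta u -> 1 <= g u om,
      forall u, u \in us -> (\int[P]_om (g u om)%:E <= (cb m u)%:E)%E &
      (\int[P]_om (\prod_(u <- us) (1 + 3 * g u om))%:E <=
       (expR (3 * \sum_(u <- us) cb m u))%:E)%E] by exists g.
  move=> m; have [/majorants[g gP]|] := boolP (1 <= m <= m0)%N; first by exists g.
  by exists (fun _ _ => 0).
have m0P : (1 <= m0 <= m0)%N by rewrite m0_gt0 leqnn.
pose H m om : R := (hamming k (sel om m) eta)%:R.
have HE m om : H m om = \sum_(u <- us) (sel om m u != eta u)%:R.
  by rewrite /H /hamming natr_sum big_enum.
have H_le m om : (1 <= m <= m0)%N -> H m om <= \sum_(u <- us) g m u om.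
  move=> mP; have [_ g0 g1 _ _] := gP _ mP; rewrite HE big_seq [leRHS]big_seq.
  apply: ler_sum => u uu; case: eqVneq => [_|err]; first exact: g0.
  exact: g1.
(* One error multiplies the exponential by e <= 4 = 1 + 3; this is the origin of the 3 in the
   majorant. *)
have expH_le m om : (1 <= m <= m0)%N ->
    expR (H m om) <= \prod_(u <- us) (1 + 3 * g m u om).
  move=> mP; have [_ g0 g1 _ _] := gP _ mP; rewrite HE expR_sum big_seq [leRHS]big_seq.
  apply: ler_prod => u uu; rewrite expR_ge0 /=; have := g0 u om.
  case: eqVneq => [_|err] h; first by rewrite expR0; lra.
  by have := g1 u om uu err; have := (expR1_le4 R); lra.
pose bin := binr R d k; have bin0 : 0 <= bin by rewrite /bin /binr ler0n.
pose Pr m om := \prod_(u <- us) (1 + 3 * g m u om).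
pose G om := v m0 + \sum_(u <- us) g m0 u om +
  bin * \sum_(j <- index_iota 1 m0) expR (- (v j / 2)) * (Pr m0 om + Pr j om).
have jP j : j \in index_iota 1 m0 -> (1 <= j <= m0)%N.
  by rewrite mem_index_iota => /andP[-> /ltnW].
exists G; split.
  move=> om; apply: (le_trans (lepski_le k (sel om) eta m0_gt0 m0_le v0)).
  rewrite /G lerD// ?lerD2l ?H_le// ler_wpM2l// big_seq [leRHS]big_seq.
  apply: ler_sum => j /jP jm.
  have Pr0 m : (1 <= m <= m0)%N -> 0 <= Pr m om.
    by move=> /(expH_le _ om); apply: le_trans; exact: expR_ge0.
  have [vj|_] := ltP (v j) _; last first.
    by rewrite mulr_ge0 ?expR_ge0// addr_ge0// Pr0.
  apply: (@le_trans _ _ (expR (- (v j / 2)) * (expR (H m0 om) + expR (H j om)))); last first.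
    by rewrite ler_wpM2l ?expR_ge0// lerD// expH_le.
  have tri : v j < H m0 om + H j om.
    apply: (lt_le_trans vj); rewrite -natrD ler_nat (hammingC k (sel om j)).
    exact: hamming_triangle.
  rewrite mulrDr -!expRD; have -> : true%:R = 1 :> R by [].
  have [h|h] := lerP (v j / 2) (H m0 om).
    have : expR 0 <= expR (- (v j / 2) + H m0 om) by rewrite ler_expR; lra.
    by rewrite expR0; have := expR_ge0 (- (v j / 2) + H j om); lra.
  have : expR 0 <= expR (- (v j / 2) + H j om) by rewrite ler_expR; lra.
  by rewrite expR0; have := expR_ge0 (- (v j / 2) + H m0 om); lra.
have mean_g m u : (1 <= m <= m0)%N -> u \in us -> mean_le P (g m u) (cb m u).
  by move=> mP uu; have [? ? _ h _] := gP _ mP; split=> //; exact: h.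
have mean_Pr m : (1 <= m <= m0)%N -> mean_le P (Pr m) (expR (v m / 4)).
  move=> mP; have [mg g0 _ _ h] := gP _ mP; split.
  - apply: measurable_prod => u _; apply: measurable_funD => //.
    exact: measurable_funM.
  - by move=> om; apply: prodr_ge0 => u _; rewrite addr_ge0// mulr_ge0.
  - apply: (le_trans h); rewrite lee_fin ler_expR.
    have := cb_small mP; lra.
have mean_G : mean_le P G (v m0 + \sum_(u <- us) cb m0 u + bin *
    \sum_(j <- index_iota 1 m0) expR (- (v j / 2)) * (expR (v m0 / 4) + expR (v j / 4))).
  apply: mean_leD.
    apply: mean_leD; first exact: mean_le_cst.
    by apply: mean_le_sum => u uu; exact: mean_g.
  apply: mean_leZ => //; apply: mean_le_sum => j /jP jm.
  apply: mean_leZ; first exact: expR_ge0.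
  by apply: mean_leD; exact: mean_Pr.
apply: (mean_le_trans mean_G).
have h1 := cb_small m0P; have v0' := v0.
have : \sum_(j <- index_iota 1 m0) expR (- (v j / 2)) * (expR (v m0 / 4) + expR (v j / 4)) <=
    \sum_(j <- index_iota 1 m0) 2 * expR (- (v m0 / 4)).
  rewrite big_seq [leRHS]big_seq; apply: ler_sum => j /jP jm.
  rewrite mulrDr -!expRD; have vj := v_ge jm.
  have e1 : expR (- (v j / 2) + v m0 / 4) <= expR (- (v m0 / 4)) by rewrite ler_expR; lra.
  have e2 : expR (- (v j / 2) + v j / 4) <= expR (- (v m0 / 4)) by rewrite ler_expR; lra.
  lra.
rewrite big_const_seq count_predT iter_addr addr0 size_iota -[_ *+ _]mulr_natr => h2.
have h3 := ler_wpM2l bin0 h2.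
have e0 := expR_ge0 (- (v m0 / 4)).
have h4 : bin * (2 * expR (- (v m0 / 4)) * (m0 - 1)%:R) <=
  2 * bin * m0%:R * expR (- (v m0 / 4)).
  have hm : (m0 - 1)%:R <= m0%:R :> R by rewrite ler_nat leq_subr.
  have := ler_wpM2l (mulr_ge0 bin0 e0) hm; lra.
rewrite -/bin; lra.
Qed.
End SelectorRisk.

(** * Risk at one sparsity order *)

Section DetectionLevel.
Variables (R : realType) (d : nat) (sigma eps : R) (u : {set 'I_d}).
Hypothesis eps_gt0 : 0 < eps.

Let c_gt0 : 0 < (2 * eps ^+ 4)^-1 :> R.
Proof. by rewrite invr_gt0 mulr_gt0// exprn_gt0. Qed.

Let quartic_ge0 (z : 'rV[int]_d -> R) : (0 <= quartic u z)%E.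
Proof. by apply: esum_ge0 => l _; rewrite lee_fin (exprM _ 2 2) sqr_ge0. Qed.

Lemma detection_le_quartic (r a : R) (z : 'rV[int]_d -> R) : 0 < a ->
  a <= detection sigma eps u r -> ellipsoid sigma u r z ->
  ((2 * eps ^+ 4 * a ^+ 2)%:E <= quartic u z)%E.
Proof.
move=> a0; rewrite /detection; set I := ereal_inf _ => aI zE.
have I0 : (0 <= I)%E.
  by apply: le_ereal_inf_tmp => _ [y _ <-]; exact: quartic_ge0.
have Iz : (I <= quartic u z)%E by apply: ereal_inf_lbound; exists z.
apply: (le_trans _ Iz); move: I0 aI; case: I {Iz} => [i||//]; last by move=> _ _; rewrite leey.
rewrite lee_fin => i0; rewrite -EFinM /= => aI; rewrite lee_fin.
have : a ^+ 2 <= (2 * eps ^+ 4)^-1 * i.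
  have ci : 0 <= (2 * eps ^+ 4)^-1 * i by rewrite mulr_ge0// ltW.
  rewrite -[leRHS]sqr_sqrtr// lerXn2r// nnegrE ?sqrtr_ge0//; exact: ltW.
by rewrite mulrC ler_pdivlMr ?mulr_gt0 ?exprn_gt0// mulrC.
Qed.

(** A positive value rules out an infinite infimum, which [detection] would send to 0. *)
Lemma quartic_of_detection (r a : R) (z : 'rV[int]_d -> R) : 0 < a ->
  detection sigma eps u r = a -> is_minimizer sigma u r z ->
  quartic u z = (2 * eps ^+ 4 * a ^+ 2)%:E.
Proof.
move=> a0 dE [zE zmin].
have IE : ereal_inf [set quartic u th | th in ellipsoid sigma u r] = quartic u z.
  apply/eqP; rewrite eq_le; apply/andP; split.
    by apply: ereal_inf_lbound; exists z.
  by apply: le_ereal_inf_tmp => _ [y yE <-]; exact: zmin.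
move: dE; rewrite /detection IE; have := quartic_ge0 z.
case: (quartic u z) => [i||//]; last first.
  by rewrite gt0_muley ?lte_fin// /= sqrtr0 => _ /esym a00; rewrite a00 ltxx in a0.
rewrite lee_fin -EFinM /= => i0 <-; rewrite sqr_sqrtr; last by rewrite mulr_ge0// ltW.
by rewrite mulrA divff ?mul1r// gt_eqF// mulr_gt0// exprn_gt0.
Qed.
End DetectionLevel.

(** Exponent of a miss at tilt lam = g a / 8, for a mean (1 + g) a and a threshold at most (1 + g /
    4) a. The terms linear in lam, with the correction in [w], are at most - g^2 a^2 / 16, of which
    lam^2 gives back g^2 a^2 / 64. *)
Lemma signal_exponent_le (R : realType) (g a t w h lam : R) : 0 <= g <= 1 -> 0 <= a ->
  lam = g * a / 8 -> 0 <= lam * w -> lam * w <= g / 16 -> t <= (1 + g / 4) * a ->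
  h <= a ^+ 2 / 2 -> 
  lam * t - lam * ((1 + g) * a) * (1 - 2 * (lam * w)) + lam ^+ 2 <= - (g ^+ 2 / 32 * h).
Proof.
move=> /andP[g0 g1] a0 lamE lw0 lw ta ha.
have lam0 : 0 <= lam by rewrite lamE divr_ge0// mulr_ge0.
have h1 := ler_wpM2l lam0 ta.
have h2 : (1 + g) * (2 * (lam * w)) <= g / 4.
  have : g * (lam * w) <= 1 * (lam * w) by rewrite ler_wpM2r.
  lra.
have h3 := ler_wpM2l (mulr_ge0 lam0 a0) h2.
have h4 : lam ^+ 2 = g ^+ 2 * a ^+ 2 / 64 by rewrite lamE; lra.
have h5 : lam * a * g = g ^+ 2 * a ^+ 2 / 8 by rewrite lamE; lra.
have h6 := ler_wpM2l (sqr_ge0 g) ha.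
have h7 : 0 <= g ^+ 2 * a ^+ 2 by rewrite mulr_ge0 ?sqr_ge0.
rewrite h4; lra.
Qed.

Section Level.
Context (R : realType) (disp : measure_display) (T : measurableType disp)
  (P : probability T R) (d k : nat) (D : set 'rV[int]_d).
Context (xi : 'rV[int]_d -> {RV P >-> R}).
Hypothesis xi_iid : iid_std_normal D xi.
Hypotheses (k_gt0 : (0 < k)%N)
  (freq_D : forall u l, u \in subsets d k -> freq_on u l -> D l).
Variables (sigma eps b kappa : R) (rho : nat -> R) (rstar : nat -> nat -> R).
Variables (thetastar : nat -> 'rV[int]_d -> R) (m : nat).
Variables (r nu : R) (eta : {set 'I_d} -> bool) (theta : 'rV[int]_d -> R) (q M : nat).
Local Notation L := (ln (binr R d k)).
Local Notation beta_m := (grid b rho k m).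
Let a := Num.sqrt (2 * beta_m * L).
Let V := 2 * eps ^+ 4 * a ^+ 2.
Let D0 := (4 * pi ^+ 2 * (k%:R * (q * M)%N%:R ^+ 2)) `^ sigma.
Definition gap : R := nu * (K3 sigma / 3).
Let wmax : R := Num.sqrt (2 / M%:R ^+ k).
Let t := Num.sqrt ((2 * beta_m + kappa) * L).
Hypotheses (sigma_gt0 : 0 < sigma) (eps_gt0 : 0 < eps) (nu_01 : 0 < nu <= 1).
Hypotheses (b_gt0 : 0 < b) (beta_ge : b <= beta_m) (beta_lt1 : beta_m <= 1)
  (kappa_ge0 : 0 <= kappa).
Hypothesis starP : forall u, u \in subsets d k ->
  [/\ 0 < rstar k m, detection sigma eps u (rstar k m) = a &
      is_minimizer sigma u (rstar k m) (thetastar m)].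
Hypotheses (M_gt0 : (0 < M)%N)
  (q_big : 2 * (1 + K1 sigma) <= (q%:R ^+ 2 / 2) `^ sigma)
  (few : D0 ^+ 2 * (expR 1 * (2 * (q * M)%N%:R)) ^+ k * V < 1).
Hypothesis theta_in : forall u, u \in subsets d k -> ellipsoid sigma u r theta.
Hypothesis far : forall u z, u \in subsets d k -> ellipsoid sigma u r z ->
  (((1 + nu) ^+ 2 * V)%:E < quartic u z)%E.
Hypotheses (L_big : 1 <= 3 * L) (kappa_small : kappa <= b * gap)
  (kappa_le1 : kappa <= 1)
  (w_small : Num.sqrt (3 * L) ^+ 3 * wmax <= gap / 8).

Lemma gap_gt0_le1 : 0 < gap <= 1.
Proof.
have K3p := K3_gt0 sigma_gt0; have /andP[n0 n1] := nu_01.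
have K1p := K1_gt0 sigma_gt0; have K2p := K2_ge2 sigma_gt0.
have K3le : K3 sigma <= 1.
  rewrite /K3 invf_le1; last first.
    by apply: mulr_gt0; [apply: mulr_gt0|]; lra.
  have : 0 <= K1 sigma * (K2 sigma - 2) by apply: mulr_ge0; lra.
  lra.
rewrite /gap; apply/andP; split; first by rewrite mulr_gt0// divr_gt0.
have : nu * (K3 sigma / 3) <= 1 * (1 / 3).
  by apply: ler_pM; lra.
lra.
Qed.

Let a_gt0 : 0 < a.
Proof.
have h := beta_ge; have hb := b_gt0; have hL := L_big.
by rewrite sqrtr_gt0; apply: mulr_gt0; [apply: mulr_gt0|]; lra.
Qed.

(** On inactive components the tilt lam0 = t is optimal in the Gaussian approximation and gives -
    t^2 / 2 = - (beta_m + kappa / 2) L; the correction 2 t^3 wmax stays below 1/2 by [w_small],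
    whence the factor 2. On active components, [kappa <= b * gap] keeps the threshold below (1 + gap
    / 4) a, well under the mean (1 + gap) a. *)
Lemma level_majorant : exists g : {set 'I_d} -> T -> R,
  let cb u := if eta u then expR (- (gap ^+ 2 * b / 32 * L))
              else 2 * expR (- ((beta_m + kappa / 2) * L)) in
  let us := enum (subsets d k) in
  [/\ forall u, measurable_fun setT (g u), forall u om, 0 <= g u om,
      forall u om, u \in us ->
        selector_at sigma eps b kappa rho rstar thetastar
          (observation eps eta theta (fun l => xi l om)) m u != eta u -> 1 <= g u om,
      forall u, u \in us -> (\int[P]_om (g u om)%:E <= (cb u)%:E)%E &
      (\int[P]_om (\prod_(u <- us) (1 + 3 * g u om))%:E <=
       (expR (3 * \sum_(u <- us) cb u))%:E)%E].
Proof.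
have /andP[gap0 gap1] := gap_gt0_le1.
have a0 := a_gt0; have e0 := eps_gt0; have b0 := b_gt0; have Lb := L_big.
have L0 : 0 <= L by lra.
have a2 : a ^+ 2 = 2 * beta_m * L.
  rewrite sqr_sqrtr// !mulr_ge0//; have := beta_ge; lra.
have e4 : 0 < eps ^+ 4 by rewrite exprn_gt0.
have V0 : 0 < V by rewrite /V !mulr_gt0// exprn_gt0.
have usP u : u \in subsets d k -> #|u| = k by rewrite inE => /eqP.
have cons u : exists s : seq 'rV[int]_d, u \in subsets d k ->
  [/\ uniq s /\ forall l, l \in s -> freq_on u l,
      forall l, freq_on u l -> l \notin s -> thetastar m l = 0,
      \sum_(l <- s) (thetastar m l ^+ 2) ^+ 2 = V,
      forall l, freq_on u l -> (thetastar m l ^+ 2) ^+ 2 * M%:R ^+ k <= 4 * V &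
      (1 + gap) * V <= \sum_(l <- s) thetastar m l ^+ 2 * theta l ^+ 2].
  have [uu|_] := boolP (u \in subsets d k); last by exists [::].
  have uk := usP _ uu; have [r0 dE minE] := starP uu.
  have u0 : (0 < #|u|)%N by rewrite uk.
  have qE : quartic u (thetastar m) = V%:E by exact: (quartic_of_detection eps_gt0 a0 dE minE).
  have few' : ((4 * pi ^+ 2 * (#|u|%:R * (q * M)%N%:R ^+ 2)) `^ sigma) ^+ 2 *
    (size (freqs sigma u ((4 * pi ^+ 2 * (#|u|%:R * (q * M)%N%:R ^+ 2)) `^ sigma)))%:R
    * V < 1.
    apply: le_lt_trans few; rewrite uk ler_wpM2r ?(ltW V0)// ler_wpM2l ?sqr_ge0//.
    have q0 : (0 < q * M)%N.
      rewrite muln_gt0 M_gt0 andbT lt0n; apply/negP => /eqP q00.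
      move: q_big; rewrite q00 expr0n mul0r powR0 ?gt_eqF//.
      by have := K1_gt0 sigma_gt0; lra.
    by have := size_freqs_le sigma_gt0 u q0; rewrite uk.
  have [s [us s0 sV sM sG]] :=
    minimizer_consequences sigma_gt0 u0 r0 minE V0 qE M_gt0 q_big few'.
  exists s => _; split => //; first by rewrite -uk.
  by apply: (sG r nu nu_01 (fun z => far uu)); exact: theta_in.
have {cons} [s sP] := choice cons.
pose w l : R := if #|fsupp l| == k then weight sigma eps rstar thetastar (fsupp l) m l else 0.
have wE u l : u \in subsets d k -> freq_on u l ->
    weight sigma eps rstar thetastar u m l = w l /\
    w l = thetastar m l ^+ 2 / (2 * eps ^+ 2 * a).
  move=> uu /freq_onE lu; rewrite /w lu (usP _ uu) eqxx; split => //.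
  by rewrite /weight (usP _ uu); have [_ -> _] := starP uu.
(* The weights are the squares of the minimizer divided by [c]. As [c ^+ 2 = 2 * V], their squares
   sum to 1/2 and are each at most 2 / M^k. *)
pose c := 2 * eps ^+ 2 * a; have c0 : 0 < c by rewrite /c !mulr_gt0// exprn_gt0.
have c2 : c ^+ 2 = 2 * V by rewrite /c /V; lra.
have Mk : 0 < M%:R ^+ k :> R by rewrite exprn_gt0// ltr0n.
have wmax0 : 0 <= wmax by exact: sqrtr_ge0.
have w_bd l : 0 <= w l <= wmax.
  rewrite /w; case: eqP => [lk|_]; last by rewrite lexx wmax0.
  have uu : fsupp l \in subsets d k by rewrite inE lk.
  have lf : freq_on (fsupp l) l by apply/freq_onE.
  have [-> ->] := wE _ _ uu lf; rewrite -/c.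
  have wn : 0 <= thetastar m l ^+ 2 / c by rewrite divr_ge0 ?sqr_ge0 ?(ltW c0).
  rewrite wn /= -(@ler_pXn2r _ 2) ?nnegrE// /wmax sqr_sqrtr; last first.
    by rewrite divr_ge0 ?(ltW Mk).
  rewrite expr_div_n c2 ler_pdivrMr; last by rewrite mulr_gt0.
  have [_ _ _ h _] := sP _ uu; have := h l lf.
  rewrite -ler_pdivlMr//; move: (M%:R ^+ k)^-1 => i; lra.
have s_uniq u : u \in enum (subsets d k) -> uniq (s u).
  by rewrite mem_enum => uu; have [[]] := sP _ uu.
have s_freq u l : u \in enum (subsets d k) -> l \in s u -> freq_on u l /\ D l.
  rewrite mem_enum => uu ls; have [[_ h] _ _ _ _] := sP _ uu.
  by split; [exact: h|exact: (freq_D uu (h l ls))].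
have w_sqr u : u \in enum (subsets d k) -> \sum_(l <- s u) w l ^+ 2 = 2^-1.
  rewrite mem_enum => uu; have [[_ h] _ sV _ _] := sP _ uu.
  rewrite (eq_big_seq (fun l => (thetastar m l ^+ 2) ^+ 2 * (c ^+ 2)^-1)); last first.
    by move=> l /h lf; have [_ ->] := wE _ _ uu lf; rewrite expr_div_n.
  by rewrite -mulr_suml sV c2 invfM mulrCA divff ?mulr1// gt_eqF.
pose mu l := theta l / eps.
have mean_ge u : u \in enum (subsets d k) -> eta u ->
    (1 + gap) * a <= \sum_(l <- s u) w l * mu l ^+ 2.
  rewrite mem_enum => uu _; have [[_ h] _ _ _ sG] := sP _ uu.
  rewrite (eq_big_seq (fun l => (c * eps ^+ 2)^-1 *
     (thetastar m l ^+ 2 * theta l ^+ 2))); last first.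
    move=> l /h lf; have [_ ->] := wE _ _ uu lf; rewrite -/c /mu expr_div_n (invfM c).
    by move: c^-1 (eps ^+ 2)^-1 => i j; lra.
  rewrite -mulr_sumr ler_pdivlMl; last by rewrite mulr_gt0// exprn_gt0.
  by apply: le_trans sG; rewrite /V /c; lra.
pose lam1 := gap * a / 8.
(* [Num.sqrt (3 * L)] dominates both [t] and [a], because 2 beta_m + kappa <= 3. *)
have T1 : 1 <= Num.sqrt (3 * L).
  by rewrite -[leLHS]sqrtr1 ler_wsqrtr.
have t0 : 0 <= t by exact: sqrtr_ge0.
have t2 : t ^+ 2 = (2 * beta_m + kappa) * L.
  rewrite sqr_sqrtr// mulr_ge0//; have := beta_ge; have := kappa_ge0; lra.
have tT : t <= Num.sqrt (3 * L).
  rewrite ler_wsqrtr// ler_wpM2r//; have := beta_lt1; have := kappa_le1; lra.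
have aT : a <= Num.sqrt (3 * L).
  rewrite ler_wsqrtr// ler_wpM2r//; have := beta_lt1; lra.
have T3 : Num.sqrt (3 * L) * wmax <= Num.sqrt (3 * L) ^+ 3 * wmax.
  by apply: ler_wpM2r => //; exact: ler_eXnr.
have Tw : Num.sqrt (3 * L) * wmax <= gap / 8 by exact: le_trans w_small.
have tw : t * wmax <= gap / 8 by apply: le_trans Tw; rewrite ler_wpM2r.
have aw : a * wmax <= gap / 8 by apply: le_trans Tw; rewrite ler_wpM2r.
have lam1_ge0 : 0 <= lam1 by rewrite /lam1 divr_ge0// mulr_ge0// ltW.
have aw0 : 0 <= a * wmax by rewrite mulr_ge0// ltW.
have lw : lam1 * wmax <= a * wmax / 8.
  have : gap * (a * wmax) <= 1 * (a * wmax) by rewrite ler_wpM2r.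
  rewrite /lam1; lra.
have lw16 : lam1 * wmax <= gap / 16 by lra.
have lam0_small : t * wmax <= 8^-1 by lra.
have lam1_small : lam1 * wmax <= 8^-1 by lra.
have [g [mg g0 g1 gE gP]] := @chernoff R disp T P d D xi xi_iid eta mu w
  (enum (subsets d k)) s (enum_uniq _) s_uniq s_freq wmax t lam1 t ((1 + gap) * a)
  w_bd w_sqr mean_ge t0 lam1_ge0 lam0_small lam1_small.
have cb_le u : chernoff_bound eta wmax t lam1 t ((1 + gap) * a) u <=
    if eta u then expR (- (gap ^+ 2 * b / 32 * L))
    else 2 * expR (- ((beta_m + kappa / 2) * L)).
  rewrite /chernoff_bound; case: ifP => _.
    rewrite ler_expR.
    have ta : t <= (1 + gap / 4) * a.
      rewrite -(@ler_pXn2r _ 2) ?nnegrE//; last by rewrite mulr_ge0 ?(ltW a0)//; lra.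
      rewrite exprMn t2 a2; have : kappa <= beta_m * gap.
        apply: (le_trans kappa_small); rewrite ler_wpM2r ?(ltW gap0)//; exact: beta_ge.
      move/(ler_wpM2r L0).
      have : 0 <= gap ^+ 2 * (beta_m * L).
        rewrite mulr_ge0 ?sqr_ge0// mulr_ge0//; have := beta_ge; lra.
      lra.
    have lw0 : 0 <= lam1 * wmax by rewrite mulr_ge0.
    have -> : gap ^+ 2 * b / 32 * L = gap ^+ 2 / 32 * (b * L) by lra.
    apply: (signal_exponent_le _ (ltW a0) (erefl _) lw0 _ ta).
    - by rewrite (ltW gap0).
    - exact: lw16.
    - have h : b * L <= beta_m * L by rewrite ler_wpM2r//; exact: beta_ge.
      by apply: (le_trans h); rewrite a2; lra.
  have hT3 : t ^+ 3 * wmax <= gap / 8.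
    apply: le_trans w_small; rewrite ler_wpM2r// lerXn2r ?nnegrE// (le_trans ler01 T1)//.
  have e2 := expR_half_le2 R.
  apply: (@le_trans _ _ (expR 2^-1 * expR (- ((beta_m + kappa / 2) * L)))); last first.
    by rewrite ler_wpM2r ?expR_ge0.
  rewrite -expRD ler_expR; lra.
exists g => cb us; split => //.
- move=> u om uu err; apply: (g1 u om uu); move: err.
  have uu' : u \in subsets d k by move: uu; rewrite mem_enum.
  have uk := usP _ uu'; have [[us_ h] s0 _ _ _] := sP _ uu'.
  rewrite /selector_at uk -/t; congr (_ != _); congr (_ < _).
  rewrite /Sstat (rsum_supported us_ h); last first.
    by move=> l lf lo; rewrite /weight (s0 l lf lo) expr0n !mul0r.
  rewrite /shifted_chi2; apply: eq_big_seq => l /h lf.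
  have [-> _] := wE _ _ uu' lf; congr (_ * (_ ^+ 2 - 1)).
  move/freq_onE : lf => lu; rewrite /observation lu mulrDl -mulrA; congr (_ + _).
  by rewrite mulrC mulKf// gt_eqF.
- by move=> u uu; apply: (le_trans (gE u uu)); rewrite lee_fin.
- apply: (le_trans gP); rewrite lee_fin ler_expR ler_wpM2l//.
  by apply: ler_sum => u _; exact: cb_le.
Qed.
End Level.

Section RiskBound.
Context (R : realType) (disp : measure_display) (T : measurableType disp)
  (P : probability T R) (d k : nat) (D : set 'rV[int]_d).
Context (xi : 'rV[int]_d -> {RV P >-> R}).
Hypothesis xi_iid : iid_std_normal D xi.
Hypotheses (k_gt0 : (0 < k)%N)
  (freq_D : forall u l, u \in subsets d k -> freq_on u l -> D l).
Variables (sigma eps b B beta kappa delta : R) (rho tau : nat -> R).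
Variables (rstar : nat -> nat -> R) (thetastar : nat -> 'rV[int]_d -> R).
Variables (r nu : R) (eta : {set 'I_d} -> bool) (theta : 'rV[int]_d -> R) (q M : nat).
Local Notation n := (binr R d k).
Local Notation L := (ln (binr R d k)).
Let D0 := (4 * pi ^+ 2 * (k%:R * (q * M)%N%:R ^+ 2)) `^ sigma.
Let wmax : R := Num.sqrt (2 / M%:R ^+ k).
Local Notation gap := (gap sigma nu).
Hypotheses (sigma_gt0 : 0 < sigma) (eps_gt0 : 0 < eps) (nu_01 : 0 < nu <= 1).
Hypotheses (b_gt0 : 0 < b) (B_lt1 : B < 1) (beta_bB : b <= beta <= B) (kappa_gt0 : 0 < kappa).
Hypotheses (rho_gt0 : 0 < rho k) (rho_log : rho k * L <= 1) (rho_bin : 1 <= rho k * n).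
Hypotheses (tau_gt0 : 0 < tau k) (tau_lower : expR (kappa / 8 * L) <= tau k)
  (tau_upper : 48 * tau k <= expR (kappa / 2 * L)).
Hypothesis starP : forall u m, u \in subsets d k -> (1 <= m <= grid_size b B rho k)%N ->
  [/\ 0 < rstar k m, detection sigma eps u (rstar k m) = Num.sqrt (2 * grid b rho k m * L) &
      is_minimizer sigma u (rstar k m) (thetastar m)].
Hypotheses (M_gt0 : (0 < M)%N)
  (q_big : 2 * (1 + K1 sigma) <= (q%:R ^+ 2 / 2) `^ sigma)
  (few : D0 ^+ 2 * (expR 1 * (2 * (q * M)%N%:R)) ^+ k * (4 * eps ^+ 4 * L) < 1).
Hypotheses (delta_le1 : delta <= 1) (eta_in : sparse_class beta delta k eta).
Hypothesis theta_in : forall u, u \in subsets d k -> ellipsoid sigma u r theta.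
Hypothesis detected : forall u, u \in subsets d k ->
  (1 + nu) * Num.sqrt (2 * beta * L) < detection sigma eps u r.
Hypotheses (L_big : 1 <= 3 * L) (kappa_small : kappa <= b * gap)
  (kappa_le1 : kappa <= 1 - B) (kappa_gap : kappa <= gap ^+ 2 * b / 16)
  (w_small : Num.sqrt (3 * L) ^+ 3 * wmax <= gap / 8).

(** An exponent p with p (1 - B) / 2 >= 3: then expR (- y / 4) <= p! 4^p / y^p is of order n^-3 as
    soon as y >= n^((1 - B) / 2). *)
Definition risk_exponent : nat := (Num.truncn (6 / (1 - B))).+1.
Definition risk_constant : R :=
  8 + 4 * (risk_exponent`!%:R * 4 ^+ risk_exponent).

Let m0 := (Num.truncn ((beta - b) / rho k)).+1.
Local Notation beta_m m := (grid b rho k m).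

Let L_ge0 : 0 <= L. Proof. have h := L_big; lra. Qed.

Let n_gt0 : 0 < n.
Proof.
rewrite /binr lt0r ler0n andbT; apply/eqP => n0.
by have := L_big; rewrite /binr n0 ln0// mulr0 ler10.
Qed.

Let powE x : n `^ x = expR (x * L).
Proof. by rewrite /powR gt_eqF. Qed.

Let nE : n = expR L. Proof. by rewrite lnK// posrE. Qed.

Let grid_le m : (1 <= m <= m0)%N -> b <= beta_m m <= beta_m m0.
Proof.
move=> /andP[m1 mm]; have r0 := ltW rho_gt0; rewrite /grid lerDl mulr_ge0//=.
by rewrite lerD2l ler_wpM2r// ler_nat -ltnS prednK.
Qed.

Let grid_m0 : beta_m m0 <= beta < beta_m m0 + rho k.
Proof.
have /andP[h1 h2] := beta_bB; have x0 : 0 <= (beta - b) / rho k.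
  by rewrite divr_ge0 ?(ltW rho_gt0)// subr_ge0.
have /andP[t1 t2] := truncn_itv x0.
rewrite /grid /m0 /=; apply/andP; split.
  by move: t1; rewrite ler_pdivlMr//; lra.
by move: t2; rewrite ltr_pdivrMr// -natr1; lra.
Qed.

Let m0_le : (m0 <= grid_size b B rho k)%N.
Proof.
rewrite /m0 /grid_size ltnS leqW//; apply: le_truncn.
rewrite ler_wpM2r ?invr_ge0 ?(ltW rho_gt0)//.
by rewrite lerD2r; case/andP : beta_bB.
Qed.

Let v m := vthr d b rho tau k m.

Let vE m : v m = expR ((1 - beta_m m) * L) / tau k.
Proof. by rewrite /v /vthr powE. Qed.

Let beta_lt1 : beta < 1.
Proof. by case/andP : beta_bB => _ h; exact: le_lt_trans B_lt1. Qed.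

Let exp_tail (y : R) : expR ((1 - B) / 2 * L) <= y ->
  expR (- (y / 4)) <= risk_exponent`!%:R * 4 ^+ risk_exponent * expR (- (3 * L)).
Proof.
move=> ybig; set p := risk_exponent.
have y0 : 0 < y by apply: lt_le_trans ybig; exact: expR_gt0.
have y4 : 0 <= y / 4 by lra.
have h := expR_ge1Dxn (Num.truncn (6 / (1 - B))) y4; rewrite -/risk_exponent -/p in h.
have f0 : 0 < p`!%:R :> R by rewrite ltr0n fact_gt0.
have yp : expR (3 * L) <= y ^+ p.
  have B1 : 0 < 1 - B by have := B_lt1; lra.
  apply: (@le_trans _ _ (expR ((1 - B) / 2 * L) ^+ p)); last first.
    by rewrite lerXn2r ?nnegrE ?expR_ge0 ?(ltW y0).
  rewrite -expRM_natl ler_expR mulrA ler_wpM2r//.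
  have : 6 / (1 - B) <= p%:R by rewrite ltW// /p truncnS_gt.
  by rewrite ler_pdivrMr//; lra.
have y4p : expR (3 * L) / (4 ^+ p * p`!%:R) <= expR (y / 4).
  have -> : expR (3 * L) / (4 ^+ p * p`!%:R) = expR (3 * L) / 4 ^+ p / p`!%:R.
    by rewrite invfM mulrA.
  apply: (@le_trans _ _ ((y / 4) ^+ p / p`!%:R)); last lra.
  rewrite ler_wpM2r ?invr_ge0 ?(ltW f0)// expr_div_n ler_wpM2r//.
have A0 : 0 < 4 ^+ p * p`!%:R :> R by rewrite mulr_gt0 ?exprn_gt0.
rewrite !expRN -[leLHS]mul1r ler_pdivrMr ?expR_gt0// mulrAC ler_pdivlMr ?expR_gt0// mul1r.
by move: y4p; rewrite ler_pdivrMr// (mulrC (4 ^+ p)) [leRHS]mulrC.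
Qed.

(** After normalization, [v m0] becomes n^(beta - beta_m0) / tau; the grid step makes the power of n
    at most e, and tau >= n^(kappa / 8). In the rejection term n m0 expR (- v m0 / 4), m0 is at most
    2n while the exponential is of order n^-3, because kappa <= 1 - B leaves v m0 >= n^((1 - B) /
    2). *)
Lemma risk_bound : exists G : T -> R,
  (forall om, let x := observation eps eta theta (fun l => xi l om) in
     n `^ (beta - 1) * (hamming k (selector sigma eps b B kappa rho tau rstar thetastar x) eta)%:R
     <= G om) /\
  mean_le P G (risk_constant * expR (- (kappa / 8 * L))).
Proof.
have /andP[b1 b2] := beta_bB; have kb := kappa_gt0; have kB := kappa_le1.
have /andP[gm1 gm2] := grid_m0; have bl1 := beta_lt1; have L0 := L_ge0.
have n0 := n_gt0; have tau0 := tau_gt0; have Lb := L_big.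
have e40 : 0 < eps ^+ 4 by rewrite exprn_gt0.
have m0_gt0 : (0 < m0)%N by [].
have v_gt0 m : 0 < v m by rewrite vE divr_gt0 ?expR_gt0.
have v_ge m : (1 <= m <= m0)%N -> v m0 <= v m.
  move=> /grid_le /andP[_ h]; rewrite !vE ler_wpM2r ?invr_ge0 ?(ltW tau0)//.
  by rewrite ler_expR ler_wpM2r//; lra.
pose cb m u := if eta u then expR (- (gap ^+ 2 * b / 32 * L))
               else 2 * expR (- ((beta_m m + kappa / 2) * L)).
have ones : (\sum_(u in subsets d k) (eta u : nat))%:R <= 2 * expR ((1 - beta) * L).
  move: eta_in; rewrite /sparse_class /=; set N := (_%:R : R).
  rewrite powE ler_norml => /andP[_ h].
  have : expR ((beta - 1) * L) * N <= 2 by have := delta_le1; lra.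
  move/(ler_wpM2l (expR_ge0 ((1 - beta) * L))); rewrite mulrA -expRD.
  have -> : (1 - beta) * L + (beta - 1) * L = 0 by lra.
  by rewrite expR0 mul1r mulrC.
(* At most 2 n^(1 - beta) active components are missed with probability n^(- gap^2 b / 32) <= n^(-
   kappa / 2) each, and at most n inactive ones are false positives. Either family contributes at
   most 2 n^(1 - beta_m - kappa / 2), and 48 = 4 * 12 in the bound on [tau] turns the total into v /
   12. *)
have cb_small m : (1 <= m <= m0)%N -> \sum_(u <- enum (subsets d k)) cb m u <= v m / 12.
  move=> mP; have /andP[bm1 bm2] := grid_le mP.
  have cb_le u : cb m u <= (eta u)%:R * expR (- (gap ^+ 2 * b / 32 * L)) +
      2 * expR (- ((beta_m m + kappa / 2) * L)).
    rewrite /cb; case: (eta u); rewrite ?mul1r ?mul0r ?add0r//.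
    by rewrite lerDl mulr_ge0 ?expR_ge0.
  apply: le_trans (ler_sum _ (fun u _ => cb_le u)) _.
  rewrite big_split/= -mulr_suml !big_enum/= -natr_sum sumr_const.
  have cardE : #|subsets d k|%:R = n by rewrite card_draws card_ord.
  rewrite -[X in _ + X <= _]mulr_natr cardE.
  set E1 := expR (- (gap ^+ 2 * b / 32 * L)); set E2 := expR (- ((beta_m m + kappa / 2) * L)).
  pose W := expR ((1 - beta_m m) * L) * expR (- (kappa / 2 * L)).
  have h1 : 2 * expR ((1 - beta) * L) * E1 <= 2 * W.
    rewrite -mulrA ler_wpM2l// /E1 /W -!expRD ler_expR.
    have : beta_m m * L <= beta * L by rewrite ler_wpM2r//; lra.
    have := ler_wpM2r L0 kappa_gap; lra.
  have h2 : 2 * E2 * n = 2 * W.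
    by rewrite [in LHS]nE /E2 /W -mulrA -!expRD; congr (_ * expR _); lra.
  have h3 := ler_wpM2r (expR_ge0 (- (gap ^+ 2 * b / 32 * L))) ones.
  have h4 : 48 * W <= v m.
    rewrite vE /W expRN ler_pdivlMr//.
    have tk := tau_upper; have ek := expR_gt0 (kappa / 2 * L).
    have X0 := expR_ge0 ((1 - beta_m m) * L).
    have : 48 * tau k / expR (kappa / 2 * L) <= 1 by rewrite ler_pdivrMr// mul1r.
    move/(ler_wpM2l X0); move: (expR ((1 - _) * L)) (expR (kappa / 2 * L))^-1 => X Y; lra.
  by rewrite h2; move: h1 h3 h4; rewrite -/E1; lra.
pose xo om := observation eps eta theta (fun l => xi l om).
pose sel om m := selector_at sigma eps b kappa rho rstar thetastar (xo om) m.
have majorants m : (1 <= m <= m0)%N -> exists g : {set 'I_d} -> T -> R,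
  [/\ forall u, measurable_fun setT (g u), forall u om, 0 <= g u om,
      forall u om, u \in enum (subsets d k) -> sel om m u != eta u -> 1 <= g u om,
      forall u, u \in enum (subsets d k) -> (\int[P]_om (g u om)%:E <= (cb m u)%:E)%E &
      (\int[P]_om (\prod_(u <- enum (subsets d k)) (1 + 3 * g u om))%:E <=
       (expR (3 * \sum_(u <- enum (subsets d k)) cb m u))%:E)%E].
  move=> mP; have /andP[bm1 bm2] := grid_le mP; have /andP[m1 mm] := mP.
  have mG : (1 <= m <= grid_size b B rho k)%N by rewrite m1 (leq_trans mm m0_le).
  have bm0 : 0 <= beta_m m by have := b_gt0; lra.
  have a_ge0 : 0 <= 2 * beta_m m * L by rewrite mulr_ge0//; lra.
  have sq_a := sqr_sqrtr a_ge0.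
  apply: (@level_majorant R disp T P d k D xi xi_iid k_gt0 freq_D sigma eps b kappa rho
    rstar thetastar m r nu eta theta q M sigma_gt0 eps_gt0 nu_01 b_gt0 bm1
    _ (ltW kappa_gt0) (fun u uu => starP uu mG) M_gt0 q_big _ theta_in _ L_big kappa_small
    _ w_small).
  - lra.
  - apply: le_lt_trans few; rewrite -/D0 ler_wpM2l//.
      by rewrite mulr_ge0 ?sqr_ge0// exprn_ge0// mulr_ge0 ?expR_ge0.
    rewrite sq_a; have : 0 <= (1 - beta_m m) * (eps ^+ 4 * L).
      by apply: mulr_ge0; [lra|exact: mulr_ge0 (ltW e40) L0].
    lra.
  (* Separation at [beta] implies separation at every grid level not above [beta]. *)
  - move=> u z uu zE.
    have det0 : 0 < detection sigma eps u r.
      apply: le_lt_trans (detected uu); rewrite mulr_ge0 ?sqrtr_ge0//.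
      by case/andP : nu_01; lra.
    apply: lt_le_trans (detection_le_quartic eps_gt0 det0 (lexx _) zE).
    rewrite lte_fin mulrCA ltr_pM2l ?mulr_gt0// -exprMn.
    rewrite ltr_pXn2r ?nnegrE ?(ltW det0)//; last first.
      by rewrite mulr_ge0 ?sqrtr_ge0//; case/andP : nu_01; lra.
    apply: le_lt_trans (detected uu); rewrite ler_wpM2l//.
      by case/andP : nu_01; lra.
    by rewrite ler_wsqrtr// ler_wpM2r//; lra.
  - have := b_gt0; lra.
have [G [GH GM]] := selector_risk m0_gt0 m0_le (ltW (v_gt0 m0)) v_ge cb_small majorants.
exists (fun om => n `^ (beta - 1) * G om); split.
  move=> om; cbv zeta; rewrite ler_wpM2l ?powR_ge0//; apply: le_trans (GH om).
  rewrite ler_nat; apply: leq_sum => u; rewrite inE => /eqP uk.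
  by rewrite /selector uk.
apply: (mean_le_trans (mean_leZ (powR_ge0 _ _) GM)); rewrite powE.
set Q := expR (- (kappa / 8 * L)); set E := expR (- (v m0 / 4)).
pose F : R := risk_exponent`!%:R * 4 ^+ risk_exponent.
have F0 : 0 <= F by rewrite mulr_ge0// exprn_ge0.
have first : expR ((beta - 1) * L) * v m0 <= 4 * Q.
  rewrite vE mulrA -expRD.
  have h1 : expR ((beta - 1) * L + (1 - beta_m m0) * L) <= expR 1.
    rewrite ler_expR; apply: le_trans rho_log.
    have : (beta - beta_m m0) * L <= rho k * L by rewrite ler_wpM2r//; lra.
    lra.
  have h2 : (tau k)^-1 <= Q.
    by rewrite /Q expRN lef_pV2 ?posrE ?expR_gt0.
  apply: ler_pM => //; rewrite ?expR_ge0 ?invr_ge0 ?(ltW tau0)//.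
  exact: le_trans h1 (expR1_le4 R).
have second : expR ((beta - 1) * L) * (n * m0%:R * E) <= 2 * F * Q.
  have h1 : expR ((beta - 1) * L) <= 1.
    by rewrite -[leRHS]expR0 ler_expR mulr_le0_ge0//; lra.
  have h2 : m0%:R <= 2 * n.
    have x0 : 0 <= (beta - b) / rho k by rewrite divr_ge0 ?(ltW rho_gt0)// subr_ge0.
    have /andP[t1 _] := truncn_itv x0.
    have h : (beta - b) / rho k <= n.
      rewrite ler_pdivrMr//; have := rho_bin; have := b_gt0; lra.
    have n1 : 1 <= n by rewrite /binr ler1n -(ltr0n R).
    by rewrite /m0 -natr1; lra.
  have h3 : E <= F * expR (- (3 * L)).
    apply: exp_tail; rewrite vE ler_pdivlMr//.
    have h4 : tau k <= expR (kappa / 2 * L) by have := tau_upper; lra.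
    apply: le_trans (ler_wpM2l (expR_ge0 _) h4) _; rewrite -expRD ler_expR.
    rewrite -mulrDl ler_wpM2r//; lra.
  have E0 : 0 <= E by exact: expR_ge0.
  apply: (@le_trans _ _ (1 * (n * (2 * n) * (F * expR (- (3 * L)))))).
    apply: ler_pM => //.
      by rewrite !mulr_ge0// ltW.
    apply: ler_pM => //; first by rewrite mulr_ge0// ltW.
    by rewrite ler_wpM2l// ltW.
  have -> : 1 * (n * (2 * n) * (F * expR (- (3 * L)))) = 2 * F * expR (- L).
    have : expR L * (expR L * expR (- (3 * L))) = expR (- L).
      by rewrite -!expRD; congr expR; lra.
    rewrite -nE.
    by move=> <-; move: (expR _) => X; lra.
  rewrite ler_wpM2l ?mulr_ge0// ler_expR lerN2.
  have : (1 - kappa / 8) * L >= 0 by rewrite mulr_ge0//; have := b_gt0; lra.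
  lra.
by rewrite /risk_constant -/F; lra.
Qed.
End RiskBound.

(** * The limit of vanishing noise *)

(** C(d+1, k+1) = C(d, k) (d+1)/(k+1), where k may be replaced by s in the denominator; as d/s >=
    (d+1)/(s+1), the induction can lower d, s and k together. *)
Lemma bin_ge_exp (R : realType) (d s k : nat) : (k <= s <= d)%N ->
  (d%:R / s%:R) ^+ k <= binr R d k.
Proof.
elim: k d s => [|k IH] d s /andP[ks sd]; first by rewrite expr0 /binr bin0.
case: s d ks sd => [//|s] [//|d]; rewrite !ltnS => ks sd.
have sd1 : 0 < s.+1%:R :> R by rewrite ltr0n.
have k1 : 0 < k.+1%:R :> R by rewrite ltr0n.
have binE : binr R d.+1 k.+1 = d.+1%:R * binr R d k / k.+1%:R.
  rewrite /binr -natrM mul_bin_diag natrM mulrC mulKf//.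
rewrite binE exprS -mulrA -mulrA ler_wpM2l//.
have step : (d.+1%:R / s.+1%:R) ^+ k <= binr R d k :> R.
  apply: le_trans (IH d s _); last by rewrite ks.
  case: k {IH k1 binE} ks => [//|k] ks.
  have s0 : 0 < s%:R :> R by rewrite ltr0n (leq_ltn_trans _ ks).
  rewrite lerXn2r ?nnegrE ?divr_ge0// ler_pdivrMr// mulrAC ler_pdivlMr//.
  rewrite -!natr1; have : s%:R <= d%:R :> R by rewrite ler_nat.
  lra.
rewrite [leRHS]mulrC ler_pM ?invr_ge0 ?exprn_ge0 ?divr_ge0//.
by rewrite lef_pV2 ?posrE// ler_nat.
Qed.

Lemma bin_le_exp (R : realType) (d k : nat) : binr R d k <= d%:R ^+ k.
Proof.
rewrite /binr -natrX ler_nat; apply: (@leq_trans (d ^_ k)).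
  by rewrite -bin_ffact leq_pmulr// fact_gt0.
by elim: k => [//|k IH]; rewrite ffactnSr expnSr leq_mul// leq_subr.
Qed.

Lemma ln_bin_ge (R : realType) (d s k : nat) : (1 <= k <= s)%N -> (s <= d)%N ->
  k%:R * ln (d%:R / s%:R) <= ln (binr R d k).
Proof.
move=> /andP[k1 ks] sd.
have x0 : 0 < d%:R / s%:R :> R.
  by have s0 := leq_trans k1 ks; rewrite divr_gt0// ltr0n// (leq_trans s0).
rewrite mulr_natl -lnXn// ler_ln ?posrE ?exprn_gt0//.
  by apply: bin_ge_exp; rewrite ks.
by rewrite /binr ltr0n bin_gt0 (leq_trans ks).
Qed.

(** * Choice of the frequency cutoff *)

Section Cutoff.
Variables (R : realType) (sigma : R) (k : nat) (l : R).
Hypotheses (sigma_gt0 : 0 < sigma) (l_ge0 : 0 <= l) (k_gt0 : (0 < k)%N).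

(* Here [l] stands for [ln (eps^-1)], so that the cutoff is about
   eps^(-1/(k+4 sigma)), which balances the two requirements on it. *)
Definition cutoff : nat := (Num.truncn (expR (l / (k%:R + 4 * sigma)))).+1.

Let den_gt0 : 0 < k%:R + 4 * sigma.
Proof. have h := sigma_gt0; have : 0 <= k%:R :> R := ler0n _ _; lra. Qed.

Let le_expR (x : R) : x <= expR x.
Proof. have := expR_ge1Dx x; lra. Qed.

Lemma cutoff_le : cutoff%:R <= expR (1 + l / (k%:R + 4 * sigma)).
Proof.
have x0 : 0 <= l / (k%:R + 4 * sigma) by rewrite divr_ge0// ltW.
rewrite expRD /cutoff -natr1.
have h1 : 1 + 1 <= expR 1 :> R := expR_ge1Dx 1.
move: (l / _) x0 => x x0.
have h2 : 1 <= expR x by rewrite -[leLHS](expR0 R) ler_expR.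
have /andP[h3 _] := truncn_itv (expR_ge0 x).
have : 0 <= (expR 1 - 2) * expR x by rewrite mulr_ge0 ?expR_ge0//; lra.
lra.
Qed.

Lemma cutoff_ge : expR (l / (k%:R + 4 * sigma)) <= cutoff%:R.
Proof. by rewrite ltW// truncnS_gt. Qed.

(** With M the cutoff, the left side is M^(k + 4 sigma) eps^4, of order exp(l - 4l), up to factors
    exponential in [S]; the assumption on [3 * l] absorbs these factors. *)
Lemma cutoff_few (q : nat) (eps L S : R) : 1 <= S -> k%:R <= S ->
  0 < eps -> eps = expR (- l) -> 0 < L -> L <= expR (2 * S) ->
  (2 * sigma * (4 * pi ^+ 2 + 2 * q%:R + 3) + q%:R + 7) * S < 3 * l ->
  ((4 * pi ^+ 2 * (k%:R * (q * cutoff)%N%:R ^+ 2)) `^ sigma) ^+ 2 *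
  (expR 1 * (2 * (q * cutoff)%N%:R)) ^+ k * (4 * eps ^+ 4 * L) < 1.
Proof.
move=> S1 kS eps0 epsE L0 LS lbig; set x := l / (k%:R + 4 * sigma).
have sg := sigma_gt0.
have q0 : 0 <= q%:R :> R := ler0n _ _.
have qM : (q * cutoff)%N%:R <= expR (q%:R + 1 + x).
  rewrite natrM -addrA expRD; apply: ler_pM => //; exact: cutoff_le.
have two : 2 <= expR 1 :> R by have := expR_ge1Dx (1 : R); lra.
have h1 : ((4 * pi ^+ 2 * (k%:R * (q * cutoff)%N%:R ^+ 2)) `^ sigma) ^+ 2 <=
    expR (2 * sigma * (4 * pi ^+ 2 + k%:R + 2 * (q%:R + 1 + x))).
  have -> : 2 * sigma * (4 * pi ^+ 2 + k%:R + 2 * (q%:R + 1 + x)) =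
      2%:R * ((4 * pi ^+ 2 + k%:R + 2%:R * (q%:R + 1 + x)) * sigma) by lra.
  rewrite (expRM_natl 2) lerXn2r ?nnegrE ?powR_ge0 ?expR_ge0//.
  rewrite expRM; apply: ge0_ler_powR; rewrite ?nnegrE ?expR_ge0//.
  - exact: ltW.
  - by rewrite !mulr_ge0 ?pi_ge0.
  - rewrite -addrA expRD; apply: ler_pM => //; first by rewrite mulr_ge0// sqr_ge0.
    rewrite expRD; apply: ler_pM => //.
    by rewrite (expRM_natl 2) lerXn2r ?nnegrE ?expR_ge0.
have h2 : (expR 1 * (2 * (q * cutoff)%N%:R)) ^+ k <= expR ((q%:R + 3 + x) * k%:R).
  rewrite [X in _ <= expR X]mulrC expRM_natl lerXn2r ?nnegrE ?expR_ge0//.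
  have -> : q%:R + 3 + x = 1 + (1 + (q%:R + 1 + x)) by lra.
  rewrite expRD ler_wpM2l ?expR_ge0// expRD; exact: ler_pM.
have h3 : 4 * eps ^+ 4 * L <= expR (2 - 4 * l + 2 * S).
  have -> : 2 - 4 * l + 2 * S = (1 + 1) + 4%:R * (- l) + 2 * S by lra.
  rewrite !expRD (expRM_natl 4) -epsE; apply: ler_pM => //.
    by rewrite mulr_ge0// exprn_ge0// ltW.
    exact: ltW.
  rewrite ler_wpM2r ?exprn_ge0 ?(ltW eps0)//.
  have := ler_pM _ _ two two; rewrite !ler0n => /(_ isT isT); lra.
apply: (@le_lt_trans _ _ (expR (2 * sigma * (4 * pi ^+ 2 + k%:R + 2 * (q%:R + 1 + x)) +
  (q%:R + 3 + x) * k%:R + (2 - 4 * l + 2 * S)))).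
  move: h1 h2 h3; set e1 := 2 * sigma * _; set e2 := (_ + x) * _; set e3 := 2 - _ + _.
  move=> h1 h2 h3; rewrite expRD (expRD e1).
  have z0 : 0 <= (expR 1 * (2 * (q * cutoff)%N%:R)) ^+ k :> R.
    by rewrite exprn_ge0// !mulr_ge0 ?expR_ge0.
  by apply: ler_pM; rewrite ?mulr_ge0 ?powR_ge0 ?(ltW eps0) ?(ltW L0)//;
    apply: ler_pM; rewrite ?sqr_ge0.
rewrite -[ltRHS](expR0 R) ltr_expR.
have xE : x * (k%:R + 4 * sigma) = l by rewrite /x divfK// gt_eqF.
have p0 : 0 <= 4 * pi ^+ 2 :> R by rewrite mulr_ge0// sqr_ge0.
have g1 : 0 <= (2 * sigma * (4 * pi ^+ 2 + 2 * q%:R + 2) + 2) * (S - 1).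
  apply: mulr_ge0; last lra.
  by apply: addr_ge0 => //; apply: mulr_ge0; lra.
have g2 : 0 <= (2 * sigma + q%:R + 3) * (S - k%:R) by apply: mulr_ge0; lra.
move: (4 * pi ^+ 2) p0 g1 lbig => pp p0 g1 lbig; lra.
Qed.

(** M^(- k / 2) is at most exp(- l k / (2 (k + 4 sigma))), which is largest for k = 1, while the
    power of L is at most exp(3 (1 + S)). The condition on [l] leaves exp(- S), at most g / 8. *)
Lemma cutoff_small (L S g : R) : 1 <= S ->
  0 <= L -> L <= expR (2 * S) -> 0 < g -> 8 / g <= S ->
  8 * S <= l / (2 * (1 + 4 * sigma)) ->
  Num.sqrt (3 * L) ^+ 3 * Num.sqrt (2 / cutoff%:R ^+ k) <= g / 8.
Proof.
move=> S1 L0 LS g0 gS lbig; have sg := sigma_gt0.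
have two : 2 <= expR 1 :> R by have := expR_ge1Dx (1 : R); lra.
have h1 : Num.sqrt (3 * L) <= expR (1 + S).
  rewrite -[leRHS]ger0_norm ?expR_ge0// -sqrtr_sqr ler_wsqrtr//.
  rewrite -expRM_natl mulrDr mulr1 expRD; apply: ler_pM => //.
  by have := expR_ge1Dx (2 : R); lra.
have h2 : Num.sqrt (2 / cutoff%:R ^+ k) <= expR ((1 - l / (1 + 4 * sigma)) / 2).
  rewrite -[leRHS]ger0_norm ?expR_ge0// -sqrtr_sqr ler_wsqrtr//.
  rewrite -expRM_natl [X in _ <= expR X]mulrC divfK// expRD; apply: ler_pM => //.
  rewrite expRN lef_pV2 ?posrE ?expR_gt0 ?exprn_gt0 ?ltr0n//.
  apply: (@le_trans _ _ (expR (l / (k%:R + 4 * sigma)) ^+ k)); last first.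
    by rewrite lerXn2r ?nnegrE ?expR_ge0//; exact: cutoff_ge.
  rewrite -expRM_natl ler_expR.
  have s1 : 0 < 1 + 4 * sigma by lra.
  rewrite mulrA ler_pdivlMr// mulrAC ler_pdivrMr//.
  have k1 : 1 <= k%:R :> R by rewrite ler1n.
  have : 0 <= l * (4 * sigma * (k%:R - 1)) by rewrite !mulr_ge0//; lra.
  lra.
have h3 : Num.sqrt (3 * L) ^+ 3 <= expR (3%:R * (1 + S)).
  by rewrite expRM_natl lerXn2r ?nnegrE ?expR_ge0 ?sqrtr_ge0.
apply: le_trans (ler_pM _ _ h3 h2) _; rewrite ?exprn_ge0 ?sqrtr_ge0//.
rewrite -expRD; apply: (@le_trans _ _ (expR (- S))).
  rewrite ler_expR; move: lbig; rewrite invfM mulrA.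
  have -> : l / 2 / (1 + 4 * sigma) = l / (1 + 4 * sigma) / 2 by rewrite mulrAC.
  lra.
rewrite expRN -[leRHS]invf_div lef_pV2 ?posrE ?expR_gt0 ?divr_gt0//.
exact: le_trans gS (le_expR S).
Qed.
End Cutoff.

Lemma geometric_le (R : realType) (Q : R) (s : nat) : 0 <= Q <= 2^-1 ->
  \sum_(1 <= k < s.+1) Q ^+ k <= 2 * Q.
Proof.
move=> /andP[Q0 Q1].
suff h : \sum_(1 <= k < s.+1) Q ^+ k <= 2 * Q - 2 * Q ^+ s.+1.
  by apply: le_trans h _; rewrite gerBl mulr_ge0// exprn_ge0.
elim: s => [|s IH]; first by rewrite big_geq// expr1 subrr.
rewrite big_nat_recr//= [Q ^+ s.+2]exprS.
have : Q * Q ^+ s.+1 <= 2^-1 * Q ^+ s.+1 by rewrite ler_wpM2r// exprn_ge0.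
by move: (Q ^+ s.+1) IH => x IH; lra.
Qed.

Section TotalRisk.
Context (R : realType) (disp : measure_display) (T : measurableType disp)
  (P : probability T R) (d s : nat).
Context (xi : 'rV[int]_d -> {RV P >-> R}).
Hypothesis xi_iid : iid_std_normal (\bigcup_(u in subsets_upto s) freq_on u) xi.
Variables (sigma eps b B beta kappa delta : R) (rho tau : nat -> R).
Variables (rstar : nat -> nat -> R) (thetastar : nat -> 'rV[int]_d -> R).
Variables (r : nat -> R) (nu l : R) (q : nat).
Local Notation n k := (binr R d k).
Local Notation L k := (ln (binr R d k)).
Local Notation gap := (gap sigma nu).
Local Notation y := (ln (d%:R / s%:R) : R).
Hypotheses (sigma_gt0 : 0 < sigma) (eps_gt0 : 0 < eps) (nu_01 : 0 < nu <= 1).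
Hypotheses (b_gt0 : 0 < b) (B_lt1 : B < 1) (beta_bB : b <= beta <= B) (kappa_gt0 : 0 < kappa).
Hypothesis rhoP : forall k, (1 <= k <= s)%N ->
  [/\ 0 < rho k, rho k * L k <= 1 & 1 <= rho k * n k].
Hypothesis tauP : forall k, (1 <= k <= s)%N ->
  [/\ 0 < tau k, n k `^ (kappa / 8) <= tau k & 48 * tau k <= n k `^ (kappa / 2)].
Hypothesis starP : forall u : {set 'I_d}, subsets_upto s u ->
  forall m, (1 <= m <= grid_size b B rho #|u|)%N ->
  [/\ 0 < rstar #|u| m, detection sigma eps u (rstar #|u| m) =
        Num.sqrt (2 * grid b rho #|u| m * L #|u|) &
      is_minimizer sigma u (rstar #|u| m) (thetastar m)].
Hypotheses (q_big : 2 * (1 + K1 sigma) <= (q%:R ^+ 2 / 2) `^ sigma)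
  (delta_le1 : delta <= 1).
Hypothesis detected : forall u : {set 'I_d}, subsets_upto s u ->
  (1 + nu) * Num.sqrt (2 * beta * L #|u|) < detection sigma eps u (r #|u|).
Hypotheses (kappa_small : kappa <= b * gap)
  (kappa_le1 : kappa <= 1 - B) (kappa_gap : kappa <= gap ^+ 2 * b / 16).
Hypotheses (s_gt0 : (0 < s)%N) (sd : (s <= d)%N) (y_big : 1 <= 3 * y)
  (epsE : eps = expR (- l)) (lnd : ln d%:R <= expR (s%:R : R))
  (l_few : (2 * sigma * (4 * pi ^+ 2 + 2 * q%:R + 3) + q%:R + 7) * s%:R < 3 * l)
  (l_small : 8 * s%:R <= l / (2 * (1 + 4 * sigma)))
  (s_gap : 8 / gap <= s%:R)
  (Q_half : expR (- (kappa / 8 * y)) <= 2^-1).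

Let lnbin_ge k : (1 <= k <= s)%N -> k%:R * y <= L k.
Proof. by move=> ks; exact: ln_bin_ge. Qed.

Let lnbin_le k : (1 <= k <= s)%N -> L k <= expR (2 * s%:R).
Proof.
move=> /andP[k1 ks]; have d0 : 0 < d%:R :> R by rewrite ltr0n (leq_trans s_gt0).
apply: (@le_trans _ _ (k%:R * ln d%:R)).
  rewrite mulr_natl -lnXn// ler_ln ?posrE ?exprn_gt0 ?bin_le_exp//.
  by rewrite /binr ltr0n bin_gt0 (leq_trans ks).
have -> : 2 * s%:R = s%:R + s%:R :> R by lra.
have h : k%:R <= expR s%:R :> R.
  apply: (@le_trans _ _ s%:R); first by rewrite ler_nat.
  by have := expR_ge1Dx (s%:R : R); lra.
apply: (@le_trans _ _ (k%:R * expR s%:R)); first by rewrite ler_wpM2l.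
by rewrite expRD ler_wpM2r ?expR_ge0.
Qed.

(** All orders k share [nu], [q] and [kappa], and only the cutoff varies with k. The role of [S] in
    the cutoff bounds is played by s, through [L k <= expR (2 * s)]. *)
Lemma total_risk (eta : {set 'I_d} -> bool) (theta : 'rV[int]_d -> R) :
  sparse_classes beta delta s eta -> signals sigma s r theta ->
  ('E_P[fun w : T =>
     let x := observation eps eta theta (fun l => xi l w) in
     let etahat := selector sigma eps b B kappa rho tau rstar thetastar x in
     (\sum_(1 <= k < s.+1) n k `^ (beta - 1) * (hamming k etahat eta)%:R)%R]
   <= (risk_constant B * (2 * expR (- (kappa / 8 * y))))%:E)%E.
Proof.
move=> eta_in theta_in; have l0 : 0 <= l.
  have h : 0 <= s%:R * 8 :> R by rewrite mulr_ge0.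
  have s0 := sigma_gt0; have := l_small.
  by rewrite ler_pdivlMr; [have := mulr_ge0 h (ltW s0)|]; lra.
have S1 : 1 <= s%:R :> R by rewrite ler1n.
have gap0 : 0 < gap by case/andP : (gap_gt0_le1 sigma_gt0 nu_01).
have bound k : (1 <= k <= s)%N -> exists G : T -> R,
    (forall om, let x := observation eps eta theta (fun l => xi l om) in
       n k `^ (beta - 1) *
       (hamming k (selector sigma eps b B kappa rho tau rstar thetastar x) eta)%:R <= G om) /\
    mean_le P G (risk_constant B * expR (- (kappa / 8 * L k))).
  move=> ks; have /andP[k1 ks'] := ks.
  have [rho0 rho1 rho2] := rhoP ks; have [tau0 tau1 tau2] := tauP ks.
  have kyL := lnbin_ge ks; have LS := lnbin_le ks.
  have L_big : 1 <= 3 * L k.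
    have : 0 <= (k%:R - 1) * y by rewrite mulr_ge0 ?subr_ge0 ?ler1n//; have := y_big; lra.
    by have := y_big; lra.
  have L0 : 0 < L k by lra.
  have n0 : 0 < n k by rewrite /binr ltr0n bin_gt0 (leq_trans ks').
  have upto u : u \in subsets d k -> subsets_upto s u /\ #|u| = k.
    by rewrite inE => /eqP uk; rewrite /subsets_upto /= uk.
  rewrite /powR gt_eqF//= in tau1 tau2.
  apply: (@risk_bound R disp T P d k _ xi xi_iid k1 _ sigma eps b B beta kappa delta
    rho tau rstar thetastar (r k) nu eta theta q (cutoff sigma k l)) => //.
  - by move=> u v /upto[uk _] uv; exists u.
  - by move=> u m /upto[us uk] mP; have := starP us; rewrite uk; apply.
  - apply: (cutoff_few sigma_gt0 l0 S1) => //; first by rewrite ler_nat.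
  - exact: eta_in.
  - by move=> u /upto[us uk]; have := theta_in u us; rewrite uk.
  - by move=> u /upto[us uk]; have := detected us; rewrite uk.
  - by apply: (cutoff_small sigma_gt0 l0 k1 S1) => //; exact: ltW.
pose G0 k := if pselect (1 <= k <= s)%N is left h then sval (cid (bound k h)) else fun=> 0.
have G0P k : k \in index_iota 1 s.+1 ->
    (forall om, let x := observation eps eta theta (fun l => xi l om) in
       n k `^ (beta - 1) *
       (hamming k (selector sigma eps b B kappa rho tau rstar thetastar x) eta)%:R <= G0 k om) /\
    mean_le P (G0 k) (risk_constant B * expR (- (kappa / 8 * L k))).
  by rewrite mem_index_iota ltnS /G0; case: pselect => // h _; case: cid.
have [_ _ meanG] := mean_le_sum (fun k ks => (G0P k ks).2).
apply: le_trans (le_trans _ meanG) _.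
  apply: expectation_ge0_le => w.
    by apply: sumr_ge0 => k _; rewrite mulr_ge0 ?powR_ge0.
  cbv zeta; rewrite big_seq [leRHS]big_seq; apply: ler_sum => k ks; exact: (G0P k ks).1.
rewrite lee_fin -mulr_sumr ler_wpM2l//.
  by rewrite /risk_constant addr_ge0// mulr_ge0// mulr_ge0// exprn_ge0.
apply: le_trans (geometric_le s _); last by rewrite expR_ge0 Q_half.
rewrite big_seq [leRHS]big_seq; apply: ler_sum => k; rewrite mem_index_iota ltnS => ks.
rewrite -expRM_natl ler_expR mulrN lerN2 mulrCA ler_wpM2l ?lnbin_ge//.
by have := kappa_gt0; lra.
Qed.
End TotalRisk.

Lemma limf_esup_eq0 (R : realType) (F : set_system R) {FF : ProperFilter F}
    (f : R -> \bar R) :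
  (\forall x \near F, (0 <= f x)%E) ->
  (forall e : R, 0 < e -> \forall x \near F, (f x <= e%:E)%E) ->
  limf_esup f F = 0%E.
Proof.
move=> f0 fe; apply/eqP; rewrite limf_esupE eq_le; apply/andP; split.
  apply/lee_addgt0Pr => e e0; rewrite add0e; apply: ereal_inf_le.
  exists (ereal_sup (f @` [set x | (f x <= e%:E)%E])).
    by exists [set x | (f x <= e%:E)%E] => //; exact: fe.
  by apply: ge_ereal_sup => _ [x /= xe <-].
apply: le_ereal_inf_tmp => _ [V FV <-].
have [x [Vx fx]] := filter_ex (filterI FV f0).
by apply: (le_trans fx); apply: ereal_sup_ubound; exists x.
Qed.

(** Converts the strict inequality between a constant and a lower limit into a fixed margin valid
    near the limit, from which [nu] is computed. *)
Lemma limf_einf_gt (R : realType) (F : set_system R) {FF : Filter F}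
    (f : R -> \bar R) (c : R) : (c%:E < limf_einf f F)%E ->
  exists2 c' : R, c < c' & \forall x \near F, (c'%:E <= f x)%E.
Proof.
rewrite limf_einfE => /ereal_sup_gt[_ [V FV <-]].
case E : (ereal_inf _) => [x| |//] cx.
- exists x; first by rewrite -lte_fin.
  by apply: filterS FV => y Vy; rewrite -E; apply: ereal_inf_lbound; exists y.
- exists (c + 1); first by rewrite ltrDl.
  apply: filterS FV => y Vy; apply: le_trans (leey _) _; rewrite -E.
  by apply: ereal_inf_lbound; exists y.
Qed.

Lemma exists_indicator (I : finType) (A : {set I}) (m : nat) : (m <= #|A|)%N ->
  (\sum_(u in A) (u \in take m (enum A) : nat))%N = m.
Proof.
move=> mA; transitivity #|[set u in take m (enum A)]|.
  rewrite -sum1_card big_mkcond [RHS]big_mkcond/=; apply: eq_bigr => u _.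
  rewrite inE; case uA : (u \in A); case ut : (u \in take _ _) => //.
  by move: (mem_take ut); rewrite mem_enum uA.
rewrite cardsE (card_uniqP _) ?take_uniq ?enum_uniq// size_take -cardE.
by move: mA; rewrite leq_eqVlt => /orP[/eqP->|->//]; rewrite ltnn.
Qed.

Section Nonempty.
Variables (R : realType) (d s : nat).

(** A supremum over an empty class is -oo, so the value 0 of the upper limit requires inhabited
    classes. The vectors with exactly the truncated number of ones belong to the class, and this
    number is available since n^(1 - beta) <= n. *)
Lemma sparse_classes_nonempty (beta delta : R) : 0 < beta -> (s <= d)%N ->
  (forall k, (1 <= k <= s)%N -> forall eta : {set 'I_d} -> bool,
     (\sum_(u in subsets d k) (eta u : nat))%N = Num.truncn (binr R d k `^ (1 - beta)) ->
     sparse_class beta delta k eta) ->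
  exists eta : {set 'I_d} -> bool, sparse_classes beta delta s eta.
Proof.
move=> b0 sd large; pose m k := Num.truncn (binr R d k `^ (1 - beta)).
exists (fun u : {set 'I_d} => u \in take (m #|u|) (enum (subsets d #|u|))) => k ks.
apply: large => //; rewrite -[RHS](@exists_indicator _ (subsets d k)).
  by apply: eq_bigr => u; rewrite inE => /eqP ->.
have n1 : 1 <= binr R d k.
  by rewrite /binr ler1n bin_gt0; case/andP : ks => _ /leq_trans; apply.
rewrite card_draws card_ord -(@natrK R 'C(d, k)); apply: le_truncn.
by rewrite -[leRHS]powRr1// ler_powR// gerBl ltW.
Qed.

(** The witness puts the value r at the single frequency with coordinates 1 on the support; its
    energy r^2 ((2 pi)^sigma k^(sigma / 2))^2 is below 1 exactly in the assumed range of radii. *)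
Lemma signals_nonempty (sigma : R) (r : nat -> R) : 0 < sigma ->
  (forall k, (1 <= k <= s)%N -> 0 < r k /\
     r k < (2 * pi) `^ (- sigma) * k%:R `^ (- sigma / 2)) ->
  exists theta : 'rV[int]_d -> R, signals sigma s r theta.
Proof.
move=> sg rP; pose one (u : {set 'I_d}) : 'rV[int]_d := \row_j (j \in u : nat)%:Z.
exists (fun l => if l == one (fsupp l) then r #|fsupp l| else 0) => u us.
have oneP : freq_on u (one u).
  by move=> j; rewrite mxE; case: (j \in u).
have fu l : freq_on u l -> fsupp l = u by move/freq_onE.
have [r0 rlt] := rP _ us.
have supp (f : R -> 'rV[int]_d -> R) : (forall l, f 0 l = 0) -> (forall x l, 0 <= f x l) ->
    \esum_(l in freq_on u) (f (if l == one (fsupp l) then r #|fsupp l| else 0) l)%:E =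
    (f (r #|u|) (one u))%:E.
  move=> f0 fge; rewrite (@esum_supported _ _ _ [:: one u])//.
  - by rewrite big_seq1 (fu _ oneP) eqxx.
  - by move=> l; rewrite inE => /eqP ->.
  - by move=> l _; rewrite lee_fin.
  - by move=> l lu; rewrite inE (fu _ lu) => /negPf ->; rewrite f0.
split.
  rewrite (supp (fun x l => x ^+ 2 * csq sigma l)).
  - have k0 : 0 < #|u|%:R :> R by rewrite ltr0n; case/andP : us.
    have csq1 : csq sigma (one u) = ((2 * pi) `^ sigma * #|u|%:R `^ (sigma / 2)) ^+ 2.
      have tp : 0 < 2 * pi :> R by rewrite mulr_gt0// pi_gt0.
      rewrite /csq; have -> : \sum_j (2 * pi * (one u 0 j)%:~R) ^+ 2 =
          (2 * pi) ^+ 2 * #|u|%:R :> R.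
        rewrite -sum1_card natr_sum mulr_sumr [RHS]big_mkcond/=; apply: eq_bigr => j _.
        by rewrite mxE; case: (j \in u); rewrite ?mulr1// mulr0 expr0n.
      rewrite powRM ?sqr_ge0// [RHS]exprMn; congr (_ * _).
        move: (2 * pi) tp => x /ltW x0.
        by rewrite -(powR_mulrn 2 x0) -powRrM (mulrC 2%:R) powRrM powR_mulrn ?powR_ge0.
      by rewrite -powR_mulrn ?powR_ge0// -powRrM divfK.
    rewrite csq1 -exprMn lee_fin exprn_ile1 ?mulr_ge0 ?powR_ge0 ?(ltW r0)//.
    set X := (2 * pi) `^ sigma * _.
    have X0 : 0 < X by rewrite mulr_gt0// powR_gt0// ?mulr_gt0 ?pi_gt0.
    rewrite -ler_pdivlMr// mul1r; apply: (le_trans (ltW rlt)).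
    by rewrite /X invfM !powRN mulNr powRN.
  - by move=> l; rewrite expr0n mul0r.
  - by move=> x l; rewrite mulr_ge0 ?sqr_ge0 ?csq_ge0.
rewrite (supp (fun x l => x ^+ 2))//; last by move=> x l; exact: sqr_ge0.
by move=> l; rewrite expr0n.
Qed.
End Nonempty.

Lemma exists_natr_powR_ge (R : realType) (sigma z : R) : 0 < sigma ->
  0 <= z -> exists q : nat, z <= (q%:R ^+ 2 / 2) `^ sigma.
Proof.
move=> s0 z0; pose w := z `^ sigma^-1.
have [q q1 q2] : exists2 q : nat, 2 * w < q%:R & 1 <= q%:R :> R.
  by exists (Num.truncn (2 * w)).+1; [exact: truncnS_gt|rewrite ler1n].
exists q.
have zE : z = w `^ sigma by rewrite /w -powRrM mulVf ?gt_eqF// powRr1.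
rewrite [leLHS]zE; apply: ge0_ler_powR; rewrite ?nnegrE ?powR_ge0 ?divr_ge0 ?sqr_ge0//.
  exact: ltW.
have : q%:R <= q%:R ^+ 2 :> R by rewrite expr2 ler_peMr//; lra.
lra.
Qed.

Theorem theorem6 (R : realType)
  (b B sigma beta : R) (b_gt0 : 0 < b) (ltbB : b < B) (B_lt1 : B < 1)
  (beta_bB : b <= beta <= B) (sigma_gt0 : 0 < sigma)
  (* dimension and maximal sparsity order *)
  (d s : R -> nat)
  (d_oo : d eps @[eps --> 0^'+] --> \oo)
  (s_oo : s eps @[eps --> 0^'+] --> \oo)
  (s_od : (s eps)%:R / (d eps)%:R @[eps --> 0^'+] --> (0 : R))
  (s_olog : (s eps)%:R / ln (eps^-1) @[eps --> 0^'+] --> (0 : R))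
  (loglogd_os : ln (ln ((d eps)%:R)) / (s eps)%:R @[eps --> 0^'+] --> (0 : R))
  (eps_logd : eps ^+ 2 * ln ((d eps)%:R) `^ (1 + 2 * sigma)
                @[eps --> 0^'+] --> (0 : R))
  (* the noise *)
  (disp : R -> measure_display)
  (T : forall eps : R, measurableType (disp eps))
  (P : forall eps : R, probability (T eps) R)
  (xi : forall eps : R, 'rV[int]_(d eps) -> {RV (P eps) >-> R})
  (xi_iid : \forall eps \near 0^'+,
     iid_std_normal (\bigcup_(u in subsets_upto (s eps)) freq_on u) (xi eps))
  (* the slack in the thresholds *)
  (kappa : R -> R)
  (kappa_gt0 : \forall eps \near 0^'+, 0 < kappa eps)
  (kappa_to0 : kappa eps @[eps --> 0^'+] --> (0 : R))
  (kappa_log : kappa eps * ln ((d eps)%:R / (s eps)%:R)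
                 @[eps --> 0^'+] --> +oo)
  (* the grid steps *)
  (rho : R -> nat -> R)
  (rho_gt0 : \forall eps \near 0^'+,
     forall k, (1 <= k <= s eps)%N -> 0 < rho eps k)
  (rho_to0 : unif_cvg0 s rho)
  (rho_log : unif_cvg0 s (fun eps k => rho eps k * ln (binr R (d eps) k)))
  (rho_bin : unif_cvgy s (fun eps k => rho eps k * binr R (d eps) k))
  (* the normalizations of the Hamming thresholds *)
  (tau : R -> nat -> R)
  (tau_gt0 : \forall eps \near 0^'+,
     forall k, (1 <= k <= s eps)%N -> 0 < tau eps k)
  (tau_oo : unif_cvgy s tau)
  (tau_lower : unif_cvg0 s
     (fun eps k => binr R (d eps) k `^ (kappa eps / 8) / tau eps k))
  (tau_upper : unif_cvg0 s
     (fun eps k => tau eps k / binr R (d eps) k `^ (kappa eps / 2)))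
  (* the radii solving the detection equation and the minimizing sequences *)
  (rstar : R -> nat -> nat -> R)
  (rstarP : \forall eps \near 0^'+,
     forall u : {set 'I_(d eps)}, subsets_upto (s eps) u ->
     forall m, (1 <= m <= grid_size b B (rho eps) #|u|)%N ->
       0 < rstar eps #|u| m /\
       detection sigma eps u (rstar eps #|u| m) =
         Num.sqrt (2 * grid b (rho eps) #|u| m * ln (binr R (d eps) #|u|)))
  (thetastar : forall eps : R, nat -> 'rV[int]_(d eps) -> R)
  (thetastarP : \forall eps \near 0^'+,
     forall u : {set 'I_(d eps)}, subsets_upto (s eps) u ->
     forall m, (1 <= m <= grid_size b B (rho eps) #|u|)%N ->
       is_minimizer sigma u (rstar eps #|u| m) (thetastar eps m))
  (* the tolerance o(1) defining the sparsity classes *)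
  (delta : R -> R)
  (delta_to0 : delta eps @[eps --> 0^'+] --> (0 : R))
  (delta_large : \forall eps \near 0^'+,
     forall k, (1 <= k <= s eps)%N ->
     forall eta : {set 'I_(d eps)} -> bool,
       (\sum_(u in subsets (d eps) k) (eta u : nat))%N
         = Num.truncn (binr R (d eps) k `^ (1 - beta)) ->
       sparse_class beta (delta eps) k eta)
  (* the radii of the signals *)
  (r : R -> nat -> R)
  (r_range : \forall eps \near 0^'+,
     forall k, (1 <= k <= s eps)%N ->
       0 < r eps k /\
       r eps k < (2 * pi) `^ (- sigma) * k%:R `^ (- sigma / 2))
  (r_detect : ((Num.sqrt beta)%:E <
     limf_einf (fun eps : R =>
       ereal_inf [set (detection sigma eps u (r eps #|u|)
                       / Num.sqrt (2 * ln (binr R (d eps) #|u|)))%:E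
                 | u in @subsets_upto (d eps) (s eps)]) 0^'+)%E) :
  limf_esup (fun eps : R =>
    ereal_sup [set
      ereal_sup [set
        ('E_(P eps)[fun w : T eps =>
          let x := observation eps eta theta (fun l => xi eps l w) in
          let etahat := selector sigma eps b B (kappa eps) (rho eps) (tau eps)
                          (rstar eps) (thetastar eps) x in
          (\sum_(1 <= k < (s eps).+1)
            binr R (d eps) k `^ (beta - 1) * (hamming k etahat eta)%:R)%R])%E
      | theta in @signals R (d eps) sigma (s eps) (r eps)]
    | eta in sparse_classes beta (delta eps) (s eps)]) 0^'+ = 0%E.
Proof.
have /andP[b_beta _] := beta_bB; have beta0 : 0 < beta by exact: lt_le_trans b_beta.
have sb0 : 0 < Num.sqrt beta by rewrite sqrtr_gt0.
have [c beta_c detect_c] := limf_einf_gt r_detect.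
(* Half of the relative margin between [c] and the critical constant, capped at 1, so that a factor
   [1 + nu] still fits below [c]. *)
pose nu := Num.min 1 ((c / Num.sqrt beta - 1) / 2).
have cb1 : 1 < c / Num.sqrt beta by rewrite ltr_pdivlMr// mul1r.
have nu01 : 0 < nu <= 1.
  by rewrite /nu lt_min ltr01 ge_min lexx/= andbT; move: cb1; lra.
have nu_c : (1 + nu) * Num.sqrt beta < c.
  rewrite -ltr_pdivlMr//; have : nu <= (c / Num.sqrt beta - 1) / 2 by rewrite /nu ge_min lexx orbT.
  by move: cb1; lra.
have /andP[gap0 _] := gap_gt0_le1 sigma_gt0 nu01.
have [q q_big] : exists q : nat, 2 * (1 + K1 sigma) <= (q%:R ^+ 2 / 2) `^ sigma.
  by apply: exists_natr_powR_ge => //; have := K1_gt0 sigma_gt0; lra.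
have s_big (K : R) : \forall eps \near 0^'+, K <= (s eps)%:R.
  exact: s_oo (nbhs_infty_ger K).
have d_big (K : R) : \forall eps \near 0^'+, K <= (d eps)%:R.
  exact: d_oo (nbhs_infty_ger K).
have kappa_lt (e : R) : 0 < e -> \forall eps \near 0^'+, kappa eps <= e.
  move=> e0; near=> eps; apply/ltW/(le_lt_trans (ler_norm _)).
  near: eps; exact: cvgr0_norm_lt kappa_to0 _ e0.
have l_big (K : R) : 0 < K -> \forall eps \near 0^'+, K * (s eps)%:R <= ln eps^-1.
  move=> K0; have K0' : 0 < K^-1 by rewrite invr_gt0.
  near=> eps.
  have e0 : 0 < eps by near: eps; exact: nbhs_right_gt.
  have e1 : eps < 1 by near: eps; exact: nbhs_right_lt.
  have l0 : 0 < ln eps^-1 by rewrite ln_gt0// invf_gt1.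
  have : (s eps)%:R / ln eps^-1 < K^-1.
    apply: le_lt_trans (ler_norm _) _; near: eps; exact: cvgr0_norm_lt s_olog _ K0'.
  by rewrite ltr_pdivrMr// mulrC ltr_pdivlMr// mulrC => /ltW.
have sd_near : \forall eps \near 0^'+, (s eps <= d eps)%N /\
    1 <= ln ((d eps)%:R / (s eps)%:R) :> R.
  near=> eps.
  have s1 : 1 <= (s eps)%:R :> R by near: eps; exact: s_big.
  have d1 : 1 <= (d eps)%:R :> R by near: eps; exact: d_big.
  have : (s eps)%:R / (d eps)%:R < 4^-1 :> R.
    apply: le_lt_trans (ler_norm _) _.
    by near: eps; apply: cvgr0_norm_lt s_od _ _; rewrite invr_gt0.
  have dp : 0 < (d eps)%:R :> R by exact: lt_le_trans d1.
  have sp : 0 < (s eps)%:R :> R by exact: lt_le_trans s1.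
  rewrite ltr_pdivrMr// => h; split; first by rewrite -(ler_nat R); move: dp h; clear; lra.
  rewrite -[leLHS]expRK ler_ln ?posrE ?expR_gt0 ?divr_gt0//.
  by apply: le_trans (expR1_le4 R) _; rewrite ler_pdivlMr//; move: h; clear; lra.
have lnd_near : \forall eps \near 0^'+, ln (d eps)%:R <= expR (s eps)%:R :> R.
  near=> eps.
  have s1 : 1 <= (s eps)%:R :> R by near: eps; exact: s_big.
  have d1 : 4 <= (d eps)%:R :> R by near: eps; exact: d_big.
  have : ln (ln (d eps)%:R) / (s eps)%:R < 1 :> R.
    apply: le_lt_trans (ler_norm _) _; near: eps; exact: cvgr0_norm_lt loglogd_os _ ltr01.
  rewrite ltr_pdivrMr ?mul1r; last exact: lt_le_trans s1.
  have lnd0 : 0 < ln (d eps)%:R :> R by rewrite ln_gt0// (lt_le_trans _ d1)// ltr1n.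
  by move=> /ltW h; rewrite -[leLHS](lnK lnd0) ler_expR.
have bound e : 0 < e -> \forall eps \near 0^'+, forall eta theta,
    sparse_classes beta (delta eps) (s eps) eta -> signals sigma (s eps) (r eps) theta ->
    ('E_(P eps)[fun w : T eps =>
          let x := observation eps eta theta (fun l => xi eps l w) in
          let etahat := selector sigma eps b B (kappa eps) (rho eps) (tau eps)
                          (rstar eps) (thetastar eps) x in
          (\sum_(1 <= k < (s eps).+1)
            binr R (d eps) k `^ (beta - 1) * (hamming k etahat eta)%:R)%R] <= e%:E)%E.
  move=> e0; pose C := risk_constant B.
  have C0 : 0 <= C by rewrite /C /risk_constant addr_ge0// !mulr_ge0// exprn_ge0.
  (* The second summand makes the final bound [C * (2 * A^-1)] at most [e]; the first keeps the
     ratio of the geometric series at most 1/2. *)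
  pose A := 2 + 2 * C / e.
  have A2 : 2 <= A by rewrite /A lerDl divr_ge0 ?mulr_ge0// ltW.
  have AC : 2 * C <= A * e by rewrite -ler_pdivrMr// /A lerDr.
  pose K := (2 * sigma * (4 * pi ^+ 2 + 2 * q%:R + 3) + q%:R + 7).
  have K0 : 0 < K.
    rewrite /K ltr_wpDl// addr_ge0// mulr_ge0 ?mulr_ge0 ?(ltW sigma_gt0)//.
    have p0 : 0 <= 4 * pi ^+ 2 :> R by rewrite mulr_ge0// sqr_ge0.
    have q0 : 0 <= 2 * q%:R :> R by rewrite mulr_ge0.
    by rewrite addr_ge0// addr_ge0.
  near=> eps => eta theta eta_in theta_in.
  have eps0 : 0 < eps by near: eps; exact: nbhs_right_gt.
  have [sd y1] : (s eps <= d eps)%N /\ 1 <= ln ((d eps)%:R / (s eps)%:R) :> R by near: eps.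
  have s1 : 1 <= (s eps)%:R :> R by near: eps; exact: s_big.
  have s_gt0 : (0 < s eps)%N by rewrite -(ler_nat R).
  (* With this bound the ratio is at most exp(- A) <= 1 / A. *)
  have ky : 8 * A <= kappa eps * ln ((d eps)%:R / (s eps)%:R).
    by near: eps; move/cvgryPge : kappa_log; apply.
  have kap0 : 0 < kappa eps by near: eps.
  have Qle : expR (- (kappa eps / 8 * ln ((d eps)%:R / (s eps)%:R))) <= A^-1.
    rewrite expRN lef_pV2 ?posrE ?expR_gt0//; last exact: lt_le_trans A2.
    apply: le_trans (expR_ge1Dx _); move: ky; clear; lra.
  have xi_eps : iid_std_normal (\bigcup_(u in subsets_upto (s eps)) freq_on u) (xi eps).
    by near: eps.
  apply: le_trans (@total_risk R (disp eps) (T eps) (P eps) (d eps) (s eps) (xi eps) xi_eps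
    sigma eps b B beta (kappa eps) (delta eps) (rho eps) (tau eps) (rstar eps) (thetastar eps)
    (r eps) nu (ln eps^-1) q sigma_gt0 eps0 nu01 b_gt0 B_lt1 beta_bB kap0
    _ _ _ q_big _ _ _ _ _ s_gt0 sd _ _ _ _ _ _ _ eta theta eta_in theta_in) _.
  - move=> k ks; split.
    + by move: k ks; near: eps.
    + by apply: le_trans (ler_norm _) (ltW _); move: k ks; near: eps; exact: rho_log _ ltr01.
    + by apply: ltW; move: k ks; near: eps; exact: rho_bin.
  - move=> k ks.
    have n0 : 0 < binr R (d eps) k.
      by rewrite /binr ltr0n bin_gt0; case/andP : ks => _ /leq_trans; apply.
    have t0 : 0 < tau eps k by move: k ks {n0}; near: eps.
    split=> //.
      have : binr R (d eps) k `^ (kappa eps / 8) / tau eps k < 1.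
        apply: le_lt_trans (ler_norm _) _; move: k ks {n0 t0}.
        by near: eps; exact: tau_lower _ ltr01.
      by rewrite ltr_pdivrMr// mul1r => /ltW.
    have : tau eps k / binr R (d eps) k `^ (kappa eps / 2) < 48^-1 :> R.
      apply: le_lt_trans (ler_norm _) _; move: k ks {n0 t0}.
      by near: eps; apply: tau_upper; rewrite invr_gt0.
    rewrite ltr_pdivrMr ?powR_gt0//.
    by move: (tau _ _) (_ `^ _) => t p; clear; lra.
  - move=> u us m mP.
    have [r0 rE] : 0 < rstar eps #|u| m /\ detection sigma eps u (rstar eps #|u| m) =
         Num.sqrt (2 * grid b (rho eps) #|u| m * ln (binr R (d eps) #|u|)).
      by move: u us m mP; near: eps.
    by split=> //; move: u us m mP {r0 rE}; near: eps.
  - have : `|delta eps| < 1 by near: eps; exact: cvgr0_norm_lt delta_to0 _ ltr01.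
    by move/ltW; apply: le_trans; exact: ler_norm.
  - move=> u us.
    have L0 : 0 < ln (binr R (d eps) #|u|).
      have /andP[u1 _] := us.
      apply: lt_le_trans (ln_bin_ge R us sd).
      by rewrite mulr_gt0 ?ltr0n// (lt_le_trans ltr01 y1).
    have S0 : 0 < Num.sqrt (2 * ln (binr R (d eps) #|u|)) by rewrite sqrtr_gt0 mulr_gt0.
    have : (c%:E <= ereal_inf [set (detection sigma eps u (r eps #|u|) /
        Num.sqrt (2 * ln (binr R (d eps) #|u|)))%:E | u in @subsets_upto (d eps) (s eps)])%E.
      by near: eps.
    move=> cle; have := le_trans cle (ereal_inf_lbound (imageP _ us)).
    rewrite lee_fin ler_pdivlMr//; apply: lt_le_trans.
    by rewrite -mulrA mulrCA sqrtrM ?(ltW beta0)// mulrA ltr_pM2r.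
  - by near: eps; apply: kappa_lt; rewrite mulr_gt0.
  - by near: eps; apply: kappa_lt; rewrite subr_gt0.
  - by near: eps; apply: kappa_lt; rewrite divr_gt0// mulr_gt0// exprn_gt0.
  - by move: y1; clear; lra.
  - by rewrite lnV ?posrE// opprK lnK.
  - by near: eps.
  - have : K * (s eps)%:R <= ln eps^-1 by near: eps; exact: l_big.
    have : 0 < K * (s eps)%:R by rewrite mulr_gt0// ltr0n.
    rewrite -/K; clear; lra.
  - have t0 : 0 < 2 * (1 + 4 * sigma) by rewrite mulr_gt0// addr_gt0// mulr_gt0.
    rewrite ler_pdivlMr// mulrAC; near: eps; apply: l_big.
    by rewrite mulr_gt0 ?mulr_gt0 ?addr_gt0 ?mulr_gt0.
  - by near: eps; exact: s_big.
  - by apply: le_trans Qle _; rewrite lef_pV2 ?posrE ?(lt_le_trans _ A2).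
  rewrite lee_fin; apply: (@le_trans _ _ (C * (2 * A^-1))); first by rewrite ler_wpM2l// ler_wpM2l.
  rewrite mulrA (mulrC C) ler_pdivrMr; last exact: lt_le_trans A2.
  by rewrite [e * A]mulrC.
apply: limf_esup_eq0.
  near=> eps.
  have [sd _] : (s eps <= d eps)%N /\ 1 <= ln ((d eps)%:R / (s eps)%:R) :> R by near: eps.
  have [eta eta_in] : exists eta : {set 'I_(d eps)} -> bool,
      sparse_classes beta (delta eps) (s eps) eta.
    by apply: sparse_classes_nonempty => //; near: eps.
  have [theta theta_in] : exists theta : 'rV[int]_(d eps) -> R,
      signals sigma (s eps) (r eps) theta.
    by apply: signals_nonempty => //; near: eps.
  apply: le_trans (ereal_sup_ubound _); last by exists eta => //; reflexivity.
  apply: le_trans (ereal_sup_ubound _); last by exists theta => //; reflexivity.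
  rewrite unlock; apply: integral_ge0 => w _.
  by rewrite lee_fin sumr_ge0// => k _; rewrite mulr_ge0// powR_ge0.
move=> e e0; apply: filterS (bound e e0) => eps h.
apply: ge_ereal_sup => _ [eta eta_in <-]; apply: ge_ereal_sup => _ [theta theta_in <-].
exact: h.
Unshelve. all: by end_near.
Qed.
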